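(* Let $n \ge 0$ be an integer. There exists a linear embedding of the graph $K_{3,3,1}$ in $\mathbb{R}^3$ that contains exactly $n$ nontrivial 2-component links if and only if $n \in \{1,2,3,4,5\}$.
   Context: $K_{3,3,1}$ is the complete tripartite graph on $3+3+1$ vertices. A linear embedding of a graph is an embedding in $\mathbb{R}^3$ in which every edge is a straight line segment. A 2-component link in an embedded graph is an unordered pair of disjoint cycles of the graph, regarded as a link in $\mathbb{R}^3$ (in $K_{3,3,1}$ there are nine such pairs, each consisting of a triangle through the degree-6 vertex and the 4-cycle on the remaining four vertices). A 2-component link is trivial if it is ambient isotopic to two disjoint round circles in a plane bounding disjoint disks, and nontrivial otherwise. *)

(* Defs.v *)
From HB Require Import structures.
From mathcomp Require Import all_boot all_order all_algebra.
Set Implicit Arguments.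
Unset Strict Implicit.
Unset Printing Implicit Defensive.
Import Order.TTheory GRing.Theory Num.Theory.

(* A finite simple graph is a symmetric irreflexive relation on a finType.    *)

Definition K331_vertex : finType := ('I_3 + 'I_3 + 'I_1)%type.

Definition K331_part (v : K331_vertex) : nat :=
  match v with
  | inl (inl _) => 0
  | inl (inr _) => 1
  | inr _ => 2
  end.

Definition K331 : rel K331_vertex :=
  fun u v => K331_part u != K331_part v.

Section Cycles.
Variables (T : finType) (e : rel T).

(* A cycle is a subgraph, recorded by its set of edges, so that it carries    *)
(* neither a base point nor an orientation.                                   *)
Definition cycle_edges (c : seq T) : {set {set T}} :=
  [set [set x; next c x] | x in c].

Definition graph_cycle (C : {set {set T}}) : Prop :=
  exists c : seq T, [/\ ucycle e c, 3 <= size c & C = cycle_edges c].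

(* [cover C] is the vertex set of the cycle [C].                              *)
Definition two_link (L : {set {set {set T}}}) : Prop :=
  exists C1 C2 : {set {set T}},
    [/\ graph_cycle C1, graph_cycle C2,
        [disjoint cover C1 & cover C2] & L = [set C1; C2]].

End Cycles.

From mathcomp Require Import all_classical all_reals all_analysis.
Import numFieldNormedType.Exports.
Local Open Scope classical_set_scope.
Local Open Scope ring_scope.

Section Space.
Variable R : realType.

(* The topology of ['rV[R]_3] comes from the sup norm; it is the usual one.   *)
Local Notation E3 := 'rV[R]_3.

Definition segment (a b : E3) : set E3 :=
  [set (1 - t) *: a + t *: b | t in `[0, 1]].

(* Injectivity on the geometric realization of the graph of the map which is  *)
(* [f] on vertices and affine on edges.                                       *)
Definition linear_embedding (T : finType) (e : rel T) (f : T -> E3) : Prop :=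
  [/\ injective f,
      (forall w u v : T, e u v -> segment (f u) (f v) (f w) ->
         w \in [set u; v]%SET)
    & (forall u v x y : T, e u v -> e x y ->
         [set u; v]%SET != [set x; y]%SET ->
         forall p : E3, segment (f u) (f v) p -> segment (f x) (f y) p ->
         exists2 w : T, w \in ([set u; v] :&: [set x; y])%SET & p = f w)].

(* [cover L] is the set of all edges of the cycles in [L].                    *)
Definition link_support (T : finType) (f : T -> E3) (L : {set {set {set T}}}) :
    set E3 :=
  [set p | exists u v : T, [set u; v]%SET \in finset.cover L /\
                           segment (f u) (f v) p].

Definition homeomorphism (h : E3 -> E3) : Prop :=
  exists g : E3 -> E3,
    [/\ cancel h g, cancel g h, continuous h & continuous g].

Definition ambient_isotopic (A B : set E3) : Prop :=
  exists H : R -> E3 -> E3,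
    [/\ {within `[0, 1] `*` setT, continuous (fun tx : R * E3 => H tx.1 tx.2)},
        (forall t : R, t \in `[0, 1] -> homeomorphism (H t)),
        (forall x : E3, H 0 x = x)
      & H 1 @` A = B].

Definition dot (x y : E3) : R := (x *m y^T) 0 0.

(* The circle and the closed disk with centre [c] and radius [r] in the plane *)
(* through [c] orthogonal to [nu].                                            *)
Definition circle3 (nu c : E3) (r : R) : set E3 :=
  [set x | dot nu (x - c) = 0 /\ dot (x - c) (x - c) = r ^+ 2].

Definition disk3 (nu c : E3) (r : R) : set E3 :=
  [set x | dot nu (x - c) = 0 /\ dot (x - c) (x - c) <= r ^+ 2].

Definition planar_unlink (U : set E3) : Prop :=
  exists (nu c1 c2 : E3) (r1 r2 : R),
    [/\ nu != 0, dot nu (c2 - c1) = 0, 0 < r1 /\ 0 < r2,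
        disk3 nu c1 r1 `&` disk3 nu c2 r2 = set0
      & U = circle3 nu c1 r1 `|` circle3 nu c2 r2].

Definition trivial_link (A : set E3) : Prop :=
  exists2 U : set E3, planar_unlink U & ambient_isotopic A U.

Definition nontrivial_links (T : finType) (e : rel T) (f : T -> E3) :
    {set {set {set {set T}}}} :=
  [set L : {set {set {set T}}} |
     `[< two_link e L /\ ~ trivial_link (link_support f L) >]]%SET.

End Space.

(* Main.v *)
(** A linear embedding can be perturbed into general position without changing the isotopy class
of any of its nine links, because a linear embedding and all straight-line maps close to it are
related by small displacements with Lipschitz constant below 1. In general position, a link formed
by a triangle T and a quadrilateral Q is trivial if and only if the signed number of the edges of Q
piercing T vanishes. When it vanishes, Q can be moved off T along explicit paths of
quadrilaterals, and far apart pieces are shrunk and rounded to circles. Conversely, this number is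
the degree of the map (t, s) |-> t - s from T x Q to R^3 minus the origin; the degree is computed on
a fine grid with a labelling of the directions by the vertices of a tetrahedron, so that it is
visibly invariant under an isotopy, and it vanishes when the two components are separated by a plane.

The number of nontrivial links is then a function of the orientations of the quadruples of
vertices, which are constrained by the three-term Grassmann-Pluecker relations. Seen from the
apex p of degree 6, every crossing of two disjoint edges of K_{3,3} yields exactly one edge piercing
one triangle. Hence, if the number c of crossings is odd and at most 5, then between 1 and 5 links
are nontrivial. An exhaustive search over the orientations of the quadruples containing p disposes
of these cases; in the remaining ones the search goes on over the orientations of the quadruples
with two vertices in each part of K_{3,3}. *)
From HB Require Import structures.
Require Import Defs.
From mathcomp Require Import all_boot all_order all_algebra.
From mathcomp Require Import ring lra zify.
Set Implicit Arguments.
Unset Strict Implicit.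
Unset Printing Implicit Defensive.

(** * Sign vectors of seven points *)

(** Nontriviality has to withstand arbitrary continuous isotopies, so the invariant must make sense
    for loops that are merely continuous; a count of piercings is defined for polygons only, and
    this is what the degree on a grid is for. The converse can stay elementary because at most four
    edges pierce a flat triangle: if any do and the signed number vanishes, then either two
    consecutive edges pierce and their common corner can be pulled back, or two opposite edges
    pierce and can be slid through the triangle together. After that, a component which bounds a
    disk missed by the other one may be replaced by an arbitrarily small copy of itself, and only
    the motion of two points is left.

    Of the 35 orientations only 29 enter the piercings: no triangle through p and disjoint edge of
    the 4-cycle involve, without p, three vertices of one part and one of the other. The search is
    cut after the 20 that contain p because c depends on them alone. Two of these are fixed by a
    mirror image and by an exchange of two vertices, so 18 remain. *)

Section sorting.
Variable T : Type.
Definition cswap (k : bool -> nat -> nat -> T) (s : bool) (x y : nat) : T :=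
  if y < x then k (~~ s) y x else k s x y.
End sorting.

(** A sorting network with five comparators; the Boolean is the parity of the exchanges. That the
    output is sorted is never proved: [val_litE] only asks that it occurs in [quads]. *)
Definition sort4 (a b c d : nat) : bool * seq nat :=
  cswap (fun s a b => cswap (fun s c d => cswap (fun s a c => cswap (fun s b d =>
    cswap (fun s b c => (s, [:: a; b; c; d])) s b c) s b d) s a c) s c d) false a b.

Definition cone_quads : seq (seq nat) :=
  flatten [seq flatten [seq [seq [:: x; y; z; 6] | z <- iota y.+1 (5 - y)]
    | y <- iota x.+1 (5 - x)] | x <- iota 0 6].
Definition square_quads : seq (seq nat) :=
  [seq xy ++ zw | xy <- [:: [:: 0; 1]; [:: 0; 2]; [:: 1; 2]],
                  zw <- [:: [:: 3; 4]; [:: 3; 5]; [:: 4; 5]]].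
(* The first two orientations are fixed by the symmetries of the problem. *)
Definition fixed_quads : seq (seq nat) := [:: [:: 0; 1; 2; 6]; [:: 3; 4; 5; 6]].
Definition quads := fixed_quads ++ [seq s <- cone_quads | s \notin fixed_quads] ++ square_quads.

(** The six quadruples with three vertices in one part and one in the other are not in [quads] and
    get the index 29, its size. Soundness always asks for an index below 29. *)
Definition lit (a b c d : nat) : nat * bool :=
  let: (s, q) := sort4 a b c d in (index q quads, s).

(* A partial assignment of the variables; a lookup takes five steps. *)
Inductive trie := Leaf of bool | Node of trie & trie.

Fixpoint get (t : trie) (p : seq bool) : bool :=
  match t, p with
  | Leaf b, _ => b
  | Node l r, b :: p' => if b then get r p' else get l p'
  | Node _ _, [::] => false
  end.

(** A leaf is a constant assignment on all addresses below it, hence the two copies of [t] when it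
    is split. *)
Fixpoint put (t : trie) (p : seq bool) (v : bool) : trie :=
  if p is b :: p' then
    let: (l, r) := if t is Node l r then (l, r) else (t, t) in
    if b then Node l (put r p' v) else Node (put l p' v) r
  else Leaf v.

Definition address (i : nat) : seq bool :=
  [:: odd i; odd i./2; odd i./2./2; odd i./2./2./2; odd i./2./2./2./2].

Notation literal := (seq bool * bool)%type.
Definition place (l : nat * bool) : literal := (address l.1, l.2).
Definition eval (t : trie) (l : literal) : bool := l.2 (+) get t l.1.

Section terms.
Variable A : Type.
Definition term := (A * A * bool)%type.
Definition clause := (term * term * term)%type.
Variable ev : A -> bool.
Definition tval (t : term) : bool := t.2 (+) (ev t.1.1 (+) ev t.1.2).
(** The three summands of a Grassmann-Pluecker relation add up to zero, so their signs cannot all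
    agree. *)
Definition violated (c : clause) : bool :=
  let x := tval c.1.1 in
  if x (+) tval c.1.2 then false else ~~ (x (+) tval c.2).
(* [has] is strict in the virtual machine. *)
Fixpoint has_violated (C : seq clause) : bool :=
  if C is c :: C' then if violated c then true else has_violated C' else false.
End terms.

Definition tmax (t : term (nat * bool)) : nat := maxn t.1.1.1 t.1.2.1.
Definition cmax (c : clause (nat * bool)) : nat := maxn (tmax c.1.1) (maxn (tmax c.1.2) (tmax c.2)).
Definition tmap A B (f : A -> B) (t : term A) : term B := (f t.1.1, f t.1.2, t.2).
Definition cmap A B (f : A -> B) (c : clause A) : clause B :=
  (tmap f c.1.1, tmap f c.1.2, tmap f c.2).

Section plucker.
Variable A : Type.
Variable q : nat -> nat -> nat -> nat -> A.
Definition plucker (x1 x2 y1 y2 y3 y4 : nat) : clause A :=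
  ((q x1 x2 y1 y2, q x1 x2 y3 y4, false), (q x1 x2 y1 y3, q x1 x2 y2 y4, true),
   (q x1 x2 y1 y4, q x1 x2 y2 y3, false)).

Definition pluck (s : seq nat) : clause A :=
  plucker (nth 0 s 0) (nth 0 s 1) (nth 0 s 2) (nth 0 s 3) (nth 0 s 4) (nth 0 s 5).
End plucker.

Definition pluckers : seq (seq nat) :=
  flatten [seq flatten [seq
    let r := [seq z <- iota 0 7 | (z != x1) && (z != x2)] in
    [seq [:: x1; x2] ++ rem z r | z <- r] | x2 <- iota x1.+1 (6 - x1)] | x1 <- iota 0 7].

(** A clause is filed under its last variable, so that it is tested as soon as all its variables
    have values. *)
Definition clauses (n : nat) : seq (clause literal) :=
  [seq cmap place c | c <- map (pluck lit) pluckers & cmax c == n].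

(** A branch succeeds by violating a clause or by passing [K], and both values of each variable must
    succeed. The conditionals stop at the first failure. *)
Fixpoint search (n : nat) (L : seq (seq (clause literal))) (K : trie -> bool) (t : trie) :=
  if L is C :: L' then
    let p := address n in
    let try b := let t' := put t p b in
      if has_violated (eval t') C then true else search n.+1 L' K t' in
    if try false then try true else false
  else K t.

(* Orientations of [t0 t1 t2 a], [t0 t1 t2 b], [a b t0 t1], [a b t1 t2], [a b t2 t0]. *)
Definition piercing (sa sb v0 v1 v2 : bool) : bool :=
  [&& sa (+) sb, ~~ (v0 (+) sb), ~~ (v1 (+) sb) & ~~ (v2 (+) sb)].

Section edges.
Variable T : Type.
Variable q : nat -> nat -> nat -> nat -> T.
Definition edge := (T * T * (T * T * T) * bool)%type.

Definition edge_of (i j k l : nat) (flip : bool) : edge :=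
  (q 6 i j k, q 6 i j l, (q k l 6 i, q k l i j, q k l j 6), flip).

Definition others (i : nat) : nat * nat := nth (0, 0) [:: (1, 2); (0, 2); (0, 1)] i.

(* The edges of the 4-cycle alternately leave and enter the first part. *)
Definition link_edges (i j : nat) : seq edge :=
  let: (k, m) := others i in let: (l, n) := others j in
  [:: edge_of i (3 + j) k (3 + l) false; edge_of i (3 + j) m (3 + l) true;
      edge_of i (3 + j) m (3 + n) false; edge_of i (3 + j) k (3 + n) true].

Definition links : seq (nat * nat) := [seq (i, j) | i <- iota 0 3, j <- iota 0 3].
Definition all_edges : seq (seq edge) := [seq link_edges ij.1 ij.2 | ij <- links].

Definition cross_of (i j k l : nat) : T * T * T * T :=
  (q 6 i j k, q 6 i j l, q 6 k l i, q 6 k l j).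

Definition all_crosses : seq (T * T * T * T) :=
  [seq cross_of ik.1 jl.1 ik.2 jl.2 | ik <- [:: (0, 1); (0, 2); (1, 2)],
     jl <- [:: (3, 4); (4, 3); (3, 5); (5, 3); (4, 5); (5, 4)]].
End edges.

Definition pierced (e : edge bool) : bool :=
  let: (sa, sb, (v0, v1, v2), f) := e in piercing sa sb v0 v1 v2.
Definition sign (e : edge bool) : bool := e.1.1.1 (+) e.2.

Definition unbalanced (T : Type) (p s : T -> bool) (r : seq T) : bool :=
  ~~ eqn (count (fun e => p e && s e) r) (count (fun e => p e && ~~ s e) r).

Definition nlinked (s : seq (seq (edge bool))) : nat := count (unbalanced pierced sign) s.

(** The four determinants are, up to sign, the coefficients of the linear relation between the
    vectors from the apex to [i], [j], [k], [l]. These signs put [i], [j] on one side of the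
    relation and [k], [l] on the other: the cones over the two edges meet. *)
Definition crossing (s1 s2 s3 s4 : bool) : bool :=
  [&& s1 (+) s2, ~~ (s3 (+) s2) & ~~ (s4 (+) s1)].

(* A piercing is decided by the cone at the apex up to the orientation of a square. *)
Definition residual (t : trie) (e : edge literal) : seq (literal * bool) :=
  let: (sa, sb, (v0, v1, v2), f) := e in
  let b := eval t sb in
  if eval t sa (+) b then
    if eval t v0 (+) b then [::] else
    if eval t v2 (+) b then [::] else [:: ((v1.1, v1.2 (+) ~~ b), ~~ b (+) f)]
  else [::].

Definition emap A B (f : A -> B) (e : edge A) : edge B :=
  let: (sa, sb, (v0, v1, v2), s) := e in (f sa, f sb, (f v0, f v1, f v2), s).

Definition xmap A B (f : A -> B) (c : A * A * A * A) : B * B * B * B :=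
  let: (s1, s2, s3, s4) := c in (f s1, f s2, f s3, f s4).

Definition eval_cross (t : trie) (c : literal * literal * literal * literal) : bool :=
  let: (s1, s2, s3, s4) := c in
  crossing (eval t s1) (eval t s2) (eval t s3) (eval t s4).

(** An odd number of piercings leaves some link unbalanced, and the number of unbalanced links is at
    most that of piercings. *)
Definition good_cone X (t : trie) : bool :=
  let c := count (eval_cross t) X in if odd c then c <= 5 else false.

Definition good_full (R : seq (seq (literal * bool))) (t : trie) : bool :=
  let n := count (unbalanced (fun e => eval t e.1) snd) R in if n <= 5 then 0 < n else false.

Definition full_search : bool :=
  let X := map (xmap place) (all_crosses lit) in
  let E := map (map (emap place)) (all_edges lit) in
  let L1 := [seq clauses i | i <- iota 2 18] in
  let L2 := [seq clauses i | i <- iota 20 9] in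
  search 2 L1 (fun t => if good_cone X t then true else
    let R := [seq flatten [seq residual t e | e <- s] | s <- E] in
    search 20 L2 (good_full R) t) (Leaf false).

Lemma full_searchT : full_search.
(* The evaluation is left to the check at [Qed], so that it runs only once. *)
Proof. by vm_cast_no_check (erefl true). Qed.

Lemma get_put t p q v : size p = size q -> get (put t p v) q = if p == q then v else get t q.
Proof.
elim: p q t => [|b p IH] [|c q] t //= [e].
have E : (b :: p == c :: q) = (b == c) && (p == q) by [].
rewrite E {E}; case: t => [a|l r] /=; case: b; case: c => //=; rewrite ?IH //; case: (p == q) => //.
all: by case: q {IH e}.
Qed.

Lemma address_inj i j : i < 32 -> j < 32 -> (address i == address j) = (i == j).
Proof.
have : all (fun i => all (fun j => (address i == address j) == (i == j)) (iota 0 32)) (iota 0 32).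
  by vm_compute.
move=> /allP H hi hj; have /allP H' := H i ltac:(by rewrite mem_iota).
by have := H' j; rewrite mem_iota => /(_ hj) /eqP.
Qed.

Definition valid4 a b c d := uniq [:: a; b; c; d] && all (fun x => x < 7) [:: a; b; c; d].
Definition valid6 a b c d e f :=
  uniq [:: a; b; c; d; e; f] && all (fun x => x < 7) [:: a; b; c; d; e; f].

Definition valid_plucker (s : seq nat) : bool :=
  if s is [:: x1; x2; y1; y2; y3; y4] then
    [&& valid6 x1 x2 y1 y2 y3 y4, valid4 x1 x2 y1 y2, valid4 x1 x2 y3 y4, valid4 x1 x2 y1 y3,
        valid4 x1 x2 y2 y4, valid4 x1 x2 y1 y4 & valid4 x1 x2 y2 y3]
  else false.

Lemma valid_pluckers : all valid_plucker pluckers.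
Proof. by vm_compute. Qed.

Lemma valid4_swap a b c d : valid4 a b c d ->
  [/\ valid4 b a c d, valid4 a c b d & valid4 a b d c].
Proof. by rewrite /valid4 /= !inE; split; lia. Qed.

(* The signs of the bases of a uniform oriented matroid of rank 4 on seven points. *)
Definition chirotope (v : nat -> nat -> nat -> nat -> bool) : Prop :=
  [/\ forall a b c d, valid4 a b c d -> v a b c d = ~~ v b a c d,
      forall a b c d, valid4 a b c d -> v a b c d = ~~ v a c b d,
      forall a b c d, valid4 a b c d -> v a b c d = ~~ v a b d c &
      forall x1 x2 y1 y2 y3 y4, valid6 x1 x2 y1 y2 y3 y4 ->
        ~~ violated id (plucker v x1 x2 y1 y2 y3 y4)].

(** * Soundness of the search for chirotopes *)

Section soundness.
Variable v : nat -> nat -> nat -> nat -> bool.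
Hypothesis vP : chirotope v.

Lemma swap12 a b c d : valid4 a b c d -> v a b c d = ~~ v b a c d.
Proof. by case: vP => h _ _ _; exact: h. Qed.

Lemma swap23 a b c d : valid4 a b c d -> v a b c d = ~~ v a c b d.
Proof. by case: vP => _ h _ _; exact: h. Qed.

Lemma swap34 a b c d : valid4 a b c d -> v a b c d = ~~ v a b d c.
Proof. by case: vP => _ _ h _; exact: h. Qed.

Lemma v_plucker x1 x2 y1 y2 y3 y4 : valid6 x1 x2 y1 y2 y3 y4 ->
  ~~ violated id (plucker v x1 x2 y1 y2 y3 y4).
Proof. by case: vP => _ _ _ h; exact: h. Qed.

Lemma swap13 a b c d : valid4 a b c d -> v a b c d = ~~ v c b a d /\ valid4 c b a d.
Proof.
move=> h; have [h1 _ _] := valid4_swap h; have [_ h2 _] := valid4_swap h1.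
have [h3 _ _] := valid4_swap h2.
by rewrite (swap12 h) (swap23 h1) (swap12 h2) negbK.
Qed.

Lemma swap24 a b c d : valid4 a b c d -> v a b c d = ~~ v a d c b /\ valid4 a d c b.
Proof.
move=> h; have [_ h1 _] := valid4_swap h; have [_ _ h2] := valid4_swap h1.
have [_ h3 _] := valid4_swap h2.
by rewrite (swap23 h) (swap34 h1) (swap23 h2) negbK.
Qed.

Lemma rot3 a b c d : valid4 a b c d -> v a b c d = v c a b d.
Proof.
by move=> h; have [_ h1 _] := valid4_swap h; rewrite (swap23 h) (swap12 h1) negbK.
Qed.

Lemma rot4 a b c d : valid4 a b c d -> v a b c d = ~~ v d a b c.
Proof.
move=> h; have [_ _ h1] := valid4_swap h; have [_ h2 _] := valid4_swap h1.
by rewrite (swap34 h) (swap23 h1) (swap12 h2) !negbK.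
Qed.

Lemma swap_pairs a b c d : valid4 a b c d -> v a b c d = v c d a b.
Proof.
move=> h; have [h1 h2] := swap13 h; have [h3 _] := swap24 h2.
by rewrite h1 h3 negbK.
Qed.

Definition vquad (s : seq nat) := if s is [:: a; b; c; d] then v a b c d else false.

(** One comparator preserves the signed value as soon as exchanging [x] and [y] changes the sign.
    Composing five of these avoids distinguishing the 24 orders. *)
Lemma cswapP k (g : nat -> nat -> bool) s x y :
  let val (r : bool * seq nat) := r.1 (+) vquad r.2 in
  g x y = ~~ g y x -> (forall s', val (k s' x y) = s' (+) g x y) ->
  (forall s', val (k s' y x) = s' (+) g y x) -> val (cswap k s x y) = s (+) g x y.
Proof.
move=> val e h1 h2; rewrite /cswap; case: ifP => _; last exact: h1.
by rewrite h2 e addNb addbN.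
Qed.

Lemma v_sort a b c d : valid4 a b c d ->
  v a b c d = (sort4 a b c d).1 (+) vquad (sort4 a b c d).2.
Proof.
move=> V; symmetry; rewrite -[RHS]addFb /sort4.
(* [k5] to [k2] are the tails of the network from its last comparator backwards; [L5] to [L2] treat
   them in this order. *)
pose k5 x u s b c := (s, [:: x; b; c; u]) : bool * seq nat.
pose k4 x z s b d := cswap (k5 x d) s b z.
pose k3 y u s a c := cswap (k4 a c) s y u.
pose k2 x y s c d := cswap (k3 y d) s x c.
have L5 s x y z u : valid4 x y z u -> let r := cswap (k5 x u) s y z in
   r.1 (+) vquad r.2 = s (+) v x y z u.
  by move=> h; apply: (@cswapP _ (fun y z => v x y z u)) => //; exact: swap23.
have L4 s x y z u : valid4 x y z u -> let r := cswap (k4 x z) s y u in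
   r.1 (+) vquad r.2 = s (+) v x y z u.
  move=> h; have [h1 h2] := swap24 h.
  by apply: (@cswapP _ (fun y u => v x y z u)) => // s'; exact: L5.
have L3 s x y z u : valid4 x y z u -> let r := cswap (k3 y u) s x z in
   r.1 (+) vquad r.2 = s (+) v x y z u.
  move=> h; have [h1 h2] := swap13 h.
  by apply: (@cswapP _ (fun x z => v x y z u)) => // s'; exact: L4.
have L2 s x y z u : valid4 x y z u -> let r := cswap (k2 x y) s z u in
   r.1 (+) vquad r.2 = s (+) v x y z u.
  move=> h; have [_ _ h2] := valid4_swap h.
  by apply: (@cswapP _ (fun z u => v x y z u)) => [|s'|s']; [exact: swap34|exact: L3|exact: L3].
have [h2 _ _] := valid4_swap V.
by apply: (@cswapP _ (fun x y => v x y c d)) => [|s'|s']; [exact: swap12|exact: L2|exact: L2].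
Qed.

Definition value (i : nat) : bool := vquad (nth [::] quads i).
Definition val_lit (l : nat * bool) : bool := l.2 (+) value l.1.

Lemma val_litE a b c d : valid4 a b c d -> (lit a b c d).1 < 29 -> val_lit (lit a b c d) = v a b c d.
Proof.
move=> h; rewrite (v_sort h) /val_lit /lit /value; case: (sort4 a b c d) => s q /= hq.
by rewrite nth_index // -index_mem.
Qed.

Definition represents (t : trie) (n : nat) := forall i, i < n -> get t (address i) = value i.

Lemma represents_put t n : n < 29 -> represents t n -> represents (put t (address n) (value n)) n.+1.
Proof.
move=> n29 h i; rewrite ltnS => hi; rewrite get_put // address_inj; try lia.
by case: eqP => [->//|/eqP ne]; apply: h; lia.
Qed.

Lemma eval_place t n l : represents t n -> l.1 < n -> eval t (place l) = val_lit l.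
Proof. by move=> h hl; rewrite /eval /place /val_lit h. Qed.

Lemma no_violation t n : n < 29 -> represents t n.+1 -> has_violated (eval t) (clauses n) = false.
Proof.
move=> n29 ht; rewrite /clauses.
have H cl : cl \in [seq c <- map (pluck lit) pluckers | cmax c == n] ->
    violated (eval t) (cmap place cl) = false.
  rewrite mem_filter => /andP[/eqP cn /mapP[s]].
  move/(allP valid_pluckers) => vs e; rewrite {cl}e in cn *.
  case: s vs cn => [|x1 [|x2 [|y1 [|y2 [|y3 [|y4 [|]]]]]]] // /and5P[V q1 q2 q3 /and3P[q4 q5 q6]] cn.
  apply/negbTE; have := v_plucker V; apply: contra.
  have E a b c d : valid4 a b c d -> (lit a b c d).1 <= n -> eval t (place (lit a b c d)) = v a b c d.
    by move=> v4 l4; rewrite (eval_place ht) // val_litE //; exact: leq_ltn_trans n29.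
  move: cn; rewrite /cmax /tmax /pluck /= => cn.
  have [l1 l2 l3] : [/\ (lit x1 x2 y1 y2).1 <= n, (lit x1 x2 y3 y4).1 <= n & (lit x1 x2 y1 y3).1 <= n].
    by split; lia.
  have [l4 l5 l6] : [/\ (lit x1 x2 y2 y4).1 <= n, (lit x1 x2 y1 y4).1 <= n & (lit x1 x2 y2 y3).1 <= n].
    by split; lia.
  by rewrite /violated /tval /= !E.
elim: [seq c <- _ | _] H => //= c C IH H; rewrite H ?mem_head // IH // => c' hc'.
by apply: H; rewrite inE hc' orbT.
Qed.

(** Only the branch of the true values is followed: it violates no clause, so it must have passed
    [K]. *)
Lemma search_sound k n (K : trie -> bool) t : n + k <= 29 -> represents t n ->
  search n [seq clauses i | i <- iota n k] K t -> exists2 t', represents t' (n + k) & K t'.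
Proof.
elim: k n t => [|k IH] n t nk ht /=; first by rewrite addn0; exists t.
have n29 : n < 29 by lia.
have ht' := represents_put n29 ht; have nv := no_violation n29 ht'.
move=> h; have {h} : search n.+1 [seq clauses i | i <- iota n.+1 k] K (put t (address n) (value n)).
  move: h; case E : (if has_violated (eval (put t (address n) false)) (clauses n) then true else _) => //.
  move: E; case: (value n) ht' nv => ht' nv E; first by rewrite nv.
  by rewrite nv in E.
by rewrite addnS -addSn; apply: IH => //; rewrite addSn -addnS.
Qed.

Definition decided n a b c d := valid4 a b c d && ((lit a b c d).1 < n).

Lemma eval_decided t n a b c d : n <= 29 -> represents t n -> decided n a b c d ->
  eval t (place (lit a b c d)) = v a b c d.
Proof.
move=> n29 ht /andP[v4 l4]; rewrite (eval_place ht) // val_litE //; exact: leq_trans l4 n29.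
Qed.

Definition decided_edge (i j k l : nat) := [&& decided 20 6 i j k, decided 20 6 i j l,
  decided 20 k l 6 i, decided 29 k l i j & decided 20 k l j 6].

Definition link_pairs (i j : nat) : seq (nat * nat * bool) :=
  let: (k, m) := others i in let: (l, n) := others j in
  [:: (k, 3 + l, false); (m, 3 + l, true); (m, 3 + n, false); (k, 3 + n, true)].

Lemma link_edgesE (T : Type) (q : nat -> nat -> nat -> nat -> T) i j :
  link_edges q i j = [seq edge_of q i (3 + j) kl.1.1 kl.1.2 kl.2 | kl <- link_pairs i j].
Proof. by rewrite /link_edges /link_pairs; case: (others i) => k m; case: (others j). Qed.

Lemma decided_links : all (fun ij => all (fun kl => decided_edge ij.1 (3 + ij.2) kl.1.1 kl.1.2)
  (link_pairs ij.1 ij.2)) links.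
Proof. by vm_compute. Qed.

(** Once the cone at the apex is known, the only open condition is the orientation of [k l i j]; a
    case check shows that [residual] records it with the right sign. *)
Lemma count_residual t20 t i j k l f (s : bool -> bool) : represents t20 20 -> represents t 29 ->
  decided_edge i j k l ->
  count (fun e => eval t e.1 && s e.2) (residual t20 (emap place (edge_of lit i j k l f))) =
  (pierced (edge_of v i j k l f) && s (sign (edge_of v i j k l f)) : nat).
Proof.
move=> h20 h29 /and5P[d1 d2 d3 d4 d5].
rewrite /residual /= !(eval_decided _ h20) //.
have := eval_decided _ h29 d4; rewrite /eval /= => /(_ isT).
rewrite /sign /=; move: (v 6 i j k) (v 6 i j l) (v k l 6 i) (v k l i j) (v k l j 6) => sa sb w0 w1 w2.
move: (lit k l i j) => [y z] /=.
by case: sa; case: sb; case: w0; case: w2 => //=; rewrite -?addbA;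
  move: (get _ _) => g; case: g; case: z; case: w1; case: f => //=; case: (s _).
Qed.

Lemma count_residuals t20 t i j L (s : bool -> bool) : represents t20 20 -> represents t 29 ->
  all (fun kl => decided_edge i j kl.1.1 kl.1.2) L ->
  count (fun e => eval t e.1 && s e.2)
    (flatten [seq residual t20 (emap place (edge_of lit i j kl.1.1 kl.1.2 kl.2)) | kl <- L]) =
  count (fun e => pierced e && s (sign e)) [seq edge_of v i j kl.1.1 kl.1.2 kl.2 | kl <- L].
Proof.
move=> h20 h29; elim: L => //= kl L IH /andP[d /IH e].
by rewrite count_cat e (count_residual _ _ h20).
Qed.

Lemma nlinked_residual t20 t : represents t20 20 -> represents t 29 ->
  count (unbalanced (fun e => eval t e.1) snd)
    [seq flatten [seq residual t20 e | e <- s] | s <- map (map (emap place)) (all_edges lit)] =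
  nlinked (all_edges v).
Proof.
move=> h20 h29; rewrite /nlinked /all_edges !count_map; apply: eq_in_count => ij hij.
have d := allP decided_links _ hij.
rewrite /= !link_edgesE -!map_comp /unbalanced.
have e1 := count_residuals id h20 h29 d; have e2 := count_residuals negb h20 h29 d.
by rewrite /= in e1 e2 *; rewrite e1 e2.
Qed.

Definition stab (i j k l : nat) : nat := pierced (edge_of v i j k l false).

Definition decided_cross (i j k l : nat) := [&& decided 20 6 i j k, decided 20 6 i j l,
  decided 20 6 k l i, decided 20 6 k l j & [&& valid4 k l 6 i, valid4 i j 6 k, valid4 k l i j,
  valid4 k l j 6 & valid4 i j l 6]].

(** When the cones over [i j] and [k l] cross, the orientation of [i j k l] tells which edge is
    nearer to the apex, and the nearer edge pierces the triangle over the farther one. *)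
Lemma stab_crossing i j k l : decided_cross i j k l ->
  stab i j k l + stab k l i j = crossing (v 6 i j k) (v 6 i j l) (v 6 k l i) (v 6 k l j) :> nat.
Proof.
move=> /and5P[_ _ _ _ /and5P[h1 h2 h3 h4 h5]]; rewrite /stab /pierced /=.
rewrite (rot3 h1) (rot3 h2) (swap_pairs h3) (rot4 h4) (rot4 h5).
move: (v 6 i j k) (v 6 i j l) (v 6 k l i) (v 6 k l j) (v i j k l).
by do 5! case.
Qed.

Definition cross_pairs : seq ((nat * nat) * (nat * nat)) :=
  [seq (ik, jl) | ik <- [:: (0, 1); (0, 2); (1, 2)],
     jl <- [:: (3, 4); (4, 3); (3, 5); (5, 3); (4, 5); (5, 4)]].

Lemma decided_crosses : all (fun x => decided_cross x.1.1 x.2.1 x.1.2 x.2.2) cross_pairs.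
Proof. by vm_compute. Qed.

Lemma all_crossesE (T : Type) (q : nat -> nat -> nat -> nat -> T) :
  all_crosses q = [seq cross_of q x.1.1 x.2.1 x.1.2 x.2.2 | x <- cross_pairs].
Proof. by []. Qed.

Definition npiercing : nat := sumn [seq count pierced s | s <- all_edges v].

(** Double counting: a triangle over one edge together with a disjoint edge is a pair of disjoint
    edges with one of them singled out. *)
Lemma pair_sum (g : nat -> nat -> nat -> nat -> nat) :
  sumn [seq sumn [seq g ij.1 (3 + ij.2) kl.1.1 kl.1.2 | kl <- link_pairs ij.1 ij.2] | ij <- links] =
  sumn [seq g x.1.1 x.2.1 x.1.2 x.2.2 + g x.1.2 x.2.2 x.1.1 x.2.1 | x <- cross_pairs].
Proof.
have N : (3 + 0 = 3) * (3 + 1 = 4) * (3 + 2 = 5) by [].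
by rewrite /= !N; lia.
Qed.

Lemma npiercingE t : represents t 20 ->
  npiercing = count (eval_cross t) (map (xmap place) (all_crosses lit)).
Proof.
move=> ht; rewrite all_crossesE !count_map.
transitivity (sumn [seq stab x.1.1 x.2.1 x.1.2 x.2.2 + stab x.1.2 x.2.2 x.1.1 x.2.1
    | x <- cross_pairs]).
  rewrite -pair_sum /npiercing /all_edges -map_comp; congr sumn; apply: eq_map.
rewrite -sumn_count; congr sumn; apply/eq_in_map => x /(allP decided_crosses) d.
rewrite stab_crossing //; move: d => /and5P[d1 d2 d3 d4 _].
by rewrite /= !(eval_decided _ ht).
Qed.

Lemma unbalanced_count (s : seq (edge bool)) : unbalanced pierced sign s -> 0 < count pierced s.
Proof.
rewrite lt0n; apply: contraTneq => h; rewrite /unbalanced negbK.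
have H (P : pred (edge bool)) : count (fun e => pierced e && P e) s = 0.
  by apply/eqP; rewrite -leqn0 -h; apply: sub_count => e /andP[].
by rewrite (H sign) (H (fun e => ~~ sign e)).
Qed.

Lemma odd_unbalanced (s : seq (edge bool)) : odd (count pierced s) -> unbalanced pierced sign s.
Proof.
have -> : count pierced s = count (fun e => pierced e && sign e) s
    + count (fun e => pierced e && ~~ sign e) s.
  by elim: s => //= e s ->; case: (pierced e); case: (sign e) => /=; lia.
rewrite /unbalanced; case: eqnP => // ->; by rewrite addnn odd_double.
Qed.

Lemma nlinked_le_npiercing : nlinked (all_edges v) <= npiercing.
Proof.
rewrite /nlinked /npiercing; elim: (all_edges v) => //= s S IH.
by apply: leq_add => //; case: (boolP (unbalanced _ _ _)) => // /unbalanced_count.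
Qed.

Lemma odd_npiercing : odd npiercing -> 0 < nlinked (all_edges v).
Proof.
rewrite /nlinked /npiercing; elim: (all_edges v) => //= s S IH; rewrite oddD.
have := @odd_unbalanced s; case: (odd (count pierced s)) => [/(_ isT) -> //|_ /= /IH h].
by rewrite addn_gt0 h orbT.
Qed.

Definition unbalanced_link (ij : nat * nat) : bool :=
  unbalanced pierced sign (link_edges v ij.1 ij.2).

Lemma nlinkedE : nlinked (all_edges v) = count unbalanced_link links.
Proof. by rewrite /nlinked /all_edges count_map. Qed.

(** Exchanging [l] and [n] reverses the 4-cycle. This negates all signs and so swaps the two
    counts. *)
Lemma unbalanced_flip i j k l m n :
  unbalanced pierced sign [:: edge_of v i j k n false; edge_of v i j m n true;
    edge_of v i j m l false; edge_of v i j k l true] =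
  unbalanced pierced sign [:: edge_of v i j k l false; edge_of v i j m l true;
    edge_of v i j m n false; edge_of v i j k n true].
Proof.
rewrite /unbalanced /sign /=.
move: (piercing _ _ _ _ _) (piercing _ _ _ _ _) (piercing _ _ _ _ _) (piercing _ _ _ _ _).
by move: (v 6 i j k) (v 6 i j m); do 6! case.
Qed.

Lemma linked_bounds_fixed : v 0 1 2 6 = false -> v 3 4 5 6 = false ->
  0 < nlinked (all_edges v) <= 5.
Proof.
(* The variables 0 and 1 are the two fixed orientations, on which [Leaf false] is correct by
   hypothesis. *)
move=> v0 v1; have h1 : represents (Leaf false) 2 by move=> [|[|//]] _; rewrite /value.
have := full_searchT; rewrite /full_search.
case/(search_sound _ h1) => // t20 h20; case: ifP => [+ _|_].
  rewrite /good_cone -(npiercingE h20); case: ifP => // /odd_npiercing -> /=.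
  exact: leq_trans nlinked_le_npiercing.
case/(search_sound _ h20) => // t h29; rewrite /good_full (nlinked_residual h20 h29).
by case: ifP => // h5 h0; apply/andP.
Qed.

End soundness.

(** * Relabellings and mirror images *)

Section symmetry.
Variable v : nat -> nat -> nat -> nat -> bool.
Hypothesis vP : chirotope v.

Definition exchange (x y z : nat) : nat := if z == x then y else if z == y then x else z.

Definition relabel (x y : nat) (a b c d : nat) : bool :=
  let s := exchange x y in v (s a) (s b) (s c) (s d).

Lemma valid_exchange x y (s : seq nat) : x < 7 -> y < 7 -> uniq s && all (fun z => z < 7) s ->
  uniq (map (exchange x y) s) && all (fun z => z < 7) (map (exchange x y) s).
Proof.
move=> x7 y7 /andP[us ls]; rewrite map_inj_uniq ?us => [|z w].
  rewrite all_map /=; apply: sub_all ls => z /= z7; rewrite /exchange.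
  by case: ifP => // _; case: ifP.
rewrite /exchange.
by case: (z =P x) => [?|?]; [|case: (z =P y) => ?]; (case: (w =P x) => [?|?];
  [|case: (w =P y) => ?]); lia.
Qed.

Lemma chirotope_relabel x y : x < 7 -> y < 7 -> chirotope (relabel x y).
Proof.
move=> x7 y7; case: vP => h1 h2 h3 h4; have V s := valid_exchange (s := s) x7 y7.
split=> [a b c d /V h|a b c d /V h|a b c d /V h|x1 x2 y1 y2 y3 y4 /V h].
- exact: h1.
- exact: h2.
- exact: h3.
- exact: h4.
Qed.

Lemma chirotope_neg : chirotope (fun a b c d => ~~ v a b c d).
Proof.
case: vP => h1 h2 h3 h4; split=> [a b c d /h1 -> //|a b c d /h2 -> //|a b c d /h3 -> //|].
move=> x1 x2 y1 y2 y3 y4 /h4; rewrite /violated /tval /=.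
have E1 (a b : bool) : ~~ a (+) ~~ b = a (+) b by case: a; case: b.
by rewrite !E1.
Qed.

Lemma nlinked_relabel x y (s : nat * nat -> nat * nat) : perm_eq (map s links) links ->
  (forall ij, ij \in links -> unbalanced_link (relabel x y) ij = unbalanced_link v (s ij)) ->
  nlinked (all_edges (relabel x y)) = nlinked (all_edges v).
Proof.
move=> p h; rewrite !nlinkedE (eq_in_count h).
by move/permP: p => /(_ (unbalanced_link v)) <-; rewrite count_map.
Qed.

Lemma nlinked_relabel45 : nlinked (all_edges (relabel 4 5)) = nlinked (all_edges v).
Proof.
apply: (@nlinked_relabel _ _ (fun ij => (ij.1, exchange 1 2 ij.2))) => // -[i j].
(* Nine cases. The exchange reverses the 4-cycle for [j = 0]; for [j = 1] and [j = 2] it carries one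
   4-cycle to the other with its direction. *)
rewrite -[_ \in _]/((i, j) \in [:: _; _; _; _; _; _; _; _; _]) !inE.
by do ![case/orP] => /eqP [-> ->]; first [exact: unbalanced_flip|by []].
Qed.

Lemma nlinked_neg : nlinked (all_edges (fun a b c d => ~~ v a b c d)) = nlinked (all_edges v).
Proof.
pose w a b c d := ~~ v a b c d.
rewrite !nlinkedE; apply: eq_count => ij; rewrite /unbalanced_link !link_edgesE.
have H (p : bool -> bool) : count (fun e => pierced e && p (sign e))
    [seq edge_of v ij.1 (3 + ij.2) kl.1.1 kl.1.2 kl.2 | kl <- link_pairs ij.1 ij.2] =
  count (fun e => pierced e && p (~~ sign e))
    [seq edge_of w ij.1 (3 + ij.2) kl.1.1 kl.1.2 kl.2 | kl <- link_pairs ij.1 ij.2].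
  rewrite !count_map; apply: eq_count => kl; rewrite /= /sign /= /piercing /w.
  by rewrite !addNb !addbN !negbK.
have e1 := H id; have e2 := H negb; rewrite /unbalanced /= in e1 e2 *; rewrite e1 e2.
congr (~~ _); rewrite [RHS]eq_sym; congr eqn; apply: eq_count => e; by rewrite ?negbK.
Qed.
End symmetry.

(** A mirror image fixes the sign of [0 1 2 6]; exchanging 4 and 5 then fixes that of [3 4 5 6]
    without touching the first. *)
Theorem linked_bounds (v : nat -> nat -> nat -> nat -> bool) :
  chirotope v -> 0 < nlinked (all_edges v) <= 5.
Proof.
wlog v0 : v / v 0 1 2 6 = false => [W vP|].
  case E : (v 0 1 2 6); last exact: W.
  rewrite -nlinked_neg; apply: W; first by rewrite E.
  exact: chirotope_neg.
wlog v1 : v v0 / v 3 4 5 6 = false => [W vP|vP]; last exact: linked_bounds_fixed.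
case E : (v 3 4 5 6); last exact: W.
rewrite -(nlinked_relabel45 v); apply: W (chirotope_relabel vP _ _) => //.
by rewrite /relabel /= -[v 3 5 4 6]negbK -(swap23 vP) // E.
Qed.

(** * The links of K331 *)

Definition avert (i : 'I_3) : K331_vertex := inl (inl i).
Definition bvert (i : 'I_3) : K331_vertex := inl (inr i).
Definition pvert : K331_vertex := inr ord0.

Definition vertices : seq K331_vertex :=
  [:: avert 0; avert 1; avert 2; bvert 0; bvert 1; bvert 2; pvert]%R.
Definition vertex (n : nat) : K331_vertex := nth pvert vertices n.

Lemma vertex_a (i : 'I_3) : vertex i = avert i.
Proof. by case: i => [[|[|[|]]] h] //; congr avert; exact/val_inj. Qed.
Lemma vertex_b (i : 'I_3) : vertex (3 + i) = bvert i.
Proof. by case: i => [[|[|[|]]] h] //; congr bvert; exact/val_inj. Qed.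

Section cycles.
Variable T : finType.

Definition edges3 (x y z : T) : {set {set T}} := [set [set x; y]; [set y; z]; [set z; x]].
Definition edges4 (x y z w : T) : {set {set T}} :=
  [set [set x; y]; [set y; z]; [set z; w]; [set w; x]].

Lemma set2C (x y : T) : [set x; y] = [set y; x].
Proof. exact: setUC. Qed.

Lemma edges3_rot x y z : edges3 x y z = edges3 y z x.
Proof.
apply/setP => e; rewrite !inE; move: (e == [set x; y]) (e == [set y; z]) (e == [set z; x]).
by do 3! case.
Qed.

Lemma edges3_rev x y z : edges3 x y z = edges3 x z y.
Proof.
apply/setP => e; rewrite !inE (set2C x z) (set2C z y) (set2C y x).
by move: (e == [set x; y]) (e == [set y; z]) (e == [set z; x]); do 3! case.
Qed.

Lemma edges4_rot x y z w : edges4 x y z w = edges4 y z w x.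
Proof.
apply/setP => e; rewrite !inE.
move: (e == [set x; y]) (e == [set y; z]) (e == [set z; w]) (e == [set w; x]).
by do 4! case.
Qed.

Lemma edges4_rev x y z w : edges4 x y z w = edges4 x w z y.
Proof.
apply/setP => e; rewrite !inE (set2C x w) (set2C w z) (set2C z y) (set2C y x).
move: (e == [set x; y]) (e == [set y; z]) (e == [set z; w]) (e == [set w; x]).
by do 4! case.
Qed.

Lemma cycle_edges3 x y z : uniq [:: x; y; z] -> cycle_edges [:: x; y; z] = edges3 x y z.
Proof.
rewrite /= !inE negb_or => /and3P[/andP[xy xz] yz _].
have nx : next [:: x; y; z] x = y by rewrite /= eqxx.
have ny : next [:: x; y; z] y = z by rewrite /= eq_sym (negPf xy) eqxx.
have nz : next [:: x; y; z] z = x by rewrite /= eq_sym (negPf xz) eq_sym (negPf yz) eqxx.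
apply/setP => e; apply/imsetP/idP => [[u + ->]|].
  by rewrite !inE => /or3P[] /eqP ->; rewrite ?nx ?ny ?nz !eqxx ?orbT.
rewrite !inE -!orbA => /or3P[] /eqP ->; [exists x|exists y|exists z];
  by rewrite ?nx ?ny ?nz ?inE ?eqxx ?orbT.
Qed.

Lemma cycle_edges4 x y z w : uniq [:: x; y; z; w] ->
  cycle_edges [:: x; y; z; w] = edges4 x y z w.
Proof.
rewrite /= !inE !negb_or => /and4P[/and3P[xy xz xw] /andP[yz yw] zw _].
have nx : next [:: x; y; z; w] x = y by rewrite /= eqxx.
have ny : next [:: x; y; z; w] y = z by rewrite /= eq_sym (negPf xy) eqxx.
have nz : next [:: x; y; z; w] z = w by rewrite /= eq_sym (negPf xz) eq_sym (negPf yz) eqxx.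
have nw : next [:: x; y; z; w] w = x.
  by rewrite /= eq_sym (negPf xw) eq_sym (negPf yw) eq_sym (negPf zw) eqxx.
apply/setP => e; apply/imsetP/idP => [[u + ->]|].
  by rewrite !inE => /or4P[] /eqP ->; rewrite ?nx ?ny ?nz ?nw !eqxx ?orbT.
rewrite !inE -!orbA => /or4P[] /eqP ->; [exists x|exists y|exists z|exists w];
  by rewrite ?nx ?ny ?nz ?nw ?inE ?eqxx ?orbT.
Qed.

Lemma cover_cycle_edges (c : seq T) : cover (cycle_edges c) = [set x in c].
Proof.
apply/setP => x; rewrite inE; apply/bigcupP/idP => [[e /imsetP[u uc ->]]|xc].
  by rewrite !inE => /orP[] /eqP -> //; rewrite mem_next.
by exists [set x; next c x]; [apply/imsetP; exists x|rewrite !inE eqxx].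
Qed.
End cycles.

Lemma card_K331 (c : seq K331_vertex) : uniq c -> size c <= 7.
Proof. by move=> /card_uniqP <-; apply: leq_trans (max_card _) _; rewrite !card_sum !card_ord. Qed.

(** The three vertices lie in three different parts, in one of six orders, and each order is a
    rotation or a reversal of the standard one. *)
Lemma triangle_K331 (c : seq K331_vertex) : ucycle K331 c -> size c = 3 ->
  exists i j : 'I_3, cycle_edges c = edges3 pvert (avert i) (bvert j) /\
    c =i [:: pvert; avert i; bvert j].
Proof.
case: c => [|x [|y [|z []]]] //= /andP[+ u] _; rewrite cycle_edges3 //.
rewrite /K331 /= andbT => /and3P[xy yz zx].
have p0 (o : 'I_1) : inr o = pvert by congr inr; rewrite (ord1 o).
case: x {u} xy zx => [[i|j]|o]; case: y yz => [[i'|j']|o'] //=; case: z => [[i''|j'']|o''] //= _ _ _;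
  rewrite ?p0.
- exists i, j'; split; first by rewrite [RHS]edges3_rot.
  move=> x; rewrite !inE /avert /bvert.
  by move: (x == inl (inl _)) (x == inl (inr _)) (x == pvert); do 3! case.
- exists i, j''; split; first by rewrite [RHS]edges3_rev [RHS]edges3_rot [RHS]edges3_rot.
  move=> x; rewrite !inE /avert /bvert.
  by move: (x == inl (inl _)) (x == inl (inr _)) (x == pvert); do 3! case.
- exists i', j; split; first by rewrite [RHS]edges3_rev [RHS]edges3_rot.
  move=> x; rewrite !inE /avert /bvert.
  by move: (x == inl (inl _)) (x == inl (inr _)) (x == pvert); do 3! case.
- exists i'', j; split; first by rewrite [RHS]edges3_rot [RHS]edges3_rot.
  move=> x; rewrite !inE /avert /bvert.
  by move: (x == inl (inl _)) (x == inl (inr _)) (x == pvert); do 3! case.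
- exists i', j''; split; first by [].
  move=> x; rewrite !inE /avert /bvert.
  by move: (x == inl (inl _)) (x == inl (inr _)) (x == pvert); do 3! case.
- exists i'', j'; split; first by rewrite [RHS]edges3_rev.
  move=> x; rewrite !inE /avert /bvert.
  by move: (x == inl (inl _)) (x == inl (inr _)) (x == pvert); do 3! case.
Qed.

(** Without [pvert] the cycle alternates between the two parts of size 3. *)
Lemma square_K331 (c : seq K331_vertex) : ucycle K331 c -> size c = 4 -> pvert \notin c ->
  exists i j k l : 'I_3, [/\ i != k, j != l,
    cycle_edges c = edges4 (avert i) (bvert j) (avert k) (bvert l) &
    c =i [:: avert i; bvert j; avert k; bvert l]].
Proof.
case: c => [|x [|y [|z [|w []]]]] //= /andP[+ u] _; rewrite cycle_edges4 // !inE !negb_or.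
rewrite /K331 /= andbT => /and4P[xy yz zw wx] /and4P[px py pz pw].
have p0 (o : 'I_1) : inr o = pvert by congr inr; rewrite (ord1 o).
case: x xy wx px u => [[i|j]|o]; last by rewrite p0 eqxx.
all: case: y yz py => [[i'|j']|o'] //=; try by rewrite p0 eqxx.
all: case: z zw pz => [[i''|j'']|o''] //=; try by rewrite p0 eqxx.
all: case: w pw => [[i3|j3]|o3] //=; try by rewrite p0 eqxx.
- move=> _ _ _ _ _ _ _ _ /and3P[+ + _]; rewrite !inE !negb_or => /and3P[_ ii _] /andP[_ jj].
  by exists i, j', i'', j3; split=> //; apply: contraNneq ii => ->.
- move=> _ _ _ _ _ _ _ _ /and3P[+ + _]; rewrite !inE !negb_or => /and3P[_ jj _] /andP[_ ii].
  exists i', j'', i3, j; split => //; [|by rewrite edges4_rot|].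
    by apply: contraNneq jj => ->.
  move=> x; rewrite !inE.
  move: (x == inl (inl i')) (x == inl (inl i3)) (x == inl (inr j)) (x == inl (inr j'')).
  by rewrite /avert /bvert; do 4! case.
Qed.

Definition tri_edges (i j : 'I_3) : {set {set K331_vertex}} := edges3 pvert (avert i) (bvert j).

Definition quad_verts (i j : nat) : seq K331_vertex :=
  let: (k, m) := others i in let: (l, n) := others j in
  [:: vertex k; vertex (3 + l); vertex m; vertex (3 + n)].

Definition quad_edges (i j : nat) : {set {set K331_vertex}} :=
  let: (k, m) := others i in let: (l, n) := others j in
  edges4 (vertex k) (vertex (3 + l)) (vertex m) (vertex (3 + n)).

Definition klink (i j : 'I_3) : {set {set {set K331_vertex}}} := [set tri_edges i j; quad_edges i j].

Lemma others_ord (i k m : 'I_3) : i != k -> i != m -> k != m ->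
  others i = (k : nat, m : nat) \/ others i = (m : nat, k : nat).
Proof.
by case: i => [[|[|[|]]] hi] //; case: k => [[|[|[|]]] hk] //; case: m => [[|[|[|]]] hm] //;
  move=> _ _ _; by [left|right].
Qed.

Lemma quad_edgesE (i k m j l n : 'I_3) : i != k -> i != m -> k != m -> j != l -> j != n -> l != n ->
  quad_edges i j = edges4 (avert k) (bvert l) (avert m) (bvert n).
Proof.
move=> ik im km jl jn ln; rewrite /quad_edges.
case: (others_ord ik im km) => ->; case: (others_ord jl jn ln) => ->; rewrite !vertex_a !vertex_b //.
- by rewrite edges4_rev.
- by rewrite edges4_rot edges4_rot edges4_rev.
- by rewrite edges4_rot edges4_rot.
Qed.

(** On seven vertices the shorter cycle is a triangle and the other has length 3 or 4. Every
    triangle contains [pvert], so the other one is a 4-cycle that avoids it. *)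
Lemma two_link_klink L : two_link K331 L -> exists i j : 'I_3, L = klink i j.
Proof.
case=> C1 [C2 [[c1 [u1 s1 e1]] [c2 [u2 s2 e2]]]]; rewrite {}e1 {}e2 => + ->.
rewrite !cover_cycle_edges => dis.
wlog le : c1 c2 u1 u2 s1 s2 dis / size c1 <= size c2.
  move=> W; case: (leqP (size c1) (size c2)) => [|/ltnW] h; first exact: W.
  have [||i [j e]] // := W c2 c1 u2 u1 s2 s1; first by rewrite disjoint_sym.
  by exists i, j; rewrite -e set2C.
have dis' x : x \in c1 -> x \in c2 -> False.
  by move=> x1 x2; have := disjointFr dis (x := x); rewrite !inE x1 x2 => /(_ isT).
have : uniq (c1 ++ c2).
  rewrite cat_uniq (ucycle_uniq u1) (ucycle_uniq u2) andbT; apply/hasPn => x x2.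
  by apply/negP => x1; exact: (dis' x).
move/card_K331; rewrite size_cat => s7.
have s1' : size c1 = 3 by lia.
have [i [j [e1 m1]]] := triangle_K331 u1 s1'.
have p1 : pvert \in c1 by rewrite m1 inE eqxx.
have s2' : size c2 = 4.
  have : size c2 = 3 \/ size c2 = 4 by lia.
  case=> // /(triangle_K331 u2)[i' [j' [_ m2]]].
  by case: (dis' pvert p1); rewrite m2 inE eqxx.
have p2 : pvert \notin c2 by apply/negP; exact: dis'.
have [k [l [m [n [km ln e2 m2]]]]] := square_K331 u2 s2' p2.
have ne x y : x \in c1 -> y \in c2 -> x != y by move=> xc yc; apply: contraPneq yc => <-; exact: dis'.
have a1 : avert i \in c1 by rewrite m1 !inE eqxx orbT.
have b1 : bvert j \in c1 by rewrite m1 !inE eqxx !orbT.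
exists i, j; rewrite /klink e1 e2 (@quad_edgesE i k m j l n) //.
- by have := ne _ (avert k) a1; rewrite m2 !inE eqxx => /(_ isT); apply: contraNneq => ->.
- by have := ne _ (avert m) a1; rewrite m2 !inE eqxx !orbT => /(_ isT); apply: contraNneq => ->.
- by have := ne _ (bvert l) b1; rewrite m2 !inE eqxx !orbT => /(_ isT); apply: contraNneq => ->.
- by have := ne _ (bvert n) b1; rewrite m2 !inE eqxx !orbT => /(_ isT); apply: contraNneq => ->.
Qed.

Lemma klink_two_link (i j : 'I_3) : two_link K331 (klink i j).
Proof.
pose c2 := quad_verts i j.
have C2 : [/\ ucycle K331 c2, 3 <= size c2, quad_edges i j = cycle_edges c2 &
    ~~ has (mem [:: pvert; avert i; bvert j]) c2].
  by case: i @c2 => [[|[|[|]]] hi] //; case: j => [[|[|[|]]] hj] // c2; split => //;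
    rewrite cycle_edges4.
case: C2 => u2 s2 e2 d; exists (tri_edges i j), (quad_edges i j); split=> //.
- exists [:: pvert; avert i; bvert j]; split=> //.
  by rewrite cycle_edges3.
- by exists c2.
- rewrite e2 /tri_edges -cycle_edges3 // !cover_cycle_edges disjoint_subset.
  apply/subsetP => x; rewrite inE => x1; rewrite !inE; apply: contra d => x2.
  by apply/hasP; exists x.
Qed.

Lemma cover_klink (i j : 'I_3) : cover (klink i j) = tri_edges i j :|: quad_edges i j.
Proof.
apply/setP => e; rewrite inE; apply/bigcupP/orP => [[C]|[]he].
- by rewrite in_set2 => /orP[] /eqP -> h; [left|right].
- by exists (tri_edges i j); rewrite // in_set2 eqxx.
- by exists (quad_edges i j); rewrite // in_set2 eqxx orbT.
Qed.

Lemma pvert_quad (i j : 'I_3) e : e \in quad_edges i j -> pvert \notin e.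
Proof.
by case: i => [[|[|[|]]] hi] //; case: j => [[|[|[|]]] hj] //;
  rewrite !inE -!orbA => /or4P[] /eqP ->; rewrite !inE.
Qed.

Lemma klink_edge_a (i j k : 'I_3) : ([set pvert; avert k] \in cover (klink i j)) = (k == i).
Proof.
rewrite cover_klink inE; apply/orP/eqP => [[|/pvert_quad]|->]; last 2 first.
- by rewrite !inE eqxx.
- by left; rewrite !inE eqxx.
rewrite !inE -!orbA => /or3P[] /eqP/setP h.
- by have := h (avert k); rewrite !inE eqxx /= => /esym/eqP[].
- by have := h pvert; rewrite !inE eqxx.
- by have := h (avert k); rewrite !inE eqxx orbT.
Qed.

Lemma klink_edge_b (i j k : 'I_3) : ([set bvert k; pvert] \in cover (klink i j)) = (k == j).
Proof.
rewrite cover_klink inE; apply/orP/eqP => [[|/pvert_quad]|->]; last 2 first.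
- by rewrite !inE eqxx orbT.
- by left; rewrite !inE eqxx !orbT.
rewrite !inE -!orbA => /or3P[] /eqP/setP h.
- by have := h (bvert k); rewrite !inE eqxx.
- by have := h pvert; rewrite !inE eqxx orbT.
- by have := h (bvert k); rewrite !inE eqxx /= orbF => /esym/eqP[].
Qed.

(** The edges of the link at [pvert] recover [i] and [j]. *)
Lemma klink_inj : injective (fun ij => klink ij.1 ij.2).
Proof.
move=> [i j] [i' j'] /= e; congr (_, _); apply/eqP.
- by rewrite -(klink_edge_a i' j') -e klink_edge_a.
- by rewrite -(klink_edge_b i' j') -e klink_edge_b.
Qed.

Lemma two_linkP L : two_link K331 L <-> exists i j : 'I_3, L = klink i j.
Proof.
by split=> [/two_link_klink|[i [j ->]]] //; exact: klink_two_link.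
Qed.

From mathcomp Require Import all_classical all_reals all_analysis.
Import Order.TTheory GRing.Theory Num.Theory.
Import numFieldNormedType.Exports.
Local Open Scope classical_set_scope.
Local Open Scope ring_scope.

(** * Ambient isotopies of polygonal graphs *)

(* Makes ['rV[R]_3] a complete normed module, for Banach's fixed point theorem. *)
HB.instance Definition _ (R : realType) (m n : nat) := Complete.on 'M[R]_(m.+1, n.+1).

Section norm3.
Variable R : realType.
Local Notation E3 := 'rV[R]_3.

Lemma norm3_leP (x : E3) (e : R) :
  (`|x| <= e) <-> (forall i, `|x 0 i| <= e).
Proof.
split=> [xe i|H].
  apply: le_trans xe; rewrite [leRHS]mx_normrE.
  by apply: (le_trans _ (@le_bigmax _ _ _ _ _ (0, i))).
rewrite [leLHS]mx_normrE; apply/bigmax_leP; split=> [|[i j] _ /=].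
  exact: le_trans (normr_ge0 _) (H 0).
by rewrite (ord1 i).
Qed.

Lemma coord_norm3 (x : E3) i : `|x 0 i| <= `|x|.
Proof. by move: i; apply/norm3_leP. Qed.

(** McShane's extension, the infimum over [a] in [A] of [v a + L * |x - a|]. *)
Lemma lipschitz_extension (V : normedModType R) (A : set V) (v : V -> R) (L : R) :
  A !=set0 -> 0 <= L ->
  (forall x y, A x -> A y -> `|v x - v y| <= L * `|x - y|) ->
  exists w : V -> R, (forall x, A x -> w x = v x) /\
    (forall x y, `|w x - w y| <= L * `|x - y|).
Proof.
move=> [a0 Aa0] L0 vL.
pose S x := [set v a + L * `|x - a| | a in A].
have S0 x : S x !=set0 by exists (v a0 + L * `|x - a0|); exists a0.
have Slb x : has_lbound (S x).
  exists (v a0 - L * `|x - a0|) => _ [a Aa <-].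
  have := vL _ _ Aa Aa0; rewrite ler_norml => /andP[h _].
  have : `|a - a0| <= `|x - a| + `|x - a0|.
    by rewrite (distrC x a); apply: ler_distD.
  by move=> /(ler_wpM2l L0); lra.
have Sinf x : has_inf (S x) by split.
exists (fun x => inf (S x)); split=> [x Ax|x y].
  apply/eqP; rewrite eq_le; apply/andP; split.
    apply: ge_inf => //; exists x => //; by rewrite subrr normr0 mulr0 addr0.
  apply: lb_le_inf => // _ [a Aa <-].
  by have := vL _ _ Ax Aa; rewrite ler_norml => /andP[_ h]; lra.
wlog: x y / inf (S x) <= inf (S y).
  move=> W; case: (leP (inf (S x)) (inf (S y))) => [|/ltW] h; first exact: W.
  by rewrite distrC (distrC x); apply: W.
move=> h; rewrite distrC ger0_norm ?subr_ge0// lerBlDr -lerBlDl.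
apply: lb_le_inf => // _ [a Aa <-]; rewrite lerBlDl.
apply: (@le_trans _ _ (v a + L * `|y - a|)).
  by apply: ge_inf => //; exists a.
have : `|y - a| <= `|x - y| + `|x - a| by rewrite (distrC x y); apply: ler_distD.
by move=> /(ler_wpM2l L0); lra.
Qed.

Lemma lipschitz_continuous (V W : normedModType R) (w : V -> W) (L : R) :
  0 <= L -> (forall x y, `|w x - w y| <= L * `|x - y|) -> continuous w.
Proof.
move=> L0 wL x; apply/cvgrPdist_le => e e0.
near=> y.
apply: le_trans (wL _ _) _.
have -> : e = (L + 1) * (e / (L + 1)).
  by rewrite mulrC divfK// gt_eqF // ltr_wpDl.
apply: ler_pM => //; first by rewrite lerDl.
near: y.
have d0 : 0 < e / (L + 1) by rewrite divr_gt0 // ltr_wpDl.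
by have /cvgrPdist_le /(_ _ d0) := @cvg_id _ (nbhs x).
Unshelve. all: by end_near. Qed.

Lemma contraction_fixpoint (f : E3 -> E3) (L : R) : 0 <= L < 1 ->
  (forall x y, `|f x - f y| <= L * `|x - y|) -> exists x, f x = x.
Proof.
move=> /andP[L0 L1] fL.
have : is_contraction (totalfun f : {fun [set: E3] >-> [set: E3]}).
  exists (NngNum L0); split=> //= -[x y] _ /=; exact: fL.
move=> /banach_fixed_point /(_ closedT) [|p _ pf]; first by exists 0.
by exists p.
Qed.

(** Solving [x + w x = y] amounts to finding a fixed point of the contraction [x |-> y - w x]. *)
Lemma add_lipschitz_homeomorphism (w : E3 -> E3) (L : R) : 0 <= L < 1 ->
  (forall x y, `|w x - w y| <= L * `|x - y|) ->
  homeomorphism (fun x => x + w x).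
Proof.
move=> L01 wL; have /andP[L0 L1] := L01.
have fp y : exists x, x + w x = y.
  have [|x xy] := @contraction_fixpoint (fun x => y - w x) L L01.
    move=> a b; rewrite opprB addrC addrA subrK.
    by rewrite (le_trans (wL _ _)) // distrC.
  by exists x; rewrite -{1}xy subrK.
(* This lower bound yields both injectivity and a Lipschitz inverse. *)
have lb a b : (1 - L) * `|a - b| <= `|(a + w a) - (b + w b)|.
  have := wL a b.
  have : `|a - b| <= `|a + w a - (b + w b)| + `|w a - w b|.
    have -> : a - b = (a + w a - (b + w b)) - (w a - w b).
      by apply/rowP => i; rewrite !mxE; ring.
    exact: ler_normB.
  by lra.
have /choice[g gP] := fp.
have inj a b : a + w a = b + w b -> a = b.
  move=> e; have := lb a b; rewrite e subrr normr0 pmulr_rle0 ?subr_gt0//.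
  by rewrite normr_le0 subr_eq0 => /eqP.
exists g; split=> //.
- by move=> x; apply: inj; rewrite gP.
- apply: (@lipschitz_continuous _ _ _ (1 + L)); first by rewrite addr_ge0.
  move=> x y; rewrite opprD addrACA mulrDl mul1r.
  by apply: le_trans (ler_normD _ _) _; apply: lerD.
- apply: (@lipschitz_continuous _ _ _ (1 - L)^-1).
    by rewrite invr_ge0 subr_ge0 ltW.
  move=> x y; rewrite -ler_pdivrMl ?invr_gt0 ?subr_gt0// invrK.
  by rewrite -{2}(gP x) -{2}(gP y).
Qed.

(** Extending each coordinate separately keeps the constant [L] because the norm is the sup norm. *)
Lemma lipschitz_extension3 (A : set E3) (u : E3 -> E3) (L : R) :
  A !=set0 -> 0 <= L ->
  (forall x y, A x -> A y -> `|u x - u y| <= L * `|x - y|) ->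
  exists w : E3 -> E3, (forall x, A x -> w x = u x) /\
    (forall x y, `|w x - w y| <= L * `|x - y|).
Proof.
move=> A0 L0 uL.
have /choice[w wP] : forall i : 'I_3, exists w : E3 -> R,
    (forall x, A x -> w x = u x 0 i) /\
    (forall x y, `|w x - w y| <= L * `|x - y|).
  move=> i; apply: lipschitz_extension => // x y Ax Ay.
  have := coord_norm3 (u x - u y) i; rewrite !mxE => h.
  exact: le_trans h (uL _ _ Ax Ay).
exists (fun x => \row_i w i x); split=> [x Ax|x y].
  by apply/rowP => i; rewrite mxE (wP i).1.
by apply/norm3_leP => i; rewrite !mxE; exact: (wP i).2.
Qed.

(** Once extended to all of space, the displacement can be scaled by the time [t]; every stage is
    the identity plus a contraction. *)
Lemma small_displacement (A : set E3) (u : E3 -> E3) (L : R) :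
  0 <= L < 1 ->
  (forall x y, A x -> A y -> `|u x - u y| <= L * `|x - y|) ->
  ambient_isotopic A [set x + u x | x in A].
Proof.
move=> /andP[L0 L1] uL.
have [->|/set0P A0] := eqVneq A set0.
  exists (fun _ x => x); split=> //.
  - by apply: continuous_subspaceT => x; exact: cvg_snd.
  - by move=> t _; exists id; split=> // x; exact: cvg_id.
  - by rewrite !image_set0.
have [w [wA wL]] := lipschitz_extension3 A0 L0 uL.
have cw := lipschitz_continuous L0 wL.
exists (fun t x => x + t *: w x); split.
- apply: continuous_subspaceT => -[t x]; apply: cvgD; first exact: cvg_snd.
  apply: cvgZ; first exact: cvg_fst.
  by apply: (cvg_comp snd w); [exact: cvg_snd|exact: cw].
- move=> t; rewrite in_itv /= => /andP[t0 t1].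
  apply: (@add_lipschitz_homeomorphism _ L); first by rewrite L0.
  move=> x y; rewrite -scalerBr normrZ (ger0_norm t0).
  apply: le_trans (wL x y); rewrite ler_piMl//.
- by move=> x; rewrite scale0r addr0.
- apply/seteqP; split=> _ [x Ax <-]; exists x => //; by rewrite scale1r wA.
Qed.

Lemma homeomorphism_comp (h k : E3 -> E3) :
  homeomorphism h -> homeomorphism k -> homeomorphism (k \o h).
Proof.
move=> [g [hg gh ch cg]] [l [kl lk ck cl]]; exists (g \o l); split.
- exact: can_comp.
- exact: can_comp.
- by move=> x; apply: continuous_comp; [exact: ch|exact: ck].
- by move=> x; apply: continuous_comp; [exact: cl|exact: cg].
Qed.

Lemma ambient_isotopic_refl (A : set E3) : ambient_isotopic A A.
Proof.
have := @small_displacement A (fun=> 0) 0; rewrite lexx ltr01.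
move=> /(_ isT) [|H [H1 H2 H3 H4]].
  by move=> *; rewrite subrr normr0 mul0r.
exists H; split=> //; rewrite H4; apply/seteqP; split=> [_ [x Ax <-]|x Ax].
  by rewrite addr0.
by exists x => //; rewrite addr0.
Qed.

(** Both isotopies run at the same time, [K t] after [H t], so that no time intervals have to be
    glued. *)
Lemma ambient_isotopic_trans (A B C : set E3) :
  ambient_isotopic A B -> ambient_isotopic B C -> ambient_isotopic A C.
Proof.
move=> [H [cH hH H0 H1]] [K [cK hK K0 K1]].
exists (fun t x => K t (H t x)); split.
- set D := `[0, 1] `*` setT; pose G (tx : R * E3) := (tx.1, H tx.1 tx.2).
  move/subspace_continuousP: cH => cH; move/subspace_continuousP: cK => cK.
  apply/subspace_continuousP => x Dx.
  have cG : G z @[z --> within D (nbhs x)] --> G x.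
    have c1 : (fst : R * E3 -> R) z @[z --> within D (nbhs x)] --> nbhs x.1.
      by apply: (cvg_trans (G := fst @ nbhs x)); [apply: cvg_app; exact: cvg_within|exact: cvg_fst].
    exact: (cvg_pair c1 (cH x Dx)).
  have GD : G @ within D (nbhs x) --> within D (nbhs (G x)).
    move=> W GW; have GW' : nbhs x [set z | D z -> D (G z) -> W (G z)] := cG _ GW.
    change (nbhs x [set z | D z -> W (G z)]); apply: filterS GW' => z /= h Dz.
    by apply: h => //; split=> //; exact: Dz.1.
  apply: (cvg_comp G (fun z : R * E3 => K z.1 z.2) GD).
  by apply: (cK (G x)); split=> //; exact: Dx.1.
- by move=> t t01; apply: (homeomorphism_comp (hH t t01) (hK t t01)).
- by move=> x; rewrite H0 K0.
- by rewrite -K1 -H1 image_comp.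
Qed.
End norm3.

(** * Quantitative injectivity of linear maps of graphs *)

Section polygonal.
Variable R : realType.
Local Notation E3 := 'rV[R]_3.
Variable V : finType.
Implicit Types (e : rel V) (f g : V -> E3).

Definition edge_pt f (u v : V) (s : R) : E3 := (1 - s) *: f u + s *: f v.

(** Barycentric coordinates in the geometric realization of the graph: a point has the same
    coordinates whichever edge describes it. [wt_dist] is the l1 distance between them. *)
Definition edge_wt (u v : V) (s : R) (w : V) : R :=
  (1 - s) * (w == u)%:R + s * (w == v)%:R.

Definition wt_dist u v s x y t : R :=
  \sum_w `|edge_wt u v s w - edge_wt x y t w|.

Definition carrier e f : set E3 :=
  [set p | exists u v : V, e u v /\ segment (f u) (f v) p].

Definition inj_edges f u v x y := forall s t, 0 <= s <= 1 -> 0 <= t <= 1 ->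
  edge_pt f u v s = edge_pt f x y t -> edge_wt u v s =1 edge_wt x y t.

Definition emb e f :=
  forall u v x y, e u v -> e x y -> inj_edges f u v x y.

(** A lower Lipschitz bound, that is, injectivity in a form that survives small changes of [f]. *)
Definition emb_bound e f (c : R) := forall u v x y s t,
  e u v -> e x y -> 0 <= s <= 1 -> 0 <= t <= 1 ->
  c * wt_dist u v s x y t <= `|edge_pt f u v s - edge_pt f x y t|.

Lemma edge_ptE f u v s : edge_pt f u v s = \sum_w edge_wt u v s w *: f w.
Proof.
under eq_bigr do rewrite scalerDl -!scalerA.
rewrite big_split -!scaler_sumr /=; congr (_ *: _ + _ *: _).
  by rewrite (bigD1 u) //= eqxx scale1r big1 ?addr0 // => w /negPf ->; rewrite scale0r.
by rewrite (bigD1 v) //= eqxx scale1r big1 ?addr0 // => w /negPf ->; rewrite scale0r.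
Qed.

Lemma edge_ptC f u v s : edge_pt f u v s = edge_pt f v u (1 - s).
Proof. by rewrite /edge_pt addrC; congr (_ *: _ + _); ring. Qed.

Lemma edge_wtC u v s w : edge_wt u v s w = edge_wt v u (1 - s) w.
Proof. by rewrite /edge_wt; ring. Qed.

Lemma edge_ptB f g u v s :
  edge_pt f u v s - edge_pt g u v s = edge_pt (fun w => f w - g w) u v s.
Proof. by rewrite /edge_pt; apply/rowP => i; rewrite !mxE; ring. Qed.

Lemma edge_pt_dist f (M : R) u v s x y t : (forall w, `|f w| <= M) ->
  `|edge_pt f u v s - edge_pt f x y t| <= M * wt_dist u v s x y t.
Proof.
move=> fM; rewrite !edge_ptE -sumrB /wt_dist mulr_sumr.
apply: le_trans (ler_norm_sum _ _ _) _; apply: ler_sum => w _.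
by rewrite -scalerBl normrZ mulrC ler_wpM2r.
Qed.

Lemma segmentP (a b p : E3) : segment a b p <->
  exists2 s : R, 0 <= s <= 1 & p = (1 - s) *: a + s *: b.
Proof.
split=> [[s /=]|[s s01 ->]]; first by rewrite in_itv /= => s01 <-; exists s.
by exists s => //=; rewrite in_itv.
Qed.

Lemma carrierP e f p : carrier e f p <->
  exists u v s, [/\ e u v, 0 <= s <= 1 & p = edge_pt f u v s].
Proof.
split=> [[u [v [uv /segmentP[s s01 ->]]]]|[u [v [s [uv s01 ->]]]]].
  by exists u, v, s.
by exists u, v; split=> //; apply/segmentP; exists s.
Qed.

(** Relative to the realization, [f] expands distances by at least [c] and [g - f] by at most [d];
    hence the displacement of the image of [f] has Lipschitz constant [d / c < 1]. *)
Lemma emb_bound_isotopic e f g (c d : R) : 0 < c ->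
  emb_bound e f c -> (forall w, `|g w - f w| <= d) -> d < c ->
  ambient_isotopic (carrier e f) (carrier e g).
Proof.
move=> c0 fc gf dc.
have /choice[u uP] : forall p, exists q, carrier e f p ->
    exists u v s, [/\ e u v, 0 <= s <= 1, p = edge_pt f u v s &
                     q = edge_pt (fun w => g w - f w) u v s].
  move=> p; case: (pselect (carrier e f p)) => [/carrierP[u [v [s [uv s01 ->]]]]|np].
    by exists (edge_pt (fun w => g w - f w) u v s) => _; exists u, v, s.
  by exists 0.
case: (pselect (carrier e f !=set0)) => [[p0 Ap0]|A0]; last first.
  have Ae : carrier e f = set0 by apply/seteqP; split=> // p Ap; apply: A0; exists p.
  have -> : carrier e g = set0.
    apply/seteqP; split=> // p /carrierP[u' [v [s [uv s01 _]]]].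
    suff : carrier e f (edge_pt f u' v s) by rewrite Ae.
    by apply/carrierP; exists u', v, s.
  rewrite Ae; exact: ambient_isotopic_refl.
have d0 : 0 <= d.
  by have [u' [v [s _]]] := uP _ Ap0; exact: le_trans (gf u').
have : ambient_isotopic (carrier e f) [set x + u x | x in carrier e f].
  apply: (@small_displacement _ _ _ (d / c)).
    by rewrite divr_ge0 ?(ltW c0)//= ltr_pdivrMr // mul1r.
  move=> p q /uP[u1 [v1 [s1 [e1 h1 -> ->]]]] /uP[u2 [v2 [s2 [e2 h2 -> ->]]]].
  apply: le_trans (@edge_pt_dist (fun w => g w - f w) d _ _ _ _ _ _ gf) _.
  rewrite -mulrA; apply: ler_wpM2l => //.
  by rewrite ler_pdivlMl //; exact: fc.
congr ambient_isotopic; apply/seteqP; split=> [_ [p Ap <-]|p].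
  have [u1 [v1 [s1 [e1 h1 pE ->]]]] := uP _ Ap.
  apply/carrierP; exists u1, v1, s1; split=> //.
  by rewrite {1}pE -edge_ptB subrKC.
move=> /carrierP[u1 [v1 [s1 [e1 h1 ->]]]].
have Ap : carrier e f (edge_pt f u1 v1 s1) by apply/carrierP; exists u1, v1, s1.
exists (edge_pt f u1 v1 s1) => //.
have [u2 [v2 [s2 [e2 h2 pE ->]]]] := uP _ Ap.
have wE : edge_wt u1 v1 s1 =1 edge_wt u2 v2 s2.
  have := fc _ _ _ _ _ _ e1 e2 h1 h2; rewrite pE subrr normr0 pmulr_rle0 // => h w.
  apply/eqP; rewrite -subr_eq0 -normr_le0; apply: le_trans h.
  by rewrite /wt_dist (bigD1 w) //= lerDl sumr_ge0.
rewrite {1}pE -edge_ptB subrKC !edge_ptE.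
by apply: eq_bigr => w _; rewrite wE.
Qed.

Lemma emb_bound_near e f g (c d : R) :
  emb_bound e f c -> (forall w, `|g w - f w| <= d) -> emb_bound e g (c - d).
Proof.
move=> fc gf u v x y s t uv xy s01 t01.
have h1 := fc _ _ _ _ _ _ uv xy s01 t01.
have h2 := @edge_pt_dist (fun w => g w - f w) d u v s x y t gf.
rewrite -!edge_ptB in h2.
have : `|edge_pt f u v s - edge_pt f x y t| <=
   `|edge_pt g u v s - edge_pt g x y t| +
   `|edge_pt g u v s - edge_pt f u v s - (edge_pt g x y t - edge_pt f x y t)|.
  set a := edge_pt f u v s; set b := edge_pt f x y t.
  set a' := edge_pt g u v s; set b' := edge_pt g x y t.
  have -> : a - b = (a' - b') - (a' - a - (b' - b)).
    by apply/rowP => i; rewrite !mxE; ring.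
  exact: ler_normB.
by rewrite mulrBl; lra.
Qed.

Lemma emb_bound_emb e f (c : R) : 0 < c -> emb_bound e f c -> emb e f.
Proof.
move=> c0 fc u v x y uv xy s t s01 t01 st w.
have := fc _ _ _ _ _ _ uv xy s01 t01; rewrite st subrr normr0 pmulr_rle0 // => h.
apply/eqP; rewrite -subr_eq0 -normr_le0; apply: le_trans h.
by rewrite /wt_dist (bigD1 w) //= lerDl sumr_ge0.
Qed.

Definition pair_bound f u v x y (c : R) := forall s t,
  0 <= s <= 1 -> 0 <= t <= 1 ->
  c * wt_dist u v s x y t <= `|edge_pt f u v s - edge_pt f x y t|.

Lemma onem_itv (s : R) : 0 <= s <= 1 -> 0 <= 1 - s <= 1.
Proof. by move=> ?; lra. Qed.

Lemma wt_dist_Cl u v s x y t : wt_dist u v s x y t = wt_dist v u (1 - s) x y t.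
Proof. by apply: eq_bigr => w _; rewrite edge_wtC. Qed.

Lemma wt_dist_sym u v s x y t : wt_dist u v s x y t = wt_dist x y t u v s.
Proof. by apply: eq_bigr => w _; rewrite distrC. Qed.

Lemma inj_edges_Cl f u v x y : inj_edges f u v x y -> inj_edges f v u x y.
Proof.
move=> h s t s01 t01; rewrite edge_ptC => /(h _ _ (onem_itv s01) t01) H w.
by rewrite edge_wtC H.
Qed.

Lemma inj_edges_sym f u v x y : inj_edges f u v x y -> inj_edges f x y u v.
Proof. by move=> h s t s01 t01 st w; rewrite (h t s). Qed.

Lemma pair_bound_Cl f u v x y c : pair_bound f v u x y c -> pair_bound f u v x y c.
Proof.
move=> h s t s01 t01; rewrite wt_dist_Cl edge_ptC; apply: h => //; exact: onem_itv.
Qed.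

Lemma pair_bound_sym f u v x y c : pair_bound f x y u v c -> pair_bound f u v x y c.
Proof. by move=> h s t s01 t01; rewrite wt_dist_sym distrC; exact: h. Qed.

Lemma edge_wt0 (u v w : V) : edge_wt u v 0 w = (w == u)%:R.
Proof. by rewrite /edge_wt; ring. Qed.

Lemma edge_wt1 (u v w : V) : edge_wt u v 1 w = (w == v)%:R.
Proof. by rewrite /edge_wt; ring. Qed.

Lemma wt_dist_le u v s x y t : 0 <= s <= 1 -> 0 <= t <= 1 ->
  wt_dist u v s x y t <= 4.
Proof.
move=> s01 t01.
have h (a b : V) r : 0 <= r <= 1 -> \sum_w `|edge_wt a b r w| <= 2.
  move=> r01; apply: (@le_trans _ _ (\sum_w ((w == a)%:R + (w == b)%:R))).
    apply: ler_sum => w _; rewrite /edge_wt.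
    by case: (w == a); case: (w == b); rewrite /= ger0_norm; lra.
  have h1 (c : V) : \sum_w ((w == c)%:R : R) = 1.
    by rewrite (bigD1 c) //= eqxx big1 ?addr0 // => w /negPf ->.
  by rewrite big_split /= !h1.
apply: (@le_trans _ _ (\sum_w (`|edge_wt u v s w| + `|edge_wt x y t w|))).
  by apply: ler_sum => w _; exact: ler_normB.
by rewrite big_split /=; have := h u v s s01; have := h x y t t01; lra.
Qed.

Lemma inj_edges_neq f u v : u != v -> inj_edges f u v u v -> f u != f v.
Proof.
move=> uv h; apply/eqP => fuv.
have := h 0 1; rewrite lexx ler01 lexx => /(_ isT isT).
rewrite /edge_pt !(subr0, subrr, scale0r, scale1r, addr0, add0r) => /(_ fuv u).
by rewrite edge_wt0 edge_wt1 eqxx (negPf uv) => /eqP; rewrite oner_eq0.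
Qed.

Lemma pair_bound_same f u v : u != v -> inj_edges f u v u v ->
  exists2 c, 0 < c & pair_bound f u v u v c.
Proof.
move=> uv h; have fuv := inj_edges_neq uv h.
have n0 : 0 < `|f v - f u| by rewrite normr_gt0 subr_eq0 eq_sym.
exists (`|f v - f u| / 2) => [|s t s01 t01]; first by rewrite divr_gt0.
have -> : edge_pt f u v s - edge_pt f u v t = (s - t) *: (f v - f u).
  by rewrite /edge_pt; apply/rowP => i; rewrite !mxE; ring.
rewrite normrZ.
suff -> : wt_dist u v s u v t = 2 * `|s - t| by rewrite mulrA divfK // mulrC.
rewrite /wt_dist (bigD1 u) //= (bigD1 v) 1?eq_sym //= big1 => [|w /andP[wu wv]].
  rewrite /edge_wt !eqxx (negPf uv) (eq_sym v) (negPf uv) addr0.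
  have -> : (1 - s) * 1%:R + s * 0%:R - ((1 - t) * 1%:R + t * 0%:R) = - (s - t) by ring.
  have -> : (1 - s) * 0%:R + s * 1%:R - ((1 - t) * 0%:R + t * 1%:R) = s - t by ring.
  by rewrite normrN; ring.
by rewrite /edge_wt (negPf wu) (negPf wv) !mulr0 !addr0 subrr normr0.
Qed.

(** Seen from the common vertex both distances are homogeneous in [(s, t)], so it suffices to bound
    the norm from below on the segment [s + t = 1]. *)
Lemma pair_bound_share f u v y : u != v -> u != y -> v != y ->
  inj_edges f u v u y -> exists2 c, 0 < c & pair_bound f u v u y c.
Proof.
move=> uv uy vy h.
pose a := f v - f u; pose b := f y - f u.
have [||c c01 cmin] := @EVT_min R (fun s => `|s *: a - (1 - s) *: b|) 0 1.
- exact: ler01.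
- apply: continuous_subspaceT => s; apply: cvg_norm.
  apply: cvgB; first by apply: cvgZr_tmp; exact: cvg_id.
  by apply: cvgZr_tmp; apply: cvgB; [exact: cvg_cst|exact: cvg_id].
pose m := `|c *: a - (1 - c) *: b|.
have m0 : 0 < m.
  rewrite normr_gt0 subr_eq0; apply/eqP => e.
  have c01' : 0 <= c <= 1 by move: c01; rewrite in_itv.
  have eq : edge_pt f u v c = edge_pt f u y (1 - c).
    have -> : edge_pt f u v c = f u + c *: a.
      by rewrite /edge_pt; apply/rowP => i; rewrite !mxE; ring.
    rewrite e; apply/rowP => i; rewrite !mxE; ring.
  have H := h _ _ c01' (onem_itv c01') eq.
  have := H v; have := H y.
  have yv : (y == v) = false by rewrite eq_sym (negPf vy).
  have yu : (y == u) = false by rewrite eq_sym (negPf uy).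
  have vu : (v == u) = false by rewrite eq_sym (negPf uv).
  by rewrite /edge_wt !eqxx (negPf vy) yv yu vu /=; lra.
exists (m / 2) => [|s t s01 t01]; first by rewrite divr_gt0.
have -> : edge_pt f u v s - edge_pt f u y t = s *: a - t *: b.
  by rewrite /edge_pt; apply/rowP => i; rewrite !mxE; ring.
have -> : wt_dist u v s u y t = `|t - s| + s + t.
  rewrite /wt_dist (bigD1 u) //= (bigD1 v) 1?eq_sym //=.
  rewrite (bigD1 y) /=; last by rewrite eq_sym uy eq_sym vy.
  rewrite big1 => [|w /andP[/andP[wu wv] wy]].
    rewrite /edge_wt !eqxx (negPf uv) (negPf uy) (negPf vy).
    rewrite !(eq_sym v) !(eq_sym y) (negPf uv) (negPf uy) (negPf vy) addr0.
    have -> : (1 - s) * 1%:R + s * 0%:R - ((1 - t) * 1%:R + t * 0%:R) = t - s by ring.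
    have -> : (1 - s) * 0%:R + s * 1%:R - ((1 - t) * 0%:R + t * 0%:R) = s by ring.
    have -> : (1 - s) * 0%:R + s * 0%:R - ((1 - t) * 0%:R + t * 1%:R) = - t by ring.
    by rewrite normrN (@ger0_norm _ s) ?(@ger0_norm _ t) ?addrA//; lra.
  by rewrite /edge_wt (negPf wu) (negPf wv) (negPf wy) !mulr0 !addr0 subrr normr0.
have : `|t - s| <= s + t by rewrite ler_norml; lra.
have [st0|st0] := eqVneq (s + t) 0.
  have -> : s = 0 by lra.
  have -> : t = 0 by lra.
  by rewrite !scale0r subrr !normr0 !addr0 mulr0.
have st1 : 0 < s + t by lra.
have sst01 : s / (s + t) \in `[0, 1].
  by rewrite in_itv /= divr_ge0 ?ler_pdivrMr //; lra.
have := cmin _ sst01.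
have -> : (s / (s + t)) *: a - (1 - s / (s + t)) *: b = (s + t)^-1 *: (s *: a - t *: b).
  by apply/rowP => i; rewrite !mxE; field.
rewrite normrZ gtr0_norm ?invr_gt0 // ler_pdivlMl // -/m => h1 h2.
have : m / 2 * (`|t - s| + s + t) <= m / 2 * ((s + t) * 2).
  by apply: ler_wpM2l; [rewrite ltW // divr_gt0|lra].
lra.
Qed.

(** By compactness the two edges are a positive distance [m] apart, while [wt_dist] never exceeds
    4. *)
Lemma pair_bound_disj f u v x y : u != x -> u != y -> v != x -> v != y ->
  inj_edges f u v x y -> exists2 c, 0 < c & pair_bound f u v x y c.
Proof.
move=> ux uy vx vy h.
pose D : set (R * R) := `[0, 1]%classic `*` `[0, 1]%classic.
have D0 : D !=set0 by exists (0, 0); split; rewrite /= in_itv /= lexx ler01.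
have cD : compact D by apply: compact_setX; exact: segment_compact.
have [|[s t] sD cmin] := compact_EVT_min (f := fun st : R * R =>
   `|edge_pt f u v st.1 - edge_pt f x y st.2|) D0 cD.
  apply: continuous_subspaceT => -[s t]; apply: cvg_norm.
  have c1 : {for (s, t), continuous (@fst R R)} by exact: cvg_fst.
  have c2 : {for (s, t), continuous (@snd R R)} by exact: cvg_snd.
  apply: cvgB; apply: cvgD; apply: cvgZr_tmp => //; apply: cvgB => //; exact: cvg_cst.
set m := `|_| in cmin.
have [s01 t01] : 0 <= s <= 1 /\ 0 <= t <= 1.
  by move: sD; rewrite inE => -[] /=; rewrite !in_itv.
have m0 : 0 < m.
  rewrite normr_gt0 subr_eq0; apply/eqP => e.
  have H := h _ _ s01 t01 e; have := H u; have := H v.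
  rewrite /edge_wt !eqxx (negPf ux) (negPf uy) (negPf vx) (negPf vy).
  by case: (u == v); case: (v == u); rewrite /=; lra.
exists (m / 4) => [|s' t' s01' t01']; first by rewrite divr_gt0.
apply: (@le_trans _ _ m); last first.
  by apply: (cmin (s', t')); rewrite inE; split; rewrite /= in_itv.
have := wt_dist_le u v x y s01' t01' => /(ler_wpM2l (ltW m0)) => ?.
by rewrite mulrAC ler_pdivrMr.
Qed.

Lemma pair_boundP f u v x y : u != v -> x != y -> inj_edges f u v u v ->
  inj_edges f u v x y -> exists2 c, 0 < c & pair_bound f u v x y c.
Proof.
move=> uv xy huv h.
have [ux|ux] := eqVneq u x.
  move: xy h; rewrite -ux => xy h.
  have [vy|vy] := eqVneq v y; first by rewrite -vy; exact: pair_bound_same.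
  exact: pair_bound_share.
have [uy|uy] := eqVneq u y.
  move: xy h; rewrite -uy => xy h.
  have [vx|vx] := eqVneq v x.
    have [c c0 cP] := pair_bound_same uv huv; exists c => //.
    by apply/pair_bound_sym/pair_bound_Cl; rewrite -vx.
  have [|c c0 cP] := @pair_bound_share f u v x uv ux vx.
    exact/inj_edges_sym/inj_edges_Cl/inj_edges_sym.
  by exists c => //; apply/pair_bound_sym/pair_bound_Cl/pair_bound_sym.
have [vx|vx] := eqVneq v x.
  move: xy h; rewrite -vx => xy h.
  have vu : v != u by rewrite eq_sym.
  have [|c c0 cP] := @pair_bound_share f v u y vu xy uy; first exact/inj_edges_Cl.
  by exists c => //; exact/pair_bound_Cl.
have [vy|vy] := eqVneq v y.
  move: xy h; rewrite -vy => xy h.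
  have vu : v != u by rewrite eq_sym.
  have [||c c0 cP] := @pair_bound_share f v u x vu _ ux; first by rewrite eq_sym.
    exact/inj_edges_Cl/inj_edges_sym/inj_edges_Cl/inj_edges_sym.
  by exists c => //; apply/pair_bound_Cl/pair_bound_sym/pair_bound_Cl/pair_bound_sym.
exact: pair_bound_disj.
Qed.

Lemma emb_boundP e f : irreflexive e -> emb e f -> exists2 c, 0 < c & emb_bound e f c.
Proof.
move=> ie ef.
have /choice[c cP] : forall q : (V * V) * (V * V), exists c : R, 0 < c /\
    (e q.1.1 q.1.2 -> e q.2.1 q.2.2 -> pair_bound f q.1.1 q.1.2 q.2.1 q.2.2 c).
  move=> [[u v] [x y]] /=.
  case uv : (e u v); last by exists 1; split.
  case xy : (e x y); last by exists 1; split.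
  have nuv : u != v by apply/eqP => uv'; rewrite uv' ie in uv.
  have nxy : x != y by apply/eqP => xy'; rewrite xy' ie in xy.
  have [c c0 cP] := pair_boundP nuv nxy (ef _ _ _ _ uv uv) (ef _ _ _ _ uv xy).
  by exists c; split.
exists (\big[Num.min/1]_q c q) => [|u v x y s t uv xy s01 t01].
  by apply/bigmin_gtP; split=> // q _; case: (cP q).
have := (cP ((u, v), (x, y))).2 uv xy s t s01 t01; apply: le_trans.
apply: ler_wpM2r; first exact: sumr_ge0.
by rewrite (bigminD1 ((u, v), (x, y))) // ge_min lexx.
Qed.

Lemma emb_locally_isotopic e f : irreflexive e -> emb e f ->
  exists2 d, 0 < d & forall g, (forall w, `|g w - f w| <= d) ->
  [/\ emb e g, ambient_isotopic (carrier e f) (carrier e g) &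
   ambient_isotopic (carrier e g) (carrier e f)].
Proof.
move=> ie /(emb_boundP ie)[c c0 cP].
(* The bound left for [g] is two thirds of [c], which still exceeds the displacement; this gives the
   isotopy back from [g] to [f]. *)
exists (c / 3) => [|g gf]; first by rewrite divr_gt0.
have c3 : 0 < c - c / 3 by lra.
have gP := emb_bound_near cP gf.
split; first exact: emb_bound_emb gP.
  by apply: emb_bound_isotopic cP gf _ => //; lra.
apply: (emb_bound_isotopic c3 gP (d := c / 3)); last lra.
by move=> w; rewrite distrC.
Qed.

(** Reachability from time 0 is locally constant in the parameter; a supremum argument carries it to
    time 1. *)
Lemma emb_path_isotopic e (F : R -> V -> E3) : irreflexive e ->
  (forall w, continuous (fun t => F t w)) ->
  (forall t, 0 <= t <= 1 -> emb e (F t)) ->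
  ambient_isotopic (carrier e (F 0)) (carrier e (F 1)).
Proof.
move=> ie cF eF.
have loc t : 0 <= t <= 1 -> exists2 d, 0 < d & forall s, `|s - t| <= d ->
   ambient_isotopic (carrier e (F t)) (carrier e (F s)) /\
   ambient_isotopic (carrier e (F s)) (carrier e (F t)).
  move=> t01; have [d d0 dP] := emb_locally_isotopic ie (eF t t01).
  have : \forall s \near t, forall w, `|F t w - F s w| <= d.
    apply: (@filter_forall _ _ (fun w s => `|F t w - F s w| <= d) (nbhs t) _) => w.
    by have /cvgrPdist_le := cF w t; exact.
  move=> /nbhs_ballP[r /= r0 rP]; exists (r / 2) => [|s st]; first by rewrite divr_gt0.
  have [|_ h1 h2] := dP (F s); last by split.
  move=> w; rewrite distrC; apply: rP; rewrite /ball /= distrC.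
  by apply: le_lt_trans st _; rewrite ltr_pdivrMr //; lra.
pose S := [set t | 0 <= t <= 1 /\ ambient_isotopic (carrier e (F 0)) (carrier e (F t))].
have S0 : S 0 by split; [rewrite lexx ler01|exact: ambient_isotopic_refl].
have hS : has_sup S by split; [exists 0|exists 1 => t [] /andP[]].
pose T := sup S.
have T01 : 0 <= T <= 1.
  by rewrite ub_le_sup //=; [apply: ge_sup; [exists 0|move=> t [] /andP[]]|exact: hS.2].
have [d d0 dP] := loc T T01.
have [s Ss sT] := sup_adherent d0 hS.
have sT' : s <= T by apply: ub_le_sup => //; exact: hS.2.
have iT : ambient_isotopic (carrier e (F 0)) (carrier e (F T)).
  apply: ambient_isotopic_trans Ss.2 _; apply: (dP s _).2.
  by rewrite distrC ger0_norm ?subr_ge0 //; rewrite -/T in sT; lra.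
have [T1|T1] := eqVneq T 1; first by rewrite -T1.
pose t := Num.min 1 (T + d).
have tT : T < t by rewrite lt_min; apply/andP; split; [rewrite lt_neqAle T1; lra|lra].
have td : t <= T + d by rewrite ge_min lexx orbT.
have t1 : t <= 1 by rewrite ge_min lexx.
have St : S t.
  split; first lra.
  apply: ambient_isotopic_trans iT _; apply: (dP t _).1.
  by rewrite ger0_norm; lra.
have : t <= T by apply: ub_le_sup => //; exact: hS.2.
by rewrite leNgt tT.
Qed.

End polygonal.

(** * Quadrilaterals *)

Section vectors.
Variable R : realType.
Local Notation E3 := 'rV[R]_3.

Lemma row3P (x y : E3) : x 0 0 = y 0 0 -> x 0 1 = y 0 1 -> x 0 2 = y 0 2 -> x = y.
Proof.
move=> h0 h1 h2; apply/rowP => -[[|[|[|//]]] i].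
- by rewrite (_ : Ordinal i = 0) //; apply/val_inj.
- by rewrite (_ : Ordinal i = 1) //; apply/val_inj.
- by rewrite (_ : Ordinal i = 2) //; apply/val_inj.
Qed.

Definition det3 (a b c : E3) : R :=
  a 0 0 * (b 0 1 * c 0 2 - b 0 2 * c 0 1)
  - a 0 1 * (b 0 0 * c 0 2 - b 0 2 * c 0 0)
  + a 0 2 * (b 0 0 * c 0 1 - b 0 1 * c 0 0).

Definition vol (a b c d : E3) : R := det3 (b - a) (c - a) (d - a).

Definition vec3 (x y z : R) : E3 :=
  \row_(i < 3) if i == 0 then x else if i == 1 then y else z.

Lemma vec3E0 x y z : vec3 x y z 0 0 = x. Proof. by rewrite mxE. Qed.
Lemma vec3E1 x y z : vec3 x y z 0 1 = y. Proof. by rewrite mxE. Qed.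
Lemma vec3E2 x y z : vec3 x y z 0 2 = z. Proof. by rewrite mxE. Qed.
Definition vec3E := (vec3E0, vec3E1, vec3E2).

(** A three-term Grassmann-Pluecker relation, used in [TL_parallel] where one of the points lies in
    the plane of [t0 t1 t2]. *)
Lemma vol_gp (t0 t1 t2 x y w : E3) :
  vol x y t0 t1 * vol t0 t1 t2 w - vol x w t0 t1 * vol t0 t1 t2 y
  + vol y w t0 t1 * vol t0 t1 t2 x = 0.
Proof. by rewrite /vol /det3 !mxE; ring. Qed.

End vectors.

Ltac vring := apply: row3P; rewrite ?mxE ?vec3E /=; ring.
Ltac volring := rewrite /vol /det3 ?mxE ?vec3E; ring.

Section fourgons.
Variable R : realType.
Local Notation E3 := 'rV[R]_3.
Implicit Types (P Q : 'I_4 -> E3).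

Definition c4 : rel 'I_4 := fun i j => j == (i.+1 %% 4)%N :> nat.

Definition poly4 P : set E3 := carrier c4 P.

Definition gon (a b c d : E3) : 'I_4 -> E3 := fun i => nth 0 [:: a; b; c; d] i.

Lemma c4_irr : irreflexive c4.
Proof. by case=> [[|[|[|[|//]]]] i]. Qed.

Lemma poly4P a b c d x : poly4 (gon a b c d) x <->
  exists2 s, 0 <= s <= 1 & [\/ x = (1 - s) *: a + s *: b,
    x = (1 - s) *: b + s *: c, x = (1 - s) *: c + s *: d |
    x = (1 - s) *: d + s *: a].
Proof.
split=> [/carrierP[[[|[|[|[|//]]]] i]] [[[|[|[|[|//]]]] j]] [s [// _ s01 ->]]|].
- by exists s => //; exact: Or41.
- by exists s => //; exact: Or42.
- by exists s => //; exact: Or43.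
- by exists s => //; exact: Or44.
move=> [s s01 [] ->]; apply/carrierP.
- by exists (inord 0), (inord 1), s; split; rewrite // /c4 /edge_pt /gon ?inordK.
- by exists (inord 1), (inord 2), s; split; rewrite // /c4 /edge_pt /gon ?inordK.
- by exists (inord 2), (inord 3), s; split; rewrite // /c4 /edge_pt /gon ?inordK.
- by exists (inord 3), (inord 0), s; split; rewrite // /c4 /edge_pt /gon ?inordK.
Qed.

Definition kite (p u v y : E3) := gon (p + u) (p + v) (p - u) (p + y).

(** Projection along [w] gives, in the coordinates [X] and [Y], the plane kite with corners (1, 0),
    (0, 1), (-1, 0), (0, -s). It is embedded even for [s = 0], when the last corner lies inside a
    side of a triangle. *)
Lemma emb_kite (p u v w : E3) (s r : R) : det3 u v w != 0 -> 0 <= s ->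
  emb c4 (kite p u v (- s *: v + r *: w)).
Proof.
move=> uvw s0.
pose X x := det3 (x - p) v w / det3 u v w.
pose Y x := det3 u (x - p) w / det3 u v w.
have XZ a b t : X ((1 - t) *: a + t *: b) = (1 - t) * X a + t * X b.
  by rewrite /X /det3 !mxE; ring.
have YZ a b t : Y ((1 - t) *: a + t *: b) = (1 - t) * Y a + t * Y b.
  by rewrite /Y /det3 !mxE; ring.
have X0 : X (p + u) = 1.
  by rewrite -[RHS](divff uvw) /X; congr (_ / _); rewrite /det3 !mxE; ring.
have X1 : X (p + v) = 0.
  by rewrite /X [det3 _ _ _](_ : _ = 0) ?mul0r // /det3 !mxE; ring.
have X2 : X (p - u) = - 1.
  have -> : -1 = - det3 u v w / det3 u v w by rewrite mulNr divff.
  by rewrite /X; congr (_ / _); rewrite /det3 !mxE; ring.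
have X3 : X (p + (- s *: v + r *: w)) = 0.
  by rewrite /X [det3 _ _ _](_ : _ = 0) ?mul0r // /det3 !mxE; ring.
have Y0 : Y (p + u) = 0.
  by rewrite /Y [det3 _ _ _](_ : _ = 0) ?mul0r // /det3 !mxE; ring.
have Y1 : Y (p + v) = 1.
  by rewrite -[RHS](divff uvw) /Y; congr (_ / _); rewrite /det3 !mxE; ring.
have Y2 : Y (p - u) = 0.
  by rewrite /Y [det3 _ _ _](_ : _ = 0) ?mul0r // /det3 !mxE; ring.
have Y3 : Y (p + (- s *: v + r *: w)) = - s.
  rewrite -[s in RHS]mulr1 -(divff uvw) mulrA -mulNr /Y; congr (_ / _).
  by rewrite /det3 !mxE; ring.
move=> u1 v1 u2 v2 e1 e2 a b a01 b01 ab.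
have := congr1 X ab; have := congr1 Y ab; rewrite /edge_pt !XZ !YZ.
clear ab XZ YZ.
case: u1 e1 => [[|[|[|[|//]]]] ?]; case: v1 => [[|[|[|[|//]]]] ?] // _;
case: u2 e2 => [[|[|[|[|//]]]] ?]; case: v2 => [[|[|[|[|//]]]] ?] // _;
rewrite /kite /gon /= ?X0 ?X1 ?X2 ?X3 ?Y0 ?Y1 ?Y2 ?Y3 => h1 h2.
all: clear - s0 a01 b01 h1 h2.
all: case=> [[|[|[|[|//]]]] ?]; rewrite /edge_wt -!val_eqE /=; first [lra | nra].
Qed.

(** A skew quadrilateral is a kite about the midpoint [m] of [a c]: along [d - m] the fourth corner
    projects to [m], which is the case [s = 0]. *)
Lemma emb_gon (a b c d : E3) : vol a b c d != 0 -> emb c4 (gon a b c d).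
Proof.
move=> h.
pose m : E3 := 2^-1 *: (a + c).
have -> : gon a b c d = kite m (a - m) (b - m) (- 0 *: (b - m) + 1 *: (d - m)).
  by rewrite /kite; congr gon; rewrite /m; apply: row3P; rewrite ?mxE; field.
apply: emb_kite => //; apply: contra h => /eqP h; apply/eqP.
have -> : vol a b c d = 2 * det3 (a - m) (b - m) (d - m); last by rewrite h mulr0.
by rewrite /vol /det3 /m !mxE; field.
Qed.

Definition cc4 : rel ('I_4 + 'I_4)%type := fun x y =>
  match x, y with inl i, inl j => c4 i j | inr i, inr j => c4 i j | _, _ => false end.

Definition two4 P Q : 'I_4 + 'I_4 -> E3 := fun x =>
  match x with inl i => P i | inr j => Q j end.

Lemma carrier_two4 P Q : carrier cc4 (two4 P Q) = poly4 P `|` poly4 Q.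
Proof.
apply/seteqP; split=> x.
  move=> /carrierP[[u|u]] [[v|v]] [s [// h s01 ->]].
    by left; apply/carrierP; exists u, v, s.
  by right; apply/carrierP; exists u, v, s.
move=> [] /carrierP[u [v [s [h s01 ->]]]]; apply/carrierP.
  by exists (inl u), (inl v), s.
by exists (inr u), (inr v), s.
Qed.

Lemma emb_two4 P Q : emb c4 P -> emb c4 Q -> poly4 P `&` poly4 Q = set0 ->
  emb cc4 (two4 P Q).
Proof.
move=> eP eQ PQ [u|u] [v|v] [x|x] [y|y] //= uv xy s t s01 t01 st.
- have H := eP _ _ _ _ uv xy _ _ s01 t01 st.
  by case=> w; [exact: H|rewrite /edge_wt /= !mulr0].
- have : (poly4 P `&` poly4 Q) (edge_pt P u v s).
    by split; apply/carrierP; [exists u, v, s|exists x, y, t].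
  by rewrite PQ.
- have : (poly4 P `&` poly4 Q) (edge_pt Q u v s).
    by split; apply/carrierP; [exists x, y, t|exists u, v, s].
  by rewrite PQ.
- have H := eQ _ _ _ _ uv xy _ _ s01 t01 st.
  by case=> w; [rewrite /edge_wt /= !mulr0|exact: H].
Qed.

Lemma poly4_path_isotopic (P Q : R -> 'I_4 -> E3) :
  (forall i, continuous (fun t => P t i)) ->
  (forall i, continuous (fun t => Q t i)) ->
  (forall t, 0 <= t <= 1 -> emb c4 (P t)) ->
  (forall t, 0 <= t <= 1 -> emb c4 (Q t)) ->
  (forall t x, 0 <= t <= 1 -> poly4 (P t) x -> poly4 (Q t) x -> False) ->
  ambient_isotopic (poly4 (P 0) `|` poly4 (Q 0)) (poly4 (P 1) `|` poly4 (Q 1)).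
Proof.
move=> cP cQ eP eQ PQ; rewrite -!carrier_two4.
apply: (emb_path_isotopic (F := fun t => two4 (P t) (Q t))).
- by case=> i; exact: c4_irr.
- by case=> i; [exact: cP|exact: cQ].
- move=> t t01; apply: emb_two4; [exact: eP|exact: eQ|].
  by apply/seteqP; split=> // x [hP hQ]; exact: (PQ t x).
Qed.

Lemma trivial_link_isotopic (A B : set E3) :
  ambient_isotopic A B -> trivial_link B -> trivial_link A.
Proof. by move=> AB [U pU BU]; exists U => //; apply: ambient_isotopic_trans BU. Qed.

End fourgons.

(** * Rounding squares *)

Section rounding.
Variable R : realType.
Local Notation E3 := 'rV[R]_3.
Implicit Types (P Q : 'I_4 -> E3).

Definition square (p : E3) := kite p (vec3 1 1 0) (vec3 (-1) 1 0) (vec3 1 (-1) 0).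

Lemma poly4_square (p x : E3) : poly4 (square p) x <->
  x 0 2 = p 0 2 /\
  [\/ x 0 0 - p 0 0 = 1 /\ `|x 0 1 - p 0 1| <= 1,
      x 0 0 - p 0 0 = -1 /\ `|x 0 1 - p 0 1| <= 1,
      x 0 1 - p 0 1 = 1 /\ `|x 0 0 - p 0 0| <= 1 |
      x 0 1 - p 0 1 = -1 /\ `|x 0 0 - p 0 0| <= 1].
Proof.
rewrite poly4P; split.
  move=> [s s01 [] ->]; rewrite !mxE ?vec3E /=; (split; first by ring);
    rewrite !ler_norml.
  - by apply: Or43; split; lra.
  - by apply: Or42; split; lra.
  - by apply: Or44; split; lra.
  - by apply: Or41; split; lra.
move=> [x2 []] [h1]; rewrite ler_norml => h2.
- exists ((x 0 1 - p 0 1 + 1) / 2); first lra.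
  by apply: Or44; apply: row3P; rewrite !mxE /=; lra.
- exists ((1 - (x 0 1 - p 0 1)) / 2); first lra.
  by apply: Or42; apply: row3P; rewrite !mxE /=; lra.
- exists ((1 - (x 0 0 - p 0 0)) / 2); first lra.
  by apply: Or41; apply: row3P; rewrite !mxE /=; lra.
- exists ((x 0 0 - p 0 0 + 1) / 2); first lra.
  by apply: Or43; apply: row3P; rewrite !mxE /=; lra.
Qed.

(** A point [(1, y)] of the square has Euclidean norm [hyp y], and [rad y] is the relative stretch
    that takes it to the circle of radius [sqrt 2]. *)
Definition hyp (y : R) : R := Num.sqrt (1 + y ^+ 2).
Definition rad (y : R) : R := Num.sqrt 2 / hyp y - 1.

Lemma hyp2 y : hyp y ^+ 2 = 1 + y ^+ 2.
Proof. by rewrite /hyp sqr_sqrtr // addr_ge0 // sqr_ge0. Qed.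

Lemma hyp_ge1 y : 1 <= hyp y.
Proof. by rewrite -sqrtr1 /hyp ler_sqrt ?lerDl ?sqr_ge0 // addr_ge0 // sqr_ge0. Qed.

Lemma sqrt2_bounds : 14 / 10 <= Num.sqrt (2 : R) <= 15 / 10.
Proof.
have h : Num.sqrt (2 : R) ^+ 2 = 2 by rewrite sqr_sqrtr.
have h0 : 0 <= Num.sqrt (2 : R) by exact: sqrtr_ge0.
by apply/andP; split; nra.
Qed.

Lemma hyp_gt0 y : 0 < hyp y.
Proof. exact: lt_le_trans (hyp_ge1 y). Qed.

(** The difference quotient is at most half of [sqrt 2], because [|y + z|] is at most half of
    [hyp y ^+ 2 + hyp z ^+ 2]. *)
Lemma rad_lip (y z : R) : `|y| <= 1 -> `|z| <= 1 ->
  `|rad y - rad z| <= 8 / 10 * `|y - z|.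
Proof.
move=> y1 z1; have A0 := hyp_gt0 y; have B0 := hyp_gt0 z.
have A1 := hyp_ge1 y; have B1 := hyp_ge1 z; have A2 := hyp2 y; have B2 := hyp2 z.
have /andP[_ s2] := sqrt2_bounds; have s0 : 0 <= Num.sqrt (2 : R) by exact: sqrtr_ge0.
have -> : rad y - rad z = (z - y) * (Num.sqrt 2 * (y + z) / (hyp y * hyp z * (hyp y + hyp z))).
  have e : (hyp z - hyp y) * (hyp y + hyp z) = (z - y) * (z + y).
    by transitivity (hyp z ^+ 2 - hyp y ^+ 2); [ring|rewrite A2 B2; ring].
  have AB : hyp y + hyp z != 0 by rewrite gt_eqF // addr_gt0.
  have -> : rad y - rad z = Num.sqrt 2 * ((hyp z - hyp y) * (hyp y + hyp z)) / (hyp y * hyp z * (hyp y + hyp z)).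
    by rewrite /rad; field; rewrite AB !gt_eqF.
  by rewrite e; field; rewrite AB !gt_eqF.
rewrite normrM distrC mulrC ler_wpM2r //.
rewrite normrM normfV (ger0_norm (x := _ * _ * _)); last by rewrite !mulr_ge0 ?addr_ge0 // ltW.
rewrite ler_pdivrMr ?mulr_gt0 ?addr_gt0 // normrM (ger0_norm s0).
move: y1 z1; rewrite !ler_norml => /andP[y1 y2] /andP[z1 z2].
have : `|y + z| <= (hyp y ^+ 2 + hyp z ^+ 2) / 2 by rewrite A2 B2 ler_norml; nra.
have : hyp y ^+ 2 + hyp z ^+ 2 <= hyp y * hyp z * (hyp y + hyp z).
  have : hyp y * hyp y <= hyp y * hyp y * hyp z by rewrite ler_peMr // mulr_ge0 // ltW.
  have : hyp z * hyp z <= hyp z * hyp z * hyp y by rewrite ler_peMr // mulr_ge0 // ltW.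
  nra.
move=> h1 h2; have : Num.sqrt 2 * `|y + z| <= 15 / 10 * `|y + z| by rewrite ler_wpM2r.
by have := sqr_ge0 (hyp y); have := sqr_ge0 (hyp z); lra.
Qed.

Lemma rad_lip2 (y z : R) : `|y| <= 1 -> `|z| <= 1 ->
  `|y * rad y - z * rad z| <= 8 / 10 * `|y - z|.
Proof.
wlog yz : y z / z <= y.
  move=> W y1 z1; have [h|/ltW h] := leP z y; first exact: W.
  by rewrite distrC (distrC y); apply: W.
move=> y1 z1; have A0 := hyp_gt0 y; have B0 := hyp_gt0 z.
have A1 := hyp_ge1 y; have B1 := hyp_ge1 z; have A2 := hyp2 y; have B2 := hyp2 z.
have /andP[s1 s2] := sqrt2_bounds.
have AB : hyp y + hyp z != 0 by rewrite gt_eqF // addr_gt0.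
pose k := (hyp y * hyp z + 1 - y * z) / (hyp y * hyp z * (hyp y + hyp z)).
have -> : y * rad y - z * rad z = (y - z) * (Num.sqrt 2 * k - 1).
  have e : (y * hyp z - z * hyp y) * (hyp y + hyp z) = (y - z) * (hyp y * hyp z + 1 - y * z).
    have -> : (y * hyp z - z * hyp y) * (hyp y + hyp z) =
       (y - z) * (hyp y * hyp z) + y * hyp z ^+ 2 - z * hyp y ^+ 2 by ring.
    by rewrite A2 B2; ring.
  have -> : y * rad y - z * rad z = Num.sqrt 2 * ((y * hyp z - z * hyp y) * (hyp y + hyp z)) /
      (hyp y * hyp z * (hyp y + hyp z)) - (y - z).
    by rewrite /rad; field; rewrite AB !gt_eqF.
  by rewrite e /k; field; rewrite AB !gt_eqF.
rewrite normrM mulrC ler_wpM2r //.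
move: y1 z1; rewrite !ler_norml => /andP[y1 y2] /andP[z1 z2].
have k1 : k <= 1.
  rewrite /k ler_pdivrMr ?mulr_gt0 ?addr_gt0 // mul1r.
  have : 1 - y * z <= hyp y * hyp z.
    rewrite -(@ler_sqr _ (1 - y * z)) ?nnegrE ?mulr_ge0 ?(ltW A0) ?(ltW B0) //; last nra.
    rewrite exprMn A2 B2 -subr_ge0.
    have -> : (1 + y ^+ 2) * (1 + z ^+ 2) - (1 - y * z) ^+ 2 = (y + z) ^+ 2 by ring.
    exact: sqr_ge0.
  have : hyp y * hyp z * 2 <= hyp y * hyp z * (hyp y + hyp z).
    by rewrite ler_wpM2l ?mulr_ge0 ?(ltW A0) ?(ltW B0) //; lra.
  lra.
have A3 : hyp y <= 15 / 10 by have := sqr_ge0 (hyp y); nra.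
have B3 : hyp z <= 15 / 10 by nra.
have k3 : 1 / 3 <= k.
  rewrite /k ler_pdivlMr ?mulr_gt0 ?addr_gt0 //.
  have : hyp y * hyp z * (hyp y + hyp z) <= hyp y * hyp z * 3.
    by rewrite ler_wpM2l ?mulr_ge0 ?(ltW A0) ?(ltW B0) //; lra.
  have yz1 : y * z <= 1 by nra.
  lra.
by apply/andP; split; nra.
Qed.

Lemma rad1 : rad 1 = 0.
Proof. by rewrite /rad /hyp expr1n divff ?subrr // gt_eqF // sqrtr_gt0. Qed.

Lemma rad_bounds y : `|y| <= 1 -> 0 <= rad y <= 5 / 10 /\ rad y <= 8 / 10 * (1 - `|y|).
Proof.
move=> y1; have A0 := hyp_gt0 y; have /andP[s1 s2] := sqrt2_bounds.
have A1 := hyp_ge1 y; have A2 := hyp2 y.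
have hn : rad y = rad `|y| by rewrite /rad /hyp real_normK ?num_real.
have -> : 0 <= rad y <= 5 / 10.
  rewrite /rad; apply/andP; split.
    rewrite subr_ge0 ler_pdivlMr // mul1r /hyp ler_sqrt //.
    by rewrite -[y ^+ 2]real_normK ?num_real //; have := normr_ge0 y; nra.
  by rewrite lerBlDr ler_pdivrMr //; nra.
split=> //; have := @rad_lip `|y| 1; rewrite normr_id normr1 lexx rad1 subr0 -hn.
move=> /(_ y1 isT); rewrite ler_norml distrC (@ger0_norm _ (1 - _)) ?subr_ge0 //.
by case/andP.
Qed.

Lemma rad_abs y : rad `|y| = rad y.
Proof. by rewrite /rad /hyp real_normK ?num_real. Qed.

Definition radm (X Y : R) := rad (Num.min `|X| `|Y|).

Lemma radmC X Y : radm X Y = radm Y X.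
Proof. by rewrite /radm minC. Qed.

Lemma radm1 X Y : `|X| = 1 -> `|Y| <= 1 -> radm X Y = rad Y.
Proof. by move=> X1 Y1; rewrite /radm X1 min_r // rad_abs. Qed.

Definition onsq (X Y : R) := (`|X| = 1 /\ `|Y| <= 1) \/ (`|Y| = 1 /\ `|X| <= 1).

Lemma onsqC X Y : onsq X Y -> onsq Y X.
Proof. by case; [right|left]. Qed.

(** Points on the same or on opposite sides of the square reduce to [rad_lip], [rad_lip2] and the
    bounds on [rad]. For adjacent sides, [mixed] uses that [rad] decreases to 0 towards the corner
    at least as fast as [rad_bounds] says. *)
Lemma radm_lip X Y X' Y' M : onsq X Y -> onsq X' Y' ->
  `|X - X'| <= M -> `|Y - Y'| <= M ->
  `|radm X Y * X - radm X' Y' * X'| <= 8 / 10 * M.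
Proof.
have N1 (a : R) : `|a| = 1 -> a = 1 \/ a = -1.
  by move/eqP; rewrite eqr_norml ler01 andbT => /orP[]/eqP; [left|right].
have mixed (a b c d : R) : `|a| = 1 -> `|b| <= 1 -> `|d| = 1 -> `|c| <= 1 ->
    `|a - c| <= M -> `|b - d| <= M -> `|rad b * a - rad c * c| <= 8 / 10 * M.
  move=> /N1 a1 b1 /N1 d1 c1.
  have [hb hb'] := rad_bounds b1; have [hc hc'] := rad_bounds c1.
  have := ler_norm b; have := ler_norm (- b); rewrite normrN.
  have := ler_norm c; have := ler_norm (- c); rewrite normrN.
  move: b1 c1; rewrite !ler_norml => b1 c1.
  have hm : 0 <= c -> 0 <= rad c * c <= rad c /\ rad c * c <= c / 2.
    by move=> ?; split; [apply/andP; split; nra|nra].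
  have hm' : c <= 0 -> c / 2 <= rad c * c <= 0 /\ - rad c <= rad c * c.
    by move=> ?; split; [apply/andP; split; nra|nra].
  have [/hm c0|/ltW /[dup] ? /hm' c0] := leP 0 c; clear - a1 d1 b1 c1 hb hb' hc hc' c0;
    by case: a1 => ->; case: d1 => ->; lra.
case=> [[X1 Y1]|[Y1 X1]] [[X1' Y1']|[Y1' X1']].
- rewrite !radm1 // => h1 h2; have := rad_lip Y1 Y1'; move/le_trans => /(_ (8 / 10 * M)).
  rewrite ler_wpM2l // => /(_ isT); move: h1.
  have [hb hb'] := rad_bounds Y1; have [hc hc'] := rad_bounds Y1'.
  case: (N1 _ X1) => ->; case: (N1 _ X1') => ->; rewrite !ler_norml; lra.
- by rewrite radm1 // radmC radm1 //; exact: mixed.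
- rewrite radmC radm1 // radm1 // => h1 h2.
  by rewrite distrC; apply: (mixed _ _ _ Y) => //; rewrite distrC.
- rewrite radmC (radmC X') !radm1 // => h1 _.
  by rewrite mulrC (mulrC (rad X')); have := rad_lip2 X1 X1'; lra.
Qed.

Lemma radm_bound X Y : onsq X Y -> `|radm X Y * X| <= 5 / 10.
Proof.
have h (a b : R) : 0 <= a <= 5 / 10 -> `|b| <= 1 -> `|a * b| <= 5 / 10.
  by rewrite !ler_norml => ? ?; apply/andP; split; nra.
case=> [[X1 Y1]|[Y1 X1]]; [rewrite radm1 //|rewrite radmC radm1 //]; apply: h.
- by have [] := rad_bounds Y1.
- by rewrite X1.
- by have [] := rad_bounds X1.
- exact: X1.
Qed.

Lemma onsq_square p x : poly4 (square p) x <->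
  x 0 2 = p 0 2 /\ onsq (x 0 0 - p 0 0) (x 0 1 - p 0 1).
Proof.
rewrite poly4_square; split=> -[-> H]; split=> //.
  by case: H => -[-> h]; [left|left|right|right]; rewrite ?normrN ?normr1.
by case: H => -[/eqP]; rewrite eqr_norml ler01 andbT => /orP[]/eqP h1 h2;
  [apply: Or41|apply: Or42|apply: Or43|apply: Or44].
Qed.

(* On the square the norm of [(X, Y)] is [hyp m] with [m] the smaller of [|X|] and [|Y|], so this
   is the radial displacement to the circumscribed circle. It is 4/5-Lipschitz. *)
Definition bulge (p x : E3) : E3 :=
  let h := radm (x 0 0 - p 0 0) (x 0 1 - p 0 1) in
  vec3 (h * (x 0 0 - p 0 0)) (h * (x 0 1 - p 0 1)) 0.

Lemma norm_vec3 (x : E3) (M : R) : `|x 0 0| <= M -> `|x 0 1| <= M -> `|x 0 2| <= M -> `|x| <= M.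
Proof.
move=> h0 h1 h2; apply/norm3_leP => -[[|[|[|//]]] i].
- by rewrite (_ : Ordinal i = 0) //; apply/val_inj.
- by rewrite (_ : Ordinal i = 1) //; apply/val_inj.
- by rewrite (_ : Ordinal i = 2) //; apply/val_inj.
Qed.

Lemma bulge_lip p x y : poly4 (square p) x -> poly4 (square p) y ->
  `|bulge p x - bulge p y| <= 8 / 10 * `|x - y|.
Proof.
move=> /onsq_square[x2 hx] /onsq_square[y2 hy].
have h0 : `|x 0 0 - p 0 0 - (y 0 0 - p 0 0)| <= `|x - y|.
  by have := coord_norm3 (x - y) 0; rewrite !mxE opprB addrA subrK.
have h1 : `|x 0 1 - p 0 1 - (y 0 1 - p 0 1)| <= `|x - y|.
  by have := coord_norm3 (x - y) 1; rewrite !mxE opprB addrA subrK.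
apply: norm_vec3; rewrite ![in X in X <= _]mxE.
- exact: radm_lip.
- by rewrite /= radmC (radmC (y 0 0 - _)); apply: radm_lip => //; exact: onsqC.
- by rewrite /= subrr normr0 mulr_ge0.
Qed.

Lemma bulge_bound p x : poly4 (square p) x -> `|bulge p x| <= 5 / 10.
Proof.
move=> /onsq_square[x2 hx]; apply: norm_vec3; rewrite mxE /=.
- exact: radm_bound.
- by rewrite radmC; apply: radm_bound; exact: onsqC.
- by rewrite normr0.
Qed.

Lemma dotE (x y : E3) : dot x y = x 0 0 * y 0 0 + x 0 1 * y 0 1 + x 0 2 * y 0 2.
Proof.
rewrite /dot mxE !big_ord_recr big_ord0 /= add0r !mxE.
by congr (_ * _ + _ * _ + _ * _); congr (_ 0 _); apply/val_inj.
Qed.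

Lemma bulge_circle p : [set x + bulge p x | x in poly4 (square p)] =
  circle3 (vec3 0 0 1) p (Num.sqrt 2).
Proof.
apply/seteqP; split=> [_ [x /onsq_square[x2 hx] <-]|y].
  rewrite /circle3 /= !dotE !mxE /= sqr_sqrtr // x2; split; first ring.
  set X := x 0 0 - p 0 0; set Y := x 0 1 - p 0 1; set h := radm X Y.
  have -> : x 0 0 + h * X - p 0 0 = (1 + h) * X by rewrite /X; ring.
  have -> : x 0 1 + h * Y - p 0 1 = (1 + h) * Y by rewrite /Y; ring.
  have key (w : R) : (1 + rad w) ^+ 2 * (1 + w ^+ 2) = 2.
    rewrite /rad addrC subrK expr_div_n sqr_sqrtr // hyp2 divfK // gt_eqF //.
    by rewrite ltr_pwDl // sqr_ge0.
  have N1 (a : R) : `|a| = 1 -> a ^+ 2 = 1.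
    by move=> a1; rewrite -real_normK ?num_real // a1 expr1n.
  case: (hx) => -[a1 b1]; rewrite /h; [|rewrite radmC]; rewrite radm1 //.
      have a2 := N1 _ a1; transitivity ((1 + rad Y) ^+ 2 * (X ^+ 2 + Y ^+ 2)); first by ring.
    by rewrite a2 key.
  have a2 := N1 _ a1; transitivity ((1 + rad X) ^+ 2 * (Y ^+ 2 + X ^+ 2)); first by ring.
  by rewrite a2 key.
rewrite /circle3 /= !dotE !mxE /= sqr_sqrtr // => -[y2 yc].
have {}y2 : y 0 2 = p 0 2 by move: y2; rewrite !mul0r !add0r mul1r => /eqP; rewrite subr_eq0 => /eqP.
set X := y 0 0 - p 0 0 in yc; set Y := y 0 1 - p 0 1 in yc.
have {}yc : X ^+ 2 + Y ^+ 2 = 2 by rewrite -yc y2; ring.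
(* The preimage of [y] is found by radial projection to the square, that is, by dividing by the
   larger absolute coordinate. *)
pose N := Num.max `|X| `|Y|; pose W := Num.min `|X| `|Y|.
have NW : N ^+ 2 + W ^+ 2 = 2.
  rewrite -yc -(@real_normK _ X) ?num_real // -(@real_normK _ Y) ?num_real // /N /W.
  by case: (leP `|X| `|Y|) => _ //; rewrite addrC.
have WN : W <= N by rewrite /W /N ge_min !le_max lexx.
have W0 : 0 <= W by rewrite le_min !normr_ge0.
have N0 : 0 < N by nra.
have hN : 1 + rad (W / N) = N.
  rewrite /rad addrC subrK.
  have -> : hyp (W / N) = Num.sqrt 2 / N.
    rewrite /hyp -[RHS](@ger0_norm _ _) ?divr_ge0 ?sqrtr_ge0 ?ltW // -sqrtr_sqr.
    congr Num.sqrt; rewrite !expr_div_n sqr_sqrtr // -NW; field; exact: lt0r_neq0.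
  by rewrite invf_div mulrCA divff ?mulr1 // gt_eqF // sqrtr_gt0.
have Nn (a : R) : `|a / N| = `|a| / N by rewrite normrM normfV (gtr0_norm N0).
have hm : radm (X / N) (Y / N) = rad (W / N).
  rewrite /radm !Nn; congr rad; rewrite /W.
  by rewrite !minElt ltr_pM2r ?invr_gt0 //; case: ifP.
exists (vec3 (p 0 0 + X / N) (p 0 1 + Y / N) (p 0 2)).
  apply/onsq_square; rewrite !mxE /=; split=> //.
  rewrite ![p 0 _ + _]addrC !addrK; rewrite /onsq !Nn.
  have Xn : `|X| <= N by rewrite le_max lexx.
  have Yn : `|Y| <= N by rewrite le_max lexx orbT.
  have [h|h] := leP `|X| `|Y|.
    by right; rewrite ler_pdivrMr // mul1r; split=> //; rewrite -(max_r h) divff // gt_eqF.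
  by left; rewrite ler_pdivrMr // mul1r; split=> //; rewrite -(max_l (ltW h)) divff // gt_eqF.
rewrite /bulge; apply: row3P; rewrite !mxE /= ?addr0 //.
- rewrite ![p 0 _ + _]addrC !addrK hm -[in RHS](subrK (p 0 0) (y 0 0)) -/X.
  have -> : rad (W / N) = N - 1 by apply/eqP; rewrite eq_sym subr_eq addrC hN.
  by field; exact: lt0r_neq0.
- rewrite ![p 0 _ + _]addrC !addrK hm -[in RHS](subrK (p 0 1) (y 0 1)) -/Y.
  have -> : rad (W / N) = N - 1 by apply/eqP; rewrite eq_sym subr_eq addrC hN.
  by field; exact: lt0r_neq0.
Qed.

Definition far : E3 := vec3 4 0 0.

(** With centres 4 apart the squares leave a gap of 2, while the two bulges add up to at most 1; so
    the displacement is 4/5-Lipschitz across the gap as well. *)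
Lemma trivial_squares : trivial_link (poly4 (square 0) `|` poly4 (square far)).
Proof.
have S0 x : poly4 (square 0) x -> x 0 0 <= 1.
  move=> /onsq_square[_]; rewrite !mxE !subr0 => -[[/eqP]|[_]]; last by rewrite ler_norml => /andP[].
  by rewrite eqr_norml => /andP[/orP[]/eqP -> _ _]; lra.
have S1 x : poly4 (square far) x -> 3 <= x 0 0.
  move=> /onsq_square[_]; rewrite !mxE /= => -[[/eqP]|[_]]; last by rewrite ler_norml => /andP[]; lra.
  by rewrite eqr_norml => /andP[/orP[]/eqP h _ _]; lra.
exists (circle3 (vec3 0 0 1) 0 (Num.sqrt 2) `|` circle3 (vec3 0 0 1) far (Num.sqrt 2)).
  exists (vec3 0 0 1), 0, far, (Num.sqrt 2), (Num.sqrt 2); split=> //.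
  - by apply/eqP => /(congr1 (fun x : E3 => x 0 2)); rewrite !mxE /= => /eqP; rewrite oner_eq0.
  - by rewrite dotE !mxE /=; ring.
  - apply/seteqP; split=> // x [[_]] /=; rewrite sqr_sqrtr // dotE !mxE /= => h1 [_].
    by rewrite dotE !mxE /= sqr_sqrtr // => h2; nra.
pose u (x : E3) := if x 0 0 < 2 then bulge 0 x else bulge far x.
have u0 x : poly4 (square 0) x -> u x = bulge 0 x.
  by move=> /S0 h; rewrite /u ifT //; lra.
have u1 x : poly4 (square far) x -> u x = bulge far x.
  by move=> /S1 h; rewrite /u ifF //; lra.
have /(@small_displacement R _ u) : 0 <= (8 / 10 : R) < 1 by lra.
move=> /(_ (poly4 (square 0) `|` poly4 (square far)))[].
  have mix x y : poly4 (square 0) x -> poly4 (square far) y ->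
     `|u x - u y| <= 8 / 10 * `|x - y|.
    move=> hx hy; have := coord_norm3 (x - y) 0; rewrite !mxE distrC => h.
    have := S0 _ hx; have := S1 _ hy => a b; rewrite ger0_norm in h; last lra.
    rewrite u0 // u1 //; apply: le_trans (ler_normB _ _) _.
    by have := bulge_bound hx; have := bulge_bound hy; lra.
  move=> x y [hx|hx] [hy|hy].
  - by rewrite !u0 //; exact: bulge_lip.
  - exact: mix.
  - by rewrite distrC (distrC x); exact: mix.
  - by rewrite !u1 //; exact: bulge_lip.
move=> H HH; exists H; move: HH; rewrite !image_setU.
rewrite -!bulge_circle.
suff -> : [set x + u x | x in poly4 (square 0)] = [set x + bulge 0 x | x in poly4 (square 0)].
  suff -> : [set x + u x | x in poly4 (square far)] = [set x + bulge far x | x in poly4 (square far)] by [].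
  by apply: eq_imagel => x hx; rewrite u1.
by apply: eq_imagel => x hx; rewrite u0.
Qed.
End rounding.

(** * Small quadrilaterals *)

Section beads.
Variable R : realType.
Local Notation E3 := 'rV[R]_3.
Implicit Types (P Q : 'I_4 -> E3).

Lemma nonroot_small (p : {poly R}) (e : R) : p != 0 -> 0 < e ->
  exists2 t, 0 < t <= e & p.[t] != 0.
Proof.
move=> p0 e0; apply: contrapT => H.
pose rs := [seq e / k.+1%:R | k <- iota 0 (size p)].
have : (size rs < size p)%N.
  apply: max_poly_roots => //.
    apply/allP => _ /mapP[k _ ->]; apply/negPn/negP => nr; apply: H.
    exists (e / k.+1%:R) => //.
    by rewrite divr_gt0 ?ltr0n //= ler_piMr ?invf_le1 ?ltr0n ?ler1n ?(ltW e0).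
  rewrite map_inj_uniq ?iota_uniq // => i j /(mulfI (lt0r_neq0 e0)).
  by move=> /invr_inj /eqP; rewrite eqr_nat => /eqP [].
by rewrite size_map size_iota ltnn.
Qed.

(** On the curve [a + t b + t^2 c] each of the three linear functionals is a nonzero polynomial in
    [t]. *)
Lemma avoid3 (a b c : E3) (f g h : E3 -> R) :
  (forall x y z t r, f (x + t *: y + r *: z) = f x + t * f y + r * f z) ->
  (forall x y z t r, g (x + t *: y + r *: z) = g x + t * g y + r * g z) ->
  (forall x y z t r, h (x + t *: y + r *: z) = h x + t * h y + r * h z) ->
  f a != 0 -> g b != 0 -> h c != 0 ->
  exists x, [/\ f x != 0, g x != 0 & h x != 0].
Proof.
move=> fE gE hE fa gb hc.
pose pol (k : E3 -> R) : {poly R} := Poly [:: k a; k b; k c].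
have polE (k : E3 -> R) t : (forall x y z t r, k (x + t *: y + r *: z) = k x + t * k y + r * k z) ->
    k (a + t *: b + (t ^+ 2) *: c) = (pol k).[t].
  by move=> kE; rewrite kE horner_Poly /=; ring.
have pn (k : E3 -> R) i : nth 0 [:: k a; k b; k c] i != 0 -> pol k != 0.
  by move=> h'; apply: contra h' => /eqP e; rewrite -coef_Poly -/(pol k) e coef0.
have := @nonroot_small (pol f * pol g * pol h) 1.
rewrite !mulf_neq0 ?(pn f 0) ?(pn g 1) ?(pn h 2) // => /(_ isT ltr01)[t _].
rewrite !hornerM !mulf_eq0 !negb_or => /andP[/andP[h1 h2] h3].
by exists (a + t *: b + (t ^+ 2) *: c); split; rewrite polE.
Qed.

Definition TL P Q := trivial_link (poly4 P `|` poly4 Q).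

Lemma TL_sym P Q : TL P Q -> TL Q P.
Proof. by rewrite /TL setUC. Qed.

Definition scaled (p : E3) P (e : R) : 'I_4 -> E3 := fun i => p + e *: P i.

Lemma edge_pt_scaled p P e u v s :
  edge_pt (scaled p P e) u v s = p + e *: edge_pt P u v s.
Proof. by rewrite /edge_pt /scaled; vring. Qed.

Lemma poly4_scaled p P e x : poly4 (scaled p P e) x <-> exists2 y, poly4 P y & x = p + e *: y.
Proof.
split=> [/carrierP[u [v [s [uv s01 ->]]]]|[y /carrierP[u [v [s [uv s01 ->]]]] ->]].
  exists (edge_pt P u v s); first by apply/carrierP; exists u, v, s.
  exact: edge_pt_scaled.
by apply/carrierP; exists u, v, s; split=> //; rewrite edge_pt_scaled.
Qed.

Lemma emb_scaled p P e : e != 0 -> emb c4 P -> emb c4 (scaled p P e).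
Proof.
move=> e0 eP u v x y uv xy s t s01 t01; rewrite !edge_pt_scaled.
by move=> /addrI /(scalerI e0); exact: eP.
Qed.

Lemma poly4_bound P (M : R) x : (forall i, `|P i| <= M) -> poly4 P x -> `|x| <= M.
Proof.
move=> PM /carrierP[u [v [s [_ /andP[s0 s1] ->]]]].
apply: le_trans (ler_normD _ _) _; rewrite !normrZ (ger0_norm s0) ger0_norm ?subr_ge0 //.
have := ler_wpM2l s0 (PM v); have : (1 - s) * `|P u| <= (1 - s) * M by rewrite ler_wpM2l ?subr_ge0.
by lra.
Qed.

Lemma path_bounded (P : R -> 'I_4 -> E3) : (forall i, continuous (fun t => P t i)) ->
  exists2 M, 0 < M & forall t i, 0 <= t <= 1 -> `|P t i| <= M.
Proof.
move=> cP.
have /choice[M MP] : forall i, exists M, forall t, 0 <= t <= 1 -> `|P t i| <= M.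
  move=> i; have [|c _ cmax] := @EVT_max R (fun t => `|P t i|) 0 1 ler01.
    by apply: continuous_subspaceT => t; apply: cvg_norm; exact: cP.
  by exists `|P c i| => t t01; apply: cmax; rewrite in_itv.
exists (1 + \sum_i `|M i|) => [|t i t01].
  by rewrite ltr_pwDl // sumr_ge0.
apply: le_trans (MP i t t01) _; apply: le_trans (ler_norm _) _.
by rewrite (bigD1 i) //= addrCA lerDl addr_ge0 // sumr_ge0.
Qed.

Lemma bead_clearance (p : R -> E3) (Q : R -> 'I_4 -> E3) : continuous p ->
  (forall i, continuous (fun t => Q t i)) ->
  (forall t, 0 <= t <= 1 -> ~ poly4 (Q t) (p t)) ->
  exists2 d, 0 < d & forall t x, 0 <= t <= 1 -> poly4 (Q t) x -> d <= `|x - p t|.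
Proof.
move=> cp cQ pQ.
have /choice[d dP] : forall uv : 'I_4 * 'I_4, exists d, 0 < d /\ (c4 uv.1 uv.2 ->
   forall t s, 0 <= t <= 1 -> 0 <= s <= 1 -> d <= `|edge_pt (Q t) uv.1 uv.2 s - p t|).
  move=> [u v] /=; case uv : (c4 u v); last by exists 1; split.
  pose D : set (R * R) := `[0, 1]%classic `*` `[0, 1]%classic.
  have D0 : D !=set0 by exists (0, 0); split; rewrite /= in_itv /= lexx ler01.
  have cD : compact D by apply: compact_setX; exact: segment_compact.
  have [|[t s] sD cmin] := compact_EVT_min (f := fun st : R * R =>
     `|edge_pt (Q st.1) u v st.2 - p st.1|) D0 cD.
    apply: continuous_subspaceT => -[t s]; apply: cvg_norm.
    have c1 : {for (t, s), continuous (@fst R R)} by exact: cvg_fst.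
    have c2 : {for (t, s), continuous (@snd R R)} by exact: cvg_snd.
    have cQ1 i : {for (t, s), continuous (fun z : R * R => Q z.1 i)}.
      by apply: (cvg_comp fst (fun t => Q t i) c1); exact: cQ.
    apply: cvgB; last by apply: (cvg_comp fst p c1); exact: cp.
    apply: cvgD; apply: cvgZ => //; first by apply: cvgB => //; exact: cvg_cst.
    - exact: cQ1.
    - exact: cQ1.
  set m := `|_| in cmin.
  have [t01 s01] : 0 <= t <= 1 /\ 0 <= s <= 1.
    by move: sD; rewrite inE => -[] /=; rewrite !in_itv.
  exists m; split.
    rewrite normr_gt0 subr_eq0; apply/eqP => /= e; apply: (pQ t t01).
    by rewrite -e; apply/carrierP; exists u, v, s.
  by move=> _ t' s' t01' s01'; apply: (cmin (t', s')); rewrite inE; split; rewrite /= in_itv.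
exists (\big[Num.min/1]_q d q) => [|t x t01 /carrierP[u [v [s [uv s01 ->]]]]].
  by apply/bigmin_gtP; split=> // q _; case: (dP q).
have := (dP (u, v)).2 uv t s t01 s01; apply: le_trans.
by rewrite (bigminD1 (u, v)) // ge_min lexx.
Qed.

Lemma continuous_lin (a b : E3) : continuous (fun t : R => a + t *: b).
Proof. by move=> t; apply: cvgD; [exact: cvg_cst|apply: cvgZr_tmp; exact: cvg_id]. Qed.

Lemma continuous_scaled (p : R -> E3) (P : R -> 'I_4 -> E3) (e : R -> R) :
  continuous p -> (forall i, continuous (fun t => P t i)) -> continuous e ->
  forall i, continuous (fun t => scaled (p t) (P t) (e t) i).
Proof.
move=> cp cP ce i t; apply: cvgD; first exact: cp.
by apply: cvgZ; [exact: ce|exact: cP].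
Qed.

(* Beads: small copies of [P] centred at [p]. *)
Definition BT (p : E3) P Q := exists2 e0, 0 < e0 &
  forall e, 0 < e <= e0 -> TL (scaled p P e) Q.

Lemma BT_path (p : R -> E3) (P Q : R -> 'I_4 -> E3) : continuous p ->
  (forall i, continuous (fun t => P t i)) ->
  (forall i, continuous (fun t => Q t i)) ->
  (forall t, 0 <= t <= 1 -> emb c4 (P t)) ->
  (forall t, 0 <= t <= 1 -> emb c4 (Q t)) ->
  (forall t, 0 <= t <= 1 -> ~ poly4 (Q t) (p t)) ->
  BT (p 1) (P 1) (Q 1) -> BT (p 0) (P 0) (Q 0).
Proof.
move=> cp cP cQ eP eQ pQ [e0 e00 H].
have [d d0 dP] := bead_clearance cp cQ pQ.
have [M M0 MP] := path_bounded cP.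
(* [M] bounds all shapes [P t], so a bead of this scale stays within half the clearance [d] of its
   centre. *)
exists (Num.min e0 (d / (2 * M))) => [|e /andP[e1]].
  by rewrite lt_min e00 divr_gt0 ?mulr_gt0.
rewrite le_min => /andP[e2 e3].
apply: trivial_link_isotopic (H e _); last by rewrite e1.
apply: (poly4_path_isotopic (P := fun t => scaled (p t) (P t) e)) => //.
- by apply: continuous_scaled => // t; exact: cvg_cst.
- by move=> t t01; apply: emb_scaled; [rewrite gt_eqF|exact: eP].
move=> t _ t01 /poly4_scaled[x xP ->] /(dP _ _ t01).
rewrite addrAC subrr add0r normrZ gtr0_norm //.
have := @poly4_bound _ M x (fun i => MP t i t01) xP.
rewrite ler_pdivlMr ?mulr_gt0 // in e3.
by move=> h1 h2; nra.
Qed.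

(** If the contraction of [P] to [p] never meets [Q], then full size can be traded for the size of a
    bead. *)
Lemma BT_shrink p P Q : emb c4 P -> emb c4 Q ->
  (forall l x, 0 < l <= 1 -> poly4 P x -> ~ poly4 Q (p + l *: x)) ->
  BT p P Q -> TL (scaled p P 1) Q.
Proof.
move=> eP eQ H [e0 e00 HT].
pose e := Num.min e0 1.
have e1 : 0 < e by rewrite lt_min e00 ltr01.
have e2 : e <= 1 by rewrite ge_min lexx orbT.
have := HT e; rewrite e1 ge_min lexx => /(_ isT).
apply: trivial_link_isotopic.
have := @poly4_path_isotopic R (fun t => scaled p P (1 + t * (e - 1))) (fun=> Q).
rewrite mul0r addr0 mul1r subrKC; apply=> //.
- apply: continuous_scaled => //; try by move=> *; exact: cvg_cst.
  by move=> t; apply: cvgD; [exact: cvg_cst|apply: cvgMr_tmp; exact: cvg_id].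
- by move=> i t; exact: cvg_cst.
- by move=> t t01; apply: emb_scaled => //; rewrite gt_eqF //; nra.
- move=> t _ t01 /poly4_scaled[x xP ->]; apply: H => //.
  by apply/andP; split; nra.
Qed.

Definition BB p P q Q := exists2 e0, 0 < e0 &
  forall e, 0 < e <= e0 -> TL (scaled p P e) (scaled q Q e).

Lemma BB_sym p P q Q : BB p P q Q -> BB q Q p P.
Proof. by move=> [e0 e00 H]; exists e0 => // e he; apply/TL_sym/H. Qed.

Lemma BB_path (p q : R -> E3) (P Q : R -> 'I_4 -> E3) :
  continuous p -> continuous q ->
  (forall i, continuous (fun t => P t i)) ->
  (forall i, continuous (fun t => Q t i)) ->
  (forall t, 0 <= t <= 1 -> emb c4 (P t)) ->
  (forall t, 0 <= t <= 1 -> emb c4 (Q t)) ->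
  (forall t, 0 <= t <= 1 -> p t != q t) ->
  BB (p 1) (P 1) (q 1) (Q 1) -> BB (p 0) (P 0) (q 0) (Q 0).
Proof.
move=> cp cq cP cQ eP eQ pq [e0 e00 H].
have [|d d0 dP] := bead_clearance (p := p) (Q := fun t _ => q t) cp (fun=> cq).
  move=> t t01 /carrierP[u [v [s [_ _]]]]; rewrite /edge_pt -scalerDl subrK scale1r.
  by apply/eqP; exact: pq.
have {}dP t : 0 <= t <= 1 -> d <= `|q t - p t|.
  move=> t01; apply: dP => //; apply/carrierP; exists (inord 0), (inord 1), 0; split.
  - by rewrite /c4 !inordK.
  - by rewrite lexx ler01.
  - by rewrite /edge_pt -scalerDl subrK scale1r.
have [M M0 MP] := path_bounded cP.
have [N N0 NP] := path_bounded cQ.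
exists (Num.min e0 (d / (2 * (M + N)))) => [|e /andP[e1]].
  by rewrite lt_min e00 divr_gt0 ?mulr_gt0 ?addr_gt0.
rewrite le_min => /andP[e2 e3].
apply: trivial_link_isotopic (H e _); last by rewrite e1.
apply: (poly4_path_isotopic (P := fun t => scaled (p t) (P t) e)
  (Q := fun t => scaled (q t) (Q t) e)) => //.
- by apply: continuous_scaled => // t; exact: cvg_cst.
- by apply: continuous_scaled => // t; exact: cvg_cst.
- by move=> t t01; apply: emb_scaled; [rewrite gt_eqF|exact: eP].
- by move=> t t01; apply: emb_scaled; [rewrite gt_eqF|exact: eQ].
move=> t _ t01 /poly4_scaled[x xP ->] /poly4_scaled[y yQ e'].
have := dP t t01; have -> : q t - p t = e *: x - e *: y.
  by move/rowP: e' => e'; apply/rowP => i; have := e' i; rewrite !mxE; lra.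
have hx := @poly4_bound _ M x (fun i => MP t i t01) xP.
have hy := @poly4_bound _ N y (fun i => NP t i t01) yQ.
rewrite ler_pdivlMr ?mulr_gt0 ?addr_gt0 // in e3.
move=> h; have := le_trans h (ler_normB _ _); rewrite !normrZ gtr0_norm //.
by nra.
Qed.

(** The bead [P] stays at [p] while [Q] contracts to a bead at [q]; by hypothesis the contraction
    keeps away from [p]. *)
Lemma BT_BB p P q Q : emb c4 P -> emb c4 Q ->
  (forall l x, 0 <= l <= 1 -> poly4 Q x -> p <> q + l *: x) ->
  BB p P q Q -> BT p P (scaled q Q 1).
Proof.
move=> eP eQ H [e0 e00 HT].
have cid : continuous (fun t : R => t) by move=> t; exact: cvg_id.
have ccst (T : topologicalType) (x : T) : continuous (fun _ : R => x) by move=> t; exact: cvg_cst.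
have [||d d0 dP] := bead_clearance (p := fun=> p) (Q := fun t => scaled q Q t) (ccst _ _).
- by apply: (@continuous_scaled (fun=> q) (fun=> Q) id) => //; move=> *; exact: ccst.
- by move=> t t01 /poly4_scaled[x xQ]; exact: H.
have [M M0 MP] := path_bounded (P := fun=> P) (fun i => ccst _ _).
exists (Num.min 1 (Num.min e0 (d / (2 * M)))) => [|e /andP[e1]].
  by rewrite !lt_min ltr01 e00 divr_gt0 ?mulr_gt0.
rewrite !le_min => /and3P[e2 e3 e4].
have := HT e; rewrite e1 e3 => /(_ isT); apply: trivial_link_isotopic.
have := @poly4_path_isotopic R (fun=> scaled p P e) (fun t => scaled q Q (1 + t * (e - 1))).
rewrite mul0r addr0 mul1r subrKC; apply=> //.
- by move=> i; exact: ccst.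
- apply: continuous_scaled; [exact: ccst|by move=> i; exact: ccst|].
  by move=> t; apply: cvgD; [exact: cvg_cst|apply: cvgMr_tmp; exact: cvg_id].
- by move=> t t01; apply: emb_scaled => //; rewrite gt_eqF.
- by move=> t t01; apply: emb_scaled => //; rewrite gt_eqF //; nra.
move=> t _ t01 /poly4_scaled[x xP ->] h.
have h1 : 0 <= 1 + t * (e - 1) <= 1 by apply/andP; split; nra.
have := dP _ _ h1 h; rewrite addrAC subrr add0r normrZ gtr0_norm //.
have h01 : 0 <= (0 : R) <= 1 by rewrite lexx ler01.
have := @poly4_bound _ M x (fun i => MP 0 i h01) xP.
rewrite ler_pdivlMr ?mulr_gt0 // in e4.
by move=> h2 h3; nra.
Qed.

Lemma continuous_fixed (T : topologicalType) (x : T) : continuous (fun _ : R => x).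
Proof. by move=> t; exact: cvg_cst. Qed.

Lemma continuous_id1 : continuous (fun t : R => t).
Proof. by move=> t; exact: cvg_id. Qed.

(** The other bead is arbitrary, so that reductions can be chained and, through [BB_sym], applied to
    both components. *)
Definition reduces P P' := emb c4 P' -> forall p q Q, p != q -> emb c4 Q ->
  BB p P' q Q -> BB p P q Q.

Lemma reduces_path (P : R -> 'I_4 -> E3) : (forall i, continuous (fun t => P t i)) ->
  (forall t, 0 <= t <= 1 -> emb c4 (P t)) -> reduces (P 0) (P 1).
Proof.
move=> cP eP _ p q Q pq eQ.
apply: (@BB_path (fun=> p) (fun=> q) P (fun=> Q)) => // *; exact: continuous_fixed.
Qed.

Definition flat_kite (k u v : E3) (s : R) := kite k u v (- s *: v).

Definition cross (a b : E3) : E3 := vec3 (a 0 1 * b 0 2 - a 0 2 * b 0 1)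
  (a 0 2 * b 0 0 - a 0 0 * b 0 2) (a 0 0 * b 0 1 - a 0 1 * b 0 0).

Lemma emb_flat_kite k u v w s : det3 u v w != 0 -> 0 <= s -> emb c4 (flat_kite k u v s).
Proof. by move=> h s0; have := @emb_kite R k u v w s 0 h s0; rewrite scale0r addr0. Qed.

Lemma continuous_flat_kite (k u v : R -> E3) (s : R -> R) :
  continuous k -> continuous u -> continuous v -> continuous s ->
  forall i, continuous (fun t => flat_kite (k t) (u t) (v t) (s t) i).
Proof.
move=> ck cu cv cs [[|[|[|[|//]]]] i] t; rewrite /flat_kite /kite /gon /=.
- by apply: cvgD; [exact: ck|exact: cu].
- by apply: cvgD; [exact: ck|exact: cv].
- by apply: cvgB; [exact: ck|exact: cu].
- apply: cvgD; first exact: ck.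
  by apply: cvgZ; [apply: cvgN; exact: cs|exact: cv].
Qed.

Lemma det3_rot (a b c : E3) : det3 a b c = det3 b c a.
Proof. volring. Qed.

(** As [v'] is outside the plane of [u] and [v], the moving vector is never parallel to [u]; [v], or
    [v'] at time 0, completes the frame. *)
Lemma reduces_frame2 u v v' : det3 u v v' != 0 ->
  reduces (flat_kite 0 u v 1) (flat_kite 0 u v' 1).
Proof.
move=> h.
have := @reduces_path (fun t => flat_kite 0 u (v + t *: (v' - v)) 1).
rewrite scale0r addr0 scale1r subrKC; apply.
  apply: continuous_flat_kite; [exact: continuous_fixed|exact: continuous_fixed|exact: continuous_lin|exact: continuous_fixed].
move=> t t01; have [t0|t0] := eqVneq t 0.
  by apply: (@emb_flat_kite _ _ _ v') => //; rewrite t0 scale0r addr0.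
apply: (@emb_flat_kite _ _ _ v) => //.
have -> : det3 u (v + t *: (v' - v)) v = - t * det3 u v v' by volring.
by rewrite mulf_neq0 // oppr_eq0.
Qed.

Lemma reduces_frame1 u u' v : det3 u v u' != 0 ->
  reduces (flat_kite 0 u v 1) (flat_kite 0 u' v 1).
Proof.
move=> h.
have := @reduces_path (fun t => flat_kite 0 (u + t *: (u' - u)) v 1).
rewrite scale0r addr0 scale1r subrKC; apply.
  apply: continuous_flat_kite; [exact: continuous_fixed|exact: continuous_lin|exact: continuous_fixed|exact: continuous_fixed].
move=> t t01; have [t0|t0] := eqVneq t 0.
  by apply: (@emb_flat_kite _ _ _ u') => //; rewrite t0 scale0r addr0.
apply: (@emb_flat_kite _ _ _ u) => //.
have -> : det3 (u + t *: (u' - u)) v u = - t * det3 u v u' by volring.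
by rewrite mulf_neq0 // oppr_eq0.
Qed.

Lemma reduces_trans P1 P2 P3 : emb c4 P2 -> reduces P1 P2 -> reduces P2 P3 -> reduces P1 P3.
Proof.
by move=> e2 h12 h23 e3 p q Q pq eQ /(h23 e3 p q Q pq eQ); exact: h12.
Qed.

Lemma square_flat_kite (p : E3) : square p = flat_kite p (vec3 1 1 0) (vec3 (-1) 1 0) 1.
Proof. by rewrite /square /flat_kite; congr kite; vring. Qed.

Lemma emb_square (p : E3) : emb c4 (square p).
Proof.
rewrite square_flat_kite; apply: (@emb_flat_kite _ _ _ (vec3 0 0 1)) => //.
by apply: lt0r_neq0; rewrite /det3 !mxE /=; lra.
Qed.

(** Moving a frame straight to that of [square 0] could degenerate on the way. Its vectors are
    therefore changed one at a time, through generic [x] and [y], each new vector leaving the plane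
    of the current frame. *)
Lemma reduces_square k u v w : det3 u v w != 0 -> reduces (flat_kite k u v 0) (square 0).
Proof.
move=> uvw; pose e1 : E3 := vec3 1 1 0; pose e2 : E3 := vec3 (-1) 1 0.
have ed : det3 e2 e1 (vec3 0 0 1) != 0.
  by apply: ltr0_neq0; rewrite /det3 !mxE /=; lra.
apply: (@reduces_trans _ (flat_kite 0 u v 0)); first exact: emb_flat_kite uvw _.
  have := @reduces_path (fun t => flat_kite (k + t *: (0 - k)) u v 0).
  rewrite scale0r addr0 scale1r subrKC; apply.
    apply: continuous_flat_kite; [exact: continuous_lin|exact: continuous_fixed|exact: continuous_fixed|exact: continuous_fixed].
  by move=> t t01; exact: emb_flat_kite uvw _.
apply: (@reduces_trans _ (flat_kite 0 u v 1)); first exact: emb_flat_kite uvw _.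
  apply: (@reduces_path (fun t => flat_kite 0 u v t)).
    by apply: continuous_flat_kite; [exact: continuous_fixed|exact: continuous_fixed|exact: continuous_fixed|exact: continuous_id1].
  by move=> t /andP[t0 _]; exact: emb_flat_kite uvw _.
have [x [x1 x2 _]] := @avoid3 w (vec3 0 0 1) (vec3 0 0 1) (det3 u v) (det3 e2 e1) (det3 e2 e1)
  ltac:(by move=> *; volring) ltac:(by move=> *; volring) ltac:(by move=> *; volring) uvw ed ed.
have vx : det3 u x v != 0.
  have -> : det3 u x v = - det3 u v x by volring.
  by rewrite oppr_eq0.
have xe : det3 e1 x e2 != 0.
  suff -> : det3 e1 x e2 = det3 e2 e1 x by [].
  volring.
have xe' : det3 x e2 e1 != 0 by rewrite det3_rot.
have [y [y1 y2 y3]] := @avoid3 v e1 x (det3 u x) (fun y => det3 y x e2) (fun y => det3 y e2 e1)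
  ltac:(by move=> *; volring) ltac:(by move=> *; volring) ltac:(by move=> *; volring)
  vx xe xe'.
apply: (@reduces_trans _ (flat_kite 0 u x 1)); first exact: emb_flat_kite vx _.
  exact: reduces_frame2.
apply: (@reduces_trans _ (flat_kite 0 y x 1)); first exact: emb_flat_kite y2 _.
  exact: reduces_frame1.
apply: (@reduces_trans _ (flat_kite 0 y e2 1)); first exact: emb_flat_kite y3 _.
  exact: reduces_frame2.
rewrite square_flat_kite; exact: reduces_frame1.
Qed.

Lemma scaled01 P : scaled 0 P 1 = P.
Proof. by apply/funext => i; rewrite /scaled add0r scale1r. Qed.

Lemma BB_squares_far : BB 0 (square 0) (far R) (square 0).
Proof.
exists 1 => // e /andP[e0 e1].
have := trivial_squares R; apply: trivial_link_isotopic.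
have := @poly4_path_isotopic R (fun t => scaled 0 (square 0) (e + t * (1 - e)))
  (fun t => scaled (far R) (square 0) (e + t * (1 - e))).
rewrite mul0r addr0 mul1r subrKC scaled01.
have -> : scaled (far R) (square 0) 1 = square (far R).
  apply/funext => i; rewrite /scaled /square /kite /gon !add0r scale1r.
  by case: i => [[|[|[|[|//]]]] i].
have ce : continuous (fun t : R => e + t * (1 - e)).
  by move=> t; apply: cvgD; [exact: cvg_cst|apply: cvgMr_tmp; exact: cvg_id].
apply=> //.
- by apply: continuous_scaled => //; [exact: continuous_fixed|move=> i; exact: continuous_fixed].
- by apply: continuous_scaled => //; [exact: continuous_fixed|move=> i; exact: continuous_fixed].
- by move=> t t01; apply: emb_scaled; [rewrite gt_eqF //; nra|exact: emb_square].
- by move=> t t01; apply: emb_scaled; [rewrite gt_eqF //; nra|exact: emb_square].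
move=> t _ t01 /poly4_scaled[x /onsq_square[x2 hx] ->].
move=> /poly4_scaled[y /onsq_square[y2 hy]] /(congr1 (fun z : E3 => z 0 0)).
have h1 : e + t * (1 - e) <= 1 by nra.
have h0 : 0 < e + t * (1 - e) by nra.
have B (X Y : R) : onsq X Y -> -1 <= X <= 1.
  by rewrite -ler_norml; case=> [[-> _]|[_ ->]].
have := B _ _ hx; have := B _ _ hy; rewrite !mxE /= !subr0 => a b.
by nra.
Qed.

(** With one bead at 0, the other moves straight to [far] unless it would pass through 0; in that
    case it sits on the first axis and takes a detour by the second. *)
Lemma BB_squares p q : p != q -> BB p (square 0) q (square 0).
Proof.
move=> pq.
have path (p0 q0 p1 q1 : E3) : (forall t, 0 <= t <= 1 -> p0 + t *: (p1 - p0) != q0 + t *: (q1 - q0)) ->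
    BB p1 (square 0) q1 (square 0) -> BB p0 (square 0) q0 (square 0).
  move=> H; have := @BB_path (fun t => p0 + t *: (p1 - p0)) (fun t => q0 + t *: (q1 - q0))
    (fun=> square 0) (fun=> square 0); rewrite !scale0r !addr0 !scale1r !subrKC.
  apply=> //; try exact: continuous_lin; try (by move=> *; exact: continuous_fixed).
  - by move=> *; exact: emb_square.
  - by move=> *; exact: emb_square.
apply: (path _ _ 0 (q - p)) => [t t01|].
  rewrite sub0r -subr_eq0.
  have -> : p + t *: - p - (q + t *: (q - p - q)) = p - q by vring.
  by rewrite subr_eq0.
have : q - p != 0 by rewrite subr_eq0 eq_sym.
move: (q - p) => w w0.
have [h|h] := pselect (forall t, 0 <= t <= 1 -> w + t *: (far R - w) != 0).
  apply: (path _ _ 0 (far R)) => [t t01|]; last exact: BB_squares_far.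
  by rewrite subrr scaler0 addr0 eq_sym; exact: h.
have [t [t01 wt]] : exists t, 0 <= t <= 1 /\ w + t *: (far R - w) = 0.
  by apply: contrapT => H; apply: h => t t01; apply/eqP => e; apply: H; exists t.
have w1 : w 0 1 = 0 /\ w 0 2 = 0.
  have t1 : t != 1.
    apply: contra_neq w0 => t1; move: wt; rewrite t1 scale1r subrKC.
    by move/(congr1 (fun z : E3 => z 0 0)); rewrite !mxE /= => /eqP; rewrite pnatr_eq0.
  have t1' : 1 - t != 0 by rewrite subr_eq0 eq_sym.
  split; apply: (mulfI t1'); rewrite mulr0.
    by move/(congr1 (fun z : E3 => z 0 1)): wt; rewrite !mxE /= => <-; ring.
  by move/(congr1 (fun z : E3 => z 0 2)): wt; rewrite !mxE /= => <-; ring.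
have w00 : w 0 0 != 0.
  apply: contra w0 => /eqP w00; apply/eqP; apply: row3P; rewrite !mxE //; by case: w1.
apply: (path _ _ 0 (vec3 0 1 0)) => [s s01|].
  rewrite subrr scaler0 addr0; apply/eqP => e.
  have e0 := congr1 (fun z : E3 => z 0 0) e; have e1 := congr1 (fun z : E3 => z 0 1) e.
  move: e0 e1; rewrite !mxE /= w1.1 => e0 e1.
  have s0 : s = 0 by lra.
  by move/eqP: w00; apply; rewrite s0 mul0r addr0 in e0; rewrite -e0.
apply: (path _ _ 0 (far R)) => [s s01|]; last exact: BB_squares_far.
rewrite subrr scaler0 addr0; apply/eqP => e.
have e0 := congr1 (fun z : E3 => z 0 0) e; have e1 := congr1 (fun z : E3 => z 0 1) e.
by move: e0 e1; rewrite !mxE /=; lra.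
Qed.

Lemma BB_kites p q k u v w k' u' v' w' : p != q -> det3 u v w != 0 -> det3 u' v' w' != 0 ->
  BB p (flat_kite k u v 0) q (flat_kite k' u' v' 0).
Proof.
move=> pq h h'.
apply: (reduces_square k h (@emb_square _)) => //; first exact: emb_flat_kite h' _.
apply: BB_sym; apply: (reduces_square k' h' (@emb_square _)).
- by rewrite eq_sym.
- exact: emb_square.
- by apply: BB_squares; rewrite eq_sym.
Qed.

End beads.

(** * Links with vanishing signed piercing number *)

Section triangles.
Variable R : realType.
Local Notation E3 := 'rV[R]_3.
Implicit Types (P Q : 'I_4 -> E3).

Definition hull3 (a b c x : E3) := exists r s t,
  [/\ 0 <= r, 0 <= s, 0 <= t, r + s + t = 1 & x = r *: a + s *: b + t *: c].

Definition on_edge (a b x : E3) := exists2 s, 0 <= s <= 1 & x = (1 - s) *: a + s *: b.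

Lemma on_edgeC a b x : on_edge a b x -> on_edge b a x.
Proof. by move=> [s s01 ->]; exists (1 - s); [lra|vring]. Qed.

Lemma poly4E a b c d x : poly4 (gon a b c d) x <->
  [\/ on_edge a b x, on_edge b c x, on_edge c d x | on_edge d a x].
Proof.
rewrite poly4P; split=> [[s s01 []] ->|[] [s s01 ->]].
- by apply: Or41; exists s.
- by apply: Or42; exists s.
- by apply: Or43; exists s.
- by apply: Or44; exists s.
- by exists s => //; apply: Or41.
- by exists s => //; apply: Or42.
- by exists s => //; apply: Or43.
- by exists s => //; apply: Or44.
Qed.

Lemma poly4_rot (a b c d : E3) : poly4 (gon a b c d) = poly4 (gon b c d a).
Proof.
by apply/seteqP; split=> x /poly4E h; apply/poly4E; case: h => h;
  [apply: Or44|apply: Or41|apply: Or42|apply: Or43|apply: Or42|apply: Or43|apply: Or44|apply: Or41].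
Qed.

Lemma poly4_rev (a b c d : E3) : poly4 (gon a b c d) = poly4 (gon a d c b).
Proof.
by apply/seteqP; split=> x /poly4E h; apply/poly4E; case: h => /on_edgeC h;
  [apply: Or44|apply: Or43|apply: Or42|apply: Or41|apply: Or44|apply: Or43|apply: Or42|apply: Or41].
Qed.

(* The triangle as a quadrilateral with a fourth vertex inside an edge. *)
Definition tri (a b c : E3) := gon a b c (2^-1 *: (a + c)).

Lemma poly4_tri a b c x : poly4 (tri a b c) x <->
  [\/ on_edge a b x, on_edge b c x | on_edge c a x].
Proof.
rewrite poly4E; split.
  case=> [?|?|[s s01 ->]|[s s01 ->]]; [exact: Or31|exact: Or32| |].
    by apply: Or33; exists (s / 2); [lra|apply: row3P; rewrite !mxE; field].
  by apply: Or33; exists ((1 + s) / 2); [lra|apply: row3P; rewrite !mxE; field].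
case=> [?|?|[s s01 ->]]; [exact: Or41|exact: Or42|].
have [h|h] := leP s (2^-1).
  by apply: Or43; exists (2 * s); [lra|apply: row3P; rewrite !mxE; field].
by apply: Or44; exists (2 * s - 1); [lra|apply: row3P; rewrite !mxE; field].
Qed.

Lemma hull3_rot a b c x : hull3 a b c x -> hull3 b c a x.
Proof.
by move=> [r [s [t [r0 s0 t0 e ->]]]]; exists s, t, r; split=> //; [lra|vring].
Qed.

Lemma on_edge_hull3 a b c x : on_edge a b x -> hull3 a b c x.
Proof. by move=> [s s01 ->]; exists (1 - s), s, 0; split; [lra|lra|lra|lra|vring]. Qed.

Lemma poly4_tri_hull a b c x : poly4 (tri a b c) x -> hull3 a b c x.
Proof.
rewrite poly4_tri; case=> h; first exact: on_edge_hull3.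
  by apply/hull3_rot/hull3_rot/on_edge_hull3.
by apply/hull3_rot/on_edge_hull3.
Qed.

Lemma hull3_star a b c p x l : hull3 a b c p -> hull3 a b c x -> 0 <= l <= 1 ->
  hull3 a b c (p + l *: (x - p)).
Proof.
move=> [r [s [t [r0 s0 t0 e ->]]]] [r' [s' [t' [r0' s0' t0' e' ->]]]] /andP[l0 l1].
exists (r + l * (r' - r)), (s + l * (s' - s)), (t + l * (t' - t)); split; [nra|nra|nra|nra|vring].
Qed.

Lemma hull3_vertex (a b c : E3) : hull3 a b c a.
Proof. by exists 1, 0, 0; split; [lra|lra|lra|lra|vring]. Qed.

Lemma tri_flat_kite a b c : tri a b c =
  flat_kite (2^-1 *: (a + c)) (a - 2^-1 *: (a + c)) (b - 2^-1 *: (a + c)) 0.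
Proof.
by rewrite /tri /flat_kite /kite; congr gon; apply: row3P; rewrite !mxE; field.
Qed.

Definition from (p : E3) P : 'I_4 -> E3 := fun i => P i - p.

Lemma scaled_from p P : scaled p (from p P) 1 = P.
Proof. by apply/funext => i; rewrite /scaled /from scale1r subrKC. Qed.

Lemma from_flat_kite p k u v s : from p (flat_kite k u v s) = flat_kite (k - p) u v s.
Proof.
apply/funext => -[[|[|[|[|//]]]] i]; rewrite /from /flat_kite /kite /gon /=; vring.
Qed.

Lemma poly4_from p P x : poly4 (from p P) x -> poly4 P (p + x).
Proof.
move=> h; rewrite -(scaled_from p P); apply/poly4_scaled; exists x => //.
by rewrite scale1r.
Qed.

Lemma emb_from p P : emb c4 P -> emb c4 (from p P).
Proof.
move=> h; have -> : from p P = scaled (- p) P 1.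
  by apply/funext => i; rewrite /scaled /from scale1r addrC.
by apply: emb_scaled => //; rewrite oner_eq0.
Qed.

Lemma mid_det (a b c w : E3) : vol a b c w != 0 ->
  det3 (a - 2^-1 *: (a + c)) (b - 2^-1 *: (a + c)) (w - 2^-1 *: (a + c)) != 0.
Proof.
apply: contra => /eqP h; apply/eqP.
have -> : vol a b c w = 2 * det3 (a - 2^-1 *: (a + c)) (b - 2^-1 *: (a + c)) (w - 2^-1 *: (a + c)).
  by rewrite /vol /det3 !mxE; field.
by rewrite h mulr0.
Qed.

Lemma emb_bend (a b c d : E3) t : vol a d c b != 0 ->
  emb c4 (gon a d c (b + t *: (2^-1 *: (a + c) - b))).
Proof.
move=> h; have := mid_det h; set m := 2^-1 *: (a + c) => hm.
have := @emb_kite R m _ _ _ 0 (1 - t) hm (lexx 0); rewrite /kite; congr (emb _ (gon _ _ _ _)).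
- by rewrite subrKC.
- by rewrite subrKC.
- by rewrite /m; apply: row3P; rewrite !mxE; field.
- by rewrite /m; apply: row3P; rewrite !mxE; field.
Qed.

Lemma emb_tri a b c w : vol a b c w != 0 -> emb c4 (tri a b c).
Proof.
move=> h; have := @emb_bend a w c b 1 h; rewrite scale1r subrKC; exact.
Qed.

Lemma TL_poly4 P Q P' Q' : poly4 P = poly4 P' -> poly4 Q = poly4 Q' -> TL P Q -> TL P' Q'.
Proof. by rewrite /TL => -> ->. Qed.

(** The triangle with its interior is star-shaped about [t0] and misses [Q]. *)
Lemma TL_shrink t0 t1 t2 w Q : vol t0 t1 t2 w != 0 -> emb c4 Q ->
  (forall x, hull3 t0 t1 t2 x -> ~ poly4 Q x) ->
  BT t0 (from t0 (tri t0 t1 t2)) Q -> TL (tri t0 t1 t2) Q.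
Proof.
move=> h eQ H hT; rewrite -(scaled_from t0 (tri t0 t1 t2)).
apply: BT_shrink => //; first exact/emb_from/emb_tri/h.
move=> l x /andP[l0 l1] /poly4_from /poly4_tri_hull hx; apply: H.
have := hull3_star (hull3_vertex _ _ _) hx; rewrite [t0 + x - t0]addrAC subrr add0r.
by apply; rewrite l1 ltW.
Qed.

(** Both triangles shrink to beads, at [t0] and at the midpoint of [a c]; beads at different points
    are unlinked by [BB_kites]. *)
Lemma BT_tri t0 t1 t2 w a b c w' : vol t0 t1 t2 w != 0 -> vol a b c w' != 0 ->
  ~ hull3 a b c t0 -> BT t0 (from t0 (tri t0 t1 t2)) (tri a b c).
Proof.
move=> h h' H; have k := mid_det h; have k' := mid_det h'.
set m := 2^-1 *: (a + c) in k'.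
have ma : hull3 a b c m.
  by exists (2^-1), 0, (2^-1); split; rewrite /m; [lra|lra|lra|lra|vring].
rewrite -(scaled_from m (tri a b c)); apply: BT_BB.
- exact/emb_from/emb_tri/h.
- exact/emb_from/emb_tri/h'.
- move=> l x l01 /poly4_from/poly4_tri_hull hx e; apply: H; rewrite e.
  by have := hull3_star ma hx l01; rewrite [m + x - m]addrAC subrr add0r.
rewrite !tri_flat_kite !from_flat_kite.
apply: BB_kites k k'; apply/eqP => e; apply: H; rewrite e; exact: ma.
Qed.

(** First the triangle shrinks to a bead at [t0]. Then [b] moves to the midpoint of [a c], sweeping
    only the triangle [a b c], and what remains is the triangle [a d c]. *)
Lemma TL_bend t0 t1 t2 w a b c d : vol t0 t1 t2 w != 0 -> vol a d c b != 0 ->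
  ~ hull3 a b c t0 -> ~ hull3 a d c t0 ->
  (forall x, hull3 t0 t1 t2 x -> ~ poly4 (gon a d c b) x) ->
  TL (tri t0 t1 t2) (gon a d c b).
Proof.
move=> h h' H1 H2 H3; apply: (TL_shrink h _ H3); first exact: emb_gon.
set m := 2^-1 *: (a + c).
have := @BT_path R (fun=> t0) (fun=> from t0 (tri t0 t1 t2))
   (fun t => gon a d c (b + t *: (m - b))).
rewrite scale0r addr0 scale1r subrKC; apply.
- exact: continuous_fixed.
- by move=> i; exact: continuous_fixed.
- case=> [[|[|[|[|//]]]] i]; rewrite /gon /=;
    [exact: continuous_fixed|exact: continuous_fixed|exact: continuous_fixed|exact: continuous_lin].
- by move=> t _; exact/emb_from/emb_tri/h.
- by move=> t _; exact: emb_bend.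
- move=> t t01 /poly4E[] hx.
  + by apply: H2; exact: on_edge_hull3.
  + by apply: H2; exact/hull3_rot/hull3_rot/on_edge_hull3.
  + move: hx => [s s01 e]; apply: H1; rewrite e /m.
    exists (s * t / 2), (s * (1 - t)), (1 - s + s * t / 2); split; [nra|nra|nra|lra|].
    by apply: row3P; rewrite !mxE; field.
  + move: hx => [s s01 e]; apply: H1; rewrite e /m.
    exists (s + (1 - s) * t / 2), ((1 - s) * (1 - t)), ((1 - s) * t / 2); split; [nra|nra|nra|lra|].
    by apply: row3P; rewrite !mxE; field.
- exact: BT_tri h h' H2.
Qed.

Section pierce.
Variables t0 t1 t2 : E3.
Definition side := vol t0 t1 t2.

(** Up to a common factor the three volumes are the barycentric coordinates of the point where the
    line [a b] meets the plane; by [vol_sum] they add up to [side b - side a], which has the sign of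
    [side b] when the ends are separated. *)
Definition pierce (a b : E3) := [&& side a * side b < 0,
  0 < vol a b t0 t1 * side b, 0 < vol a b t1 t2 * side b & 0 < vol a b t2 t0 * side b].

Definition transversal (a b : E3) := [&& side a != 0, side b != 0,
  vol a b t0 t1 != 0, vol a b t1 t2 != 0 & vol a b t2 t0 != 0].

Lemma side_edge a b s : side ((1 - s) *: a + s *: b) = (1 - s) * side a + s * side b.
Proof. rewrite /side; volring. Qed.

Lemma side_hull a b c r s t : r + s + t = 1 ->
  side (r *: a + s *: b + t *: c) = r * side a + s * side b + t * side c.
Proof. move=> e; have -> : r = 1 - s - t by lra. rewrite /side; volring. Qed.

Lemma side0 x : hull3 t0 t1 t2 x -> side x = 0.
Proof.
move=> [r [s [t [_ _ _ e ->]]]]; have -> : r = 1 - s - t by lra.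
rewrite /side; volring.
Qed.

Lemma vol_sum a b : vol a b t0 t1 + vol a b t1 t2 + vol a b t2 t0 = side b - side a.
Proof. rewrite /side; volring. Qed.

Lemma pierceC a b : pierce a b = pierce b a.
Proof.
suff H x y : pierce x y -> pierce y x by apply/idP/idP; exact: H.
move=> /and4P[h0 h1 h2 h3]; rewrite /pierce (mulrC (side y)) h0 /=.
have v i j : vol y x i j = - vol x y i j by volring.
rewrite !v !mulNr !oppr_gt0.
have [sy|sy|sy] := ltrgt0P (side y).
- rewrite !(pmulr_lgt0 _ sy) in h1 h2 h3; have sx : side x < 0 by nra.
  by rewrite !(nmulr_llt0 _ sx) h1 h2 h3.
- rewrite !(nmulr_lgt0 _ sy) in h1 h2 h3; have sx : 0 < side x by nra.
  by rewrite !(pmulr_llt0 _ sx) h1 h2 h3.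
- by rewrite sy mulr0 ltxx in h0.
Qed.

Lemma edge_hull_pierce a b x : transversal a b -> on_edge a b x ->
  hull3 t0 t1 t2 x -> pierce a b.
Proof.
move=> /and5P[sa sb v0 v1 v2] [s s01 ex] hx.
have z := side0 hx; move: hx => [r0 [r1 [r2 [h0 h1 h2 e er]]]].
(* Putting [x] in place of [b] scales the volume by [s]; expanding [x] in barycentric coordinates
   turns the same volume into a multiple of [side a]. *)
have e0 : s * vol a b t0 t1 = - r2 * side a.
  transitivity (vol a x t0 t1); first by rewrite ex; volring.
  by rewrite er; have -> : r0 = 1 - r1 - r2 by [lra]; rewrite /side; volring.
have e1 : s * vol a b t1 t2 = - r0 * side a.
  transitivity (vol a x t1 t2); first by rewrite ex; volring.
  by rewrite er; have -> : r0 = 1 - r1 - r2 by [lra]; rewrite /side; volring.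
have e2 : s * vol a b t2 t0 = - r1 * side a.
  transitivity (vol a x t2 t0); first by rewrite ex; volring.
  by rewrite er; have -> : r0 = 1 - r1 - r2 by [lra]; rewrite /side; volring.
rewrite ex side_edge in z.
have s0 : 0 < s.
  by rewrite lt_neqAle eq_sym; apply/andP; split; [apply: contra sa => /eqP s0; rewrite -z s0; apply/eqP; ring|lra].
have s1 : 0 < 1 - s.
  rewrite lt_neqAle eq_sym; apply/andP; split; last lra.
  apply: contra sb => /eqP s1; rewrite -z s1; apply/eqP; have -> : s = 1 by [lra]; ring.
have sab : side a * side b < 0.
  have : 0 < side b ^+ 2 by rewrite exprn_even_gt0.
  nra.
have key r v : s * v = - r * side a -> v != 0 -> 0 <= r -> 0 < v * side b.
  move=> e' v' r'; have : 0 < r.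
    rewrite lt_neqAle r' andbT eq_sym; apply: contra v' => /eqP r0'.
    by move/eqP: e'; rewrite r0' oppr0 mul0r mulf_eq0 gt_eqF.
  by move=> r''; rewrite -(pmulr_rgt0 _ s0) mulrA e'; nra.
apply/and4P; split=> //; [exact: key e0 v0 h2|exact: key e1 v1 h0|exact: key e2 v2 h1].
Qed.

Lemma boundary_edge_side a b x : on_edge a b x -> poly4 (tri t0 t1 t2) x ->
  transversal a b -> False.
Proof.
move=> [s s01 ex] hx /and5P[sa sb v0 v1 v2].
have z := side0 (poly4_tri_hull hx); rewrite ex side_edge in z.
have key (i j : E3) : on_edge i j x -> vol a b i j != 0 -> False.
  move=> [r r01 er] h.
  have /eqP : s * vol a b i j = 0.
    by transitivity (vol a x i j); [rewrite ex; volring|rewrite er; volring].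
  rewrite mulf_eq0 (negPf h) orbF => /eqP s0.
  by move/eqP: sa; apply; rewrite -z s0; ring.
by case/poly4_tri: hx => /key; [move/(_ v0)|move/(_ v1)|move/(_ v2)].
Qed.

(** For [x] in the triangle [a b c], [vol x b i j] is a nonnegative combination of [vol a b i j] and
    [vol c b i j], both of the sign of [side b]. On the side [i j] it vanishes, which forces
    [x = b], but [b] is off the plane. *)
Lemma pierced_corner a b c x : pierce a b -> pierce c b -> hull3 a b c x ->
  poly4 (tri t0 t1 t2) x -> False.
Proof.
move=> /and4P[h0 h1 h2 h3] /and4P[k0 k1 k2 k3] [r [s [t [r0 s0 t0' e ex]]]] hx.
have z := side0 (poly4_tri_hull hx).
have sb : side b != 0 by apply: contraTneq h0 => ->; rewrite mulr0 ltxx.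
have key (i j : E3) : on_edge i j x -> 0 < vol a b i j * side b -> 0 < vol c b i j * side b -> False.
  move=> [q q01 eq] p1 p2.
  have v0 : r * vol a b i j + t * vol c b i j = 0.
    transitivity (vol x b i j); last by rewrite eq; volring.
    by rewrite ex; have -> : s = 1 - r - t by [lra]; volring.
  have rt : r * (vol a b i j * side b) + t * (vol c b i j * side b) = 0.
    by rewrite !mulrA -mulrDl v0 mul0r.
  have re : r = 0 by nra.
  have te : t = 0 by nra.
  have se : s = 1 by lra.
  by move/eqP: sb; apply; rewrite -z ex re te se; congr side; vring.
by case/poly4_tri: hx => hx; [exact: (key t0 t1)|exact: (key t1 t2)|exact: (key t2 t0)].
Qed.

End pierce.

Lemma poly4_path1 (P : 'I_4 -> E3) (Q : R -> 'I_4 -> E3) Q0 Q1 :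
  Q 0 = Q0 -> Q 1 = Q1 -> (forall i, continuous (fun t => Q t i)) ->
  emb c4 P -> (forall t, 0 <= t <= 1 -> emb c4 (Q t)) ->
  (forall t x, 0 <= t <= 1 -> poly4 P x -> poly4 (Q t) x -> False) ->
  TL P Q1 -> TL P Q0.
Proof.
move=> <- <- cQ eP eQ H; apply: trivial_link_isotopic.
apply: (poly4_path_isotopic (P := fun=> P)) => // i; exact: continuous_fixed.
Qed.

Lemma continuous_gon (a b c d : R -> E3) :
  continuous a -> continuous b -> continuous c -> continuous d ->
  forall i, continuous (fun t => gon (a t) (b t) (c t) (d t) i).
Proof. by move=> ca cb cc cd [[|[|[|[|//]]]] i]. Qed.

Lemma sgn_pn (x y z : R) : 0 < x * y -> y * z < 0 -> x * z < 0.
Proof.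
move=> xy yz; have y0 : y != 0 by apply: contraTneq xy => ->; rewrite mulr0 ltxx.
have y2 : 0 < y ^+ 2 by rewrite exprn_even_gt0.
have e : (x * y) * (y * z) = x * z * y ^+ 2 by ring.
by rewrite -(pmulr_llt0 _ y2) -e pmulr_rlt0.
Qed.

Lemma convex_gt0 (s A B : R) : 0 <= s <= 1 -> 0 < A -> 0 < B -> 0 < (1 - s) * A + s * B.
Proof.
move=> s01 A0 B0; have [->|s0] := eqVneq s 0; first lra.
by nra.
Qed.

Lemma convex3_gt0 (r s t A B C : R) : 0 <= r -> 0 <= s -> 0 <= t -> r + s + t = 1 ->
  0 < A -> 0 < B -> 0 < C -> 0 < r * A + s * B + t * C.
Proof.
move=> r0 s0 t0' e A0 B0 C0.
have h1 : 0 <= r * A by rewrite mulr_ge0 // ltW.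
have h2 : 0 <= s * B by rewrite mulr_ge0 // ltW.
have h3 : 0 <= t * C by rewrite mulr_ge0 // ltW.
have [r1|r1] := ltrP 0 r; first by have := mulr_gt0 r1 A0; lra.
have [s1|s1] := ltrP 0 s; first by have := mulr_gt0 s1 B0; lra.
have t1 : 0 < t by lra.
by have := mulr_gt0 t1 C0; lra.
Qed.

Lemma vol_edge (s : R) (p q y i j : E3) :
  vol ((1 - s) *: p + s *: q) y i j = (1 - s) * vol p y i j + s * vol q y i j.
Proof. volring. Qed.

Lemma vol_on_edge0 (x y i j : E3) : on_edge i j x -> vol x y i j = 0.
Proof. move=> [s _ ->]; volring. Qed.

Lemma onem_mul_itv (s y : R) : 0 <= s <= 1 -> 0 <= y < 1 ->
  0 <= (1 - s) * (1 - y) <= 1 /\ 0 <= 1 - s * (1 - y) <= 1.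
Proof. by move=> s01 y01; split; apply/andP; split; nra. Qed.

Lemma slide_itv (k r t : R) : 0 < k -> k < r -> 0 <= t <= 1 ->
  0 <= t * ((1 + k) / (1 + r)) < 1.
Proof.
move=> k0 kr t01; have r1 : 0 < 1 + r by lra.
by rewrite mulrA ltr_pdivrMr // divr_ge0 ?(ltW r1) //=; nra.
Qed.

Section linking.
Variables t0 t1 t2 a b c d : E3.
Local Notation T := (tri t0 t1 t2).
Local Notation side := (side t0 t1 t2).
Local Notation pierce := (pierce t0 t1 t2).
Local Notation transversal := (transversal t0 t1 t2).

Definition generic7 := [&& transversal a b, transversal b c, transversal c d,
  transversal d a, vol a d c b != 0, vol a b c t0 != 0 & vol a c d t0 != 0].

Lemma hull3_vol (x y z w : E3) : vol x y z w != 0 -> ~ hull3 x y z w.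
Proof.
move=> /eqP h [r [s [t [_ _ _ e ew]]]]; apply: h; rewrite ew.
have -> : r = 1 - s - t by lra.
volring.
Qed.

Lemma hull3_swap (x y z w : E3) : hull3 x y z w -> hull3 x z y w.
Proof. by move=> [r [s [t [r0 s0 t0' e ->]]]]; exists r, t, s; split=> //; [lra|vring]. Qed.

Lemma same_side_edge x y p : side x * side y > 0 -> on_edge x y p -> side p != 0.
Proof.
move=> xy [s s01 ->]; rewrite side_edge.
have [hx|hx|hx] := ltrgt0P (side x); last by rewrite hx mul0r ltxx in xy.
- have hy : 0 < side y by nra.
  have [s0|s0] := eqVneq s 0; first by rewrite s0 subr0 mul1r mul0r addr0 gt_eqF.
  by rewrite gt_eqF //; nra.
- have hy : side y < 0 by nra.
  have [s0|s0] := eqVneq s 0; first by rewrite s0 subr0 mul1r mul0r addr0 lt_eqF.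
  by rewrite lt_eqF //; nra.
Qed.

Lemma TL_no_pierce : generic7 -> ~~ pierce a b -> ~~ pierce b c -> ~~ pierce c d ->
  ~~ pierce d a -> TL T (gon a d c b).
Proof.
move=> /and5P[tab tbc tcd tda /and3P[abcd ga gb]] p1 p2 p3 p4.
have sa : vol t0 t1 t2 a != 0 by case/and5P: tab.
apply: (TL_bend sa abcd).
- exact: hull3_vol.
- by move=> /hull3_swap; exact: hull3_vol.
move=> x hx /poly4E[] he.
- by move/negP: p4; apply; apply: edge_hull_pierce hx => //; exact: on_edgeC.
- by move/negP: p3; apply; apply: edge_hull_pierce hx => //; exact: on_edgeC.
- by move/negP: p2; apply; apply: edge_hull_pierce hx => //; exact: on_edgeC.
- by move/negP: p1; apply; apply: edge_hull_pierce hx => //; exact: on_edgeC.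
Qed.

Lemma pierce_side x y : pierce x y -> side x * side y < 0.
Proof. by case/and4P. Qed.

(** By [pierced_corner] the corner [b] can be pulled back to the midpoint of [a c] without touching
    the boundary of [T]. If the other two edges pierce as well, the remaining triangle [a d c]
    misses that boundary and shrinks; otherwise it misses the disk of [T], and [T] shrinks. *)
Lemma TL_corner : generic7 -> pierce a b -> pierce b c -> pierce c d = pierce d a ->
  TL T (gon a d c b).
Proof.
move=> /and5P[tab tbc tcd tda /and3P[abcd ga gb]] p1 p2 p34.
have sa : vol t0 t1 t2 a != 0 by case/and5P: tab.
have eT : emb c4 T by exact: emb_tri sa.
set m := 2^-1 *: (a + c).
have p2' : pierce c b by rewrite pierceC.
have ac : 0 < side a * side c.
  have := pierce_side p1; have := pierce_side p2.
  have : 0 < side b ^+ 2 by rewrite exprn_even_gt0 //; case/and5P: tab.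
  nra.
apply: (@poly4_path1 _ (fun t => gon a d c (b + t *: (m - b))) _ (tri a d c)).
- by rewrite scale0r addr0.
- by rewrite scale1r subrKC.
- by apply: continuous_gon;
    [exact: continuous_fixed|exact: continuous_fixed|exact: continuous_fixed|exact: continuous_lin].
- exact: eT.
- by move=> t _; exact: emb_bend.
- move=> t x t01 hx /poly4E[he|he|he|he].
  + exact: (boundary_edge_side (on_edgeC he) hx tda).
  + exact: (boundary_edge_side (on_edgeC he) hx tcd).
  + apply: (pierced_corner p1 p2' _ hx).
    move: he => [s s01 ->]; rewrite /m.
    exists (s * t / 2), (s * (1 - t)), (1 - s + s * t / 2); split; [nra|nra|nra|lra|].
    by apply: row3P; rewrite !mxE; field.
  + apply: (pierced_corner p1 p2' _ hx).
    move: he => [s s01 ->]; rewrite /m.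
    exists (s + (1 - s) * t / 2), ((1 - s) * (1 - t)), ((1 - s) * t / 2); split; [nra|nra|nra|lra|].
    by apply: row3P; rewrite !mxE; field.
case p4 : (pierce d a) p34 => p3.
  apply: TL_sym; apply: (TL_shrink abcd eT).
    move=> x hx; apply: (pierced_corner _ _ hx); first by rewrite pierceC.
    exact: p3.
  apply: (BT_tri abcd sa) => h; move: sa; have := side0 h; rewrite /side => ->.
  by rewrite eqxx.
apply: (TL_shrink sa (emb_tri abcd)).
  move=> x hx /poly4_tri[] he.
  - by move/negP: p4; apply; apply: edge_hull_pierce hx => //; exact: on_edgeC.
  - by move/negP: p3; apply; apply: edge_hull_pierce hx => //; exact: on_edgeC.
  - by move: (same_side_edge ac (on_edgeC he)); rewrite (side0 hx) eqxx.
apply: (BT_tri sa abcd) => /hull3_swap; exact: hull3_vol.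
Qed.

(* When [a], [d] lie on one side of the plane of the triangle and [b], [c] on
   the other, [b] and [c] slide along [ab] and [dc] and cross the plane at the
   same time, through the piercing points. *)
Lemma TL_parallel : generic7 -> pierce a b -> pierce c d -> 0 < side a * side d ->
  TL T (gon a d c b).
Proof.
move=> /and5P[tab tbc tcd tda /and3P[abcd ga gb]] p1 p3 ad.
have sa : vol t0 t1 t2 a != 0 by case/and5P: tab.
have eT : emb c4 T by exact: emb_tri sa.
have ab := pierce_side p1; have cd := pierce_side p3.
have side_b : side b != 0 by case/and5P: tab.
have side_d : side d != 0 by case/and5P: tda.
have side_c : side c != 0 by case/and5P: tcd.
have side_a : side a != 0 by [].
(* The distance of [a] from the plane relative to that of [b] on the other side, and likewise for
   [d] and [c]. *)
pose ra := - side a / side b; pose rd := - side d / side c.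
have neg (x y : R) : x * y < 0 -> 0 < - x / y.
  move=> xy; have y0 : y != 0 by apply: contraTneq xy => ->; rewrite mulr0 ltxx.
  have -> : - x / y = - (x * y) / y ^+ 2 by field.
  by rewrite divr_gt0 ?oppr_gt0 // exprn_even_gt0.
have ra0 : 0 < ra by exact: neg.
have rd0 : 0 < rd by apply: neg; rewrite mulrC.
(* [b] and [c] will stop beyond the plane at [k] times their initial distances, before reaching [a]
   and [d]. *)
pose k := Num.min ra rd / 2.
have k0 : 0 < k by rewrite divr_gt0 // lt_min ra0.
have ka : k < ra.
  by rewrite ltr_pdivrMr // (le_lt_trans (y := ra)) ?ge_min ?lexx //; lra.
have kd : k < rd.
  by rewrite ltr_pdivrMr // (le_lt_trans (y := rd)) ?ge_min ?lexx ?orbT //; lra.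
pose bt t := b + t *: (((1 + k) / (1 + ra)) *: (a - b)).
pose ct t := c + t *: (((1 + k) / (1 + rd)) *: (d - c)).
have ra1 : 1 + ra != 0 by rewrite gt_eqF // addr_gt0.
have rd1 : 1 + rd != 0 by rewrite gt_eqF // addr_gt0.
have ea : side a = - ra * side b by rewrite /ra; field.
have ed : side d = - rd * side c by rewrite /rd; field.
have sideb t : side (bt t) = (1 - t * (1 + k)) * side b.
  transitivity (side b + t * ((1 + k) / (1 + ra)) * (side a - side b)).
    by rewrite /bt /side; volring.
  by rewrite ea; field.
have sidec t : side (ct t) = (1 - t * (1 + k)) * side c.
  transitivity (side c + t * ((1 + k) / (1 + rd)) * (side d - side c)).
    by rewrite /ct /side; volring.
  by rewrite ed; field.
have tau (r t : R) : k < r -> 0 <= t <= 1 -> 0 <= t * ((1 + k) / (1 + r)) < 1.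
  exact: slide_itv.
have btE t : bt t = b + (t * ((1 + k) / (1 + ra))) *: (a - b) by rewrite /bt scalerA.
have ctE t : ct t = c + (t * ((1 + k) / (1 + rd))) *: (d - c) by rewrite /ct scalerA.
have volt t : 0 <= t <= 1 -> vol a d (ct t) (bt t) != 0.
  move=> t01; have := tau _ _ ka t01; have := tau _ _ kd t01.
  rewrite btE ctE; set x := t * _; set y := t * _ => hx hy.
  have -> : vol a d (c + x *: (d - c)) (b + y *: (a - b)) =
     (1 - x) * (1 - y) * vol a d c b by volring.
  by rewrite !mulf_neq0 // subr_eq0 gt_eqF //; [case/andP: hx|case/andP: hy].
have bc : 0 < side b * side c.
  have : 0 < (side a * side b) * (side c * side d) by rewrite nmulr_rgt0.
  have -> : (side a * side b) * (side c * side d) = (side a * side d) * (side b * side c) by ring.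
  by rewrite pmulr_rgt0.
apply: (@poly4_path1 _ (fun t => gon a d (ct t) (bt t)) _ (gon a d (ct 1) (bt 1))).
- by rewrite /ct /bt !scale0r !addr0.
- by [].
- apply: continuous_gon; first exact: continuous_fixed; first exact: continuous_fixed.
    exact: continuous_lin.
  exact: continuous_lin.
- exact: eT.
- by move=> t t01; apply: emb_gon; exact: volt.
- move=> t x t01 hx /poly4E[he|he|he|he].
  + exact: (boundary_edge_side (on_edgeC he) hx tda).
  + apply: (boundary_edge_side _ hx tcd); move: he => [s s01 ->]; rewrite ctE.
    have := tau _ _ kd t01; set y := t * _ => hy.
    by exists (1 - s * (1 - y)); [exact: (onem_mul_itv s01 hy).2|vring].
  (* The moving edge meets the plane only when both its ends lie in it, at time [1 / (1 + k)]. These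
     ends are then piercing points, so the edge lies in the interior of the triangle. *)
  + have sx := side0 (poly4_tri_hull hx); move: he => [s s01 ex].
    have tk : t * (1 + k) = 1.
      move: sx; rewrite ex side_edge sideb sidec.
      have -> : (1 - s) * ((1 - t * (1 + k)) * side c) + s * ((1 - t * (1 + k)) * side b) =
        (1 - t * (1 + k)) * ((1 - s) * side c + s * side b) by ring.
      rewrite -side_edge => /eqP; rewrite mulf_eq0 => /orP[|/eqP h].
        by rewrite subr_eq0 => /eqP.
      have cb : 0 < side c * side b by rewrite mulrC.
      have : on_edge c b ((1 - s) *: c + s *: b) by exists s.
      by move/(same_side_edge cb); rewrite h eqxx.
    have := tau _ _ ka t01; have := tau _ _ kd t01.
    set y := t * _ => hy; set z := t * _ => hz.
    have c0 : side (ct t) = 0 by rewrite sidec tk subrr mul0r.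
    have key (i j : E3) : on_edge i j x -> 0 < vol a b i j * side b ->
        0 < vol c d i j * side d ->
        vol (ct t) a i j * side d = vol (ct t) d i j * side a -> False.
      move=> eq h1 h2 h3.
      have h4 : vol (bt t) a i j = - (1 - z) * vol a b i j by rewrite btE -/z; volring.
      have h5 : vol (ct t) d i j = (1 - y) * vol c d i j by rewrite ctE -/y; volring.
      have h6 : (1 - s) * vol (ct t) a i j + s * vol (bt t) a i j = 0.
        by rewrite -vol_edge -ex; exact: vol_on_edge0.
      have A : 0 < vol (ct t) a i j * side a.
        have e : vol (ct t) a i j * side a * side d ^+ 2 = (1 - y) * (vol c d i j * side d) * side a ^+ 2.
          transitivity ((vol (ct t) a i j * side d) * (side a * side d)); first by ring.
          by rewrite h3 h5; ring.
        have sd2 : 0 < side d ^+ 2 by rewrite exprn_even_gt0.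
        have y1 : 0 < 1 - y by rewrite subr_gt0; case/andP: hy.
        rewrite -(pmulr_lgt0 _ sd2) e; apply: mulr_gt0; first exact: mulr_gt0.
        by rewrite exprn_even_gt0.
      have B : 0 < vol (bt t) a i j * side a.
        have e : vol (bt t) a i j * side a * side b ^+ 2 =
            (1 - z) * (vol a b i j * side b) * - (side a * side b) by rewrite h4; ring.
        have sb2 : 0 < side b ^+ 2 by rewrite exprn_even_gt0.
        have z1 : 0 < 1 - z by rewrite subr_gt0; case/andP: hz.
        rewrite -(pmulr_lgt0 _ sb2) e; apply: mulr_gt0; first exact: mulr_gt0.
        by rewrite oppr_gt0.
      have := convex_gt0 s01 A B.
      by rewrite !mulrA -mulrDl h6 mul0r ltxx.
    move/and4P: p1 => [_ q1 q2 q3]; move/and4P: p3 => [_ r1 r2 r3].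
    (* As [ct t] now lies in the plane, [vol_gp] loses a term and relates the volumes taken with [a]
       and with [d]. *)
    have gp i j k' : (forall w, vol i j k' w = side w) ->
        vol (ct t) a i j * side d = vol (ct t) d i j * side a.
      move=> sw; have := vol_gp i j k' (ct t) a d; rewrite !sw c0 mulr0 addr0.
      by move/eqP; rewrite subr_eq0 => /eqP.
    case/poly4_tri: hx => hx.
    * by apply: (key t0 t1) => //; exact: (gp t0 t1 t2).
    * by apply: (key t1 t2) => //; apply: (gp t1 t2 t0) => w; rewrite /side; volring.
    * by apply: (key t2 t0) => //; apply: (gp t2 t0 t1) => w; rewrite /side; volring.
  + apply: (boundary_edge_side _ hx tab); move: he => [s s01 ->]; rewrite btE.
    have := tau _ _ ka t01; set y := t * _ => hy.
    by exists ((1 - s) * (1 - y)); [exact: (onem_mul_itv s01 hy).1|vring].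
have h01 : 0 <= (1 : R) <= 1 by rewrite ler01 lexx.
have ab1 : 0 < side a * side (bt 1).
  rewrite sideb mul1r (_ : _ * _ = k * - (side a * side b)); last by ring.
  by rewrite mulr_gt0 ?oppr_gt0.
have ac : side a * side c < 0 by apply: (sgn_pn ad); rewrite mulrC.
have ac1 : 0 < side a * side (ct 1).
  rewrite sidec mul1r (_ : _ * _ = k * - (side a * side c)); last by ring.
  by rewrite mulr_gt0 ?oppr_gt0.
have aa : 0 < side a * side a by rewrite -expr2 exprn_even_gt0.
have hull_side x y z p : 0 < side a * side x -> 0 < side a * side y ->
    0 < side a * side z -> hull3 x y z p -> 0 < side a * side p.
  move=> hx hy hz [r [s [t [r0 s0 t0' e ->]]]]; rewrite side_hull //.
  have -> : side a * (r * side x + s * side y + t * side z) =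
    r * (side a * side x) + s * (side a * side y) + t * (side a * side z) by ring.
  exact: convex3_gt0.
have t00 : side t0 = 0 by apply: side0; exact: hull3_vertex.
apply: (TL_bend sa (volt _ h01)).
- by move=> h; have := hull_side _ _ _ _ aa ab1 ac1 h; rewrite t00 mulr0 ltxx.
- by move=> h; have := hull_side _ _ _ _ aa ad ac1 h; rewrite t00 mulr0 ltxx.
have both p q : 0 < side a * p -> 0 < side a * q -> 0 < p * q.
  move=> hp hq; have e : (side a * p) * (side a * q) = (side a * side a) * (p * q) by ring.
  by rewrite -(pmulr_rgt0 _ aa) -e mulr_gt0.
move=> x /side0 hx.
have no p q : 0 < side a * side p -> 0 < side a * side q -> ~ on_edge p q x.
  by move=> hp hq /(same_side_edge (both _ _ hp hq)); rewrite hx eqxx.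
by case/poly4E; apply: no.
Qed.

End linking.

(** * A vanishing signed number implies triviality *)

Section criterion.
Variables t0 t1 t2 : E3.
Local Notation T := (tri t0 t1 t2).
Local Notation side := (side t0 t1 t2).
Local Notation pierce := (pierce t0 t1 t2).
Local Notation transversal := (transversal t0 t1 t2).

Definition crossing_sign (a b : E3) : int :=
  if pierce a b then (if 0 < side a then 1 else -1) else 0.

Definition link4 (a b c d : E3) : int :=
  crossing_sign a b + crossing_sign b c + crossing_sign c d + crossing_sign d a.

Definition generic_link a b c d := [&& transversal a b, transversal b c, transversal c d,
  transversal d a, vol a d c b != 0, vol a b c t0 != 0, vol b c d t0 != 0,
  vol c d a t0 != 0 & vol d a b t0 != 0].

Lemma generic_link_rot a b c d : generic_link a b c d -> generic_link b c d a.
Proof.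
rewrite /generic_link => /and5P[-> -> -> -> /and5P[h -> -> -> ->]] /=; rewrite !andbT.
have -> : vol b a d c = - vol a d c b by volring.
by rewrite oppr_eq0.
Qed.

Lemma generic_link7 a b c d : generic_link a b c d -> generic7 t0 t1 t2 a b c d.
Proof.
rewrite /generic_link /generic7 => /and5P[-> -> -> -> /and5P[-> -> _ h _]] /=.
have -> : vol a c d t0 = vol c d a t0 by volring.
by rewrite h.
Qed.

Lemma TL_rot P a b c d : TL P (gon b a d c) -> TL P (gon a d c b).
Proof. by rewrite /TL (poly4_rot b). Qed.

(** A piercing edge changes the side of the plane. Hence a vanishing sum leaves three kinds: no
    piercing; two consecutive ones, the other two edges behaving alike; two opposite ones in
    opposite directions. *)
Lemma signs_cases (p1 p2 p3 p4 A B C D : bool) :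
  (p1 -> A = ~~ B) -> (p2 -> B = ~~ C) -> (p3 -> C = ~~ D) -> (p4 -> D = ~~ A) ->
  (if p1 then if A then 1 else -1 else 0) + (if p2 then if B then 1 else -1 else 0)
  + (if p3 then if C then 1 else -1 else 0) + (if p4 then if D then 1 else -1 else 0)
    = 0 :> int ->
  [|| [&& ~~ p1, ~~ p2, ~~ p3 & ~~ p4], [&& p1, p2 & p3 == p4], [&& p2, p3 & p4 == p1]
    | [|| [&& p3, p4 & p1 == p2], [&& p4, p1 & p2 == p3], [&& p1, p3 & A == D]
        | [&& p2, p4 & B == A]]].
Proof.
by case: p1; case: p2; case: p3; case: p4; case: A; case: B; case: C; case: D => //= h1 h2 h3 h4;
  first [by have := h1 isT | by have := h2 isT | by have := h3 isT | by have := h4 isT].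
Qed.

Theorem TL_link4 a b c d : generic_link a b c d -> link4 a b c d = 0 ->
  TL T (gon a d c b).
Proof.
move=> g1; have g2 := generic_link_rot g1; have g3 := generic_link_rot g2.
have g4 := generic_link_rot g3.
have opp x y : transversal x y -> pierce x y -> (0 < side x) = ~~ (0 < side y).
  move=> _ /pierce_side h; case: (ltrgt0P (side x)) h => // hx.
  - by rewrite pmulr_rlt0 // -leNgt => /ltW ->.
  - by rewrite nmulr_rlt0 // => ->.
  - by rewrite hx mul0r ltxx.
have same x y : side x != 0 -> side y != 0 -> (0 < side x) = (0 < side y) -> 0 < side x * side y.
  case: (ltrgt0P (side x)) => hx // _; case: (ltrgt0P (side y)) => hy // _ _; nra.
have /and5P[tab tbc tcd tda _] := g1.
have sa : side a != 0 by case/and5P: tab.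
have sb : side b != 0 by case/and5P: tbc.
have sc : side c != 0 by case/and5P: tcd.
have sd : side d != 0 by case/and5P: tda.
move=> /(signs_cases (opp _ _ tab) (opp _ _ tbc) (opp _ _ tcd) (opp _ _ tda)).
case/or4P => [/and4P[]|/and3P[p1 p2 /eqP p34]|/and3P[p2 p3 /eqP p41]|].
- by apply: TL_no_pierce; exact: generic_link7.
- by apply: TL_corner => //; exact: generic_link7.
- by apply: TL_rot; apply: TL_corner => //; exact: generic_link7.
case/or4P => [/and3P[p3 p4 /eqP p12]|/and3P[p4 p1 /eqP p23]|/and3P[p1 p3 /eqP ad]|/and3P[p2 p4 /eqP ba]].
- by do 2!apply: TL_rot; apply: TL_corner => //; exact: generic_link7.
- by do 3!apply: TL_rot; apply: TL_corner => //; exact: generic_link7.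
- by apply: TL_parallel => //; [exact: generic_link7|exact: same].
- by apply: TL_rot; apply: TL_parallel => //; [exact: generic_link7|exact: same].
Qed.
End criterion.
End triangles.

(** * Degrees of labelled tori *)

(* Directions in space are labelled by the vertices of a tetrahedron; [om] detects its face
   [L0 L1 L2] with sign, so that [deg] is the degree of a simplicial map from a torus grid, each
   square being cut along the diagonal [a d], to the boundary of the tetrahedron. *)
Inductive label := L0 | L1 | L2 | L3.

Definition om (a b c : label) : int :=
  match a, b, c with
  | L0, L1, L2 | L1, L2, L0 | L2, L0, L1 => 1
  | L0, L2, L1 | L2, L1, L0 | L1, L0, L2 => -1
  | _, _, _ => 0
  end.

Definition sq (a b c d : label) : int := om a b d - om a c d.

(** The boundary of a tetrahedron, mapped so that one label is missed, has degree 0. *)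
Lemma om_tetra (m a b c d : label) : a <> m -> b <> m -> c <> m -> d <> m ->
  om b c d - om a c d + om a b d - om a b c = 0.
Proof. by case: m; case: a => //; case: b => //; case: c => //; case: d. Qed.

(* The signed faces of the six tetrahedra around the main diagonal of a cube. *)
Lemma sq_cube (m : label) (l : bool -> bool -> bool -> label) :
  (forall k i j, l k i j <> m) ->
  sq (l true false false) (l true true false) (l true false true) (l true true true)
  - sq (l false false false) (l false true false) (l false false true) (l false true true)
  = (sq (l false true false) (l true true false) (l false true true) (l true true true)
     - sq (l false false false) (l true false false) (l false false true) (l true false true))
  - (sq (l false false true) (l true false true) (l false true true) (l true true true)
     - sq (l false false false) (l true false false) (l false true false) (l true true false)).
Proof.
move=> lm; pose v := l.
have T a1 a2 a3 b1 b2 b3 := om_tetra (lm false false false) (lm a1 a2 a3) (lm b1 b2 b3) (lm true true true).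
have := T true false false true true false; have := T true false false true false true.
have := T false true false true true false; have := T false true false false true true.
have := T false false true true false true; have := T false false true false true true.
rewrite /sq; lia.
Qed.
Definition deg (n1 n2 : nat) (f : nat -> nat -> label) : int :=
  \sum_(i < n1) \sum_(j < n2) sq (f i j) (f i.+1 j) (f i j.+1) (f i.+1 j.+1).

Lemma sum_telescope (n : nat) (g : nat -> int) : \sum_(i < n) (g i.+1 - g i) = g n - g 0%N.
Proof. by rewrite -(big_mkord xpredT (fun i => g i.+1 - g i)) telescope_sumr. Qed.

(** Each cube between the two grids misses a label. So [sq_cube] turns the difference of the degrees
    into sums over lateral faces, which telescope and cancel by periodicity. *)
Lemma deg_step n1 n2 (f g : nat -> nat -> label) :
  (forall i j, (i < n1)%N -> (j < n2)%N -> exists m, forall a b : bool,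
     f (i + a)%N (j + b)%N <> m /\ g (i + a)%N (j + b)%N <> m) ->
  (forall j, f n1 j = f 0%N j /\ g n1 j = g 0%N j) ->
  (forall i, f i n2 = f i 0%N /\ g i n2 = g i 0%N) ->
  deg n1 n2 g = deg n1 n2 f.
Proof.
move=> H p1 p2.
pose A i j := sq (f i j) (g i j) (f i j.+1) (g i j.+1).
pose B i j := sq (f i j) (g i j) (f i.+1 j) (g i.+1 j).
apply/eqP; rewrite -subr_eq0 /deg -sumrB.
have -> : \sum_(i < n1) (\sum_(j < n2) sq (g i j) (g i.+1 j) (g i j.+1) (g i.+1 j.+1) -
    \sum_(j < n2) sq (f i j) (f i.+1 j) (f i j.+1) (f i.+1 j.+1)) =
   \sum_(i < n1) \sum_(j < n2) (A i.+1 j - A i j) - \sum_(i < n1) \sum_(j < n2) (B i j.+1 - B i j).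
  rewrite -sumrB; apply: eq_bigr => i _; rewrite -!sumrB; apply: eq_bigr => j _.
  have [m mP] := H i j (ltn_ord i) (ltn_ord j).
  have := @sq_cube m (fun k a b => (if k then g else f) (i + a)%N (j + b)%N) _.
  by rewrite /A /B !addn0 !addn1; apply=> -[] a b; case: (mP a b).
have -> : \sum_(i < n1) \sum_(j < n2) (A i.+1 j - A i j) = 0.
  rewrite exchange_big big1 //= => j _; rewrite (sum_telescope n1 (A ^~ j)).
  by rewrite /A !(p1 _).1 !(p1 _).2 subrr.
rewrite big1 ?subrr // => i _; rewrite (sum_telescope n2 (B i)).
by rewrite /B !(p2 _).1 !(p2 _).2 subrr.
Qed.

Definition turn (a b : label) : int :=
  match a, b with
  | L0, L1 | L1, L2 | L2, L0 => 1
  | L1, L0 | L2, L1 | L0, L2 => -1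
  | _, _ => 0
  end.

(** Without [L3] the labels form a circle of three steps and [turn] counts steps; hence the factor
    3. *)
Lemma om_turn a b c : a <> L3 -> b <> L3 -> c <> L3 ->
  3 * om a b c = turn a b + turn b c - turn a c.
Proof. by case: a => //; case: b => //; case: c. Qed.

Lemma om_L3 a b c : a = L3 \/ b = L3 \/ c = L3 -> om a b c = 0.
Proof. by case: a; case: b; case: c => //; intuition. Qed.

Definition winding (n : nat) (f : nat -> label) : int := \sum_(i < n) turn (f i) (f i.+1).

(** Every row is free of [L3] or entirely [L3]. Between two free rows the contribution is the
    difference of their windings and telescopes, so only the ends of the blocks of free rows
    count. *)
Lemma deg_rows n1 n2 (f : nat -> nat -> label) (bl : nat -> bool) (w : nat -> int) :
  (forall i j, bl j -> f i j <> L3) -> (forall i j, ~~ bl j -> f i j = L3) ->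
  (forall j, f n1 j = f 0%N j) -> (forall i, f i n2 = f i 0%N) -> bl n2 = bl 0%N ->
  (forall j, (j < n2)%N -> bl j && ~~ bl j.+1 -> winding n1 (f ^~ j) = w j) ->
  (forall j, (j < n2)%N -> ~~ bl j && bl j.+1 -> winding n1 (f ^~ j.+1) = w j) ->
  3 * deg n1 n2 f = \sum_(j < n2) w j * ((bl j.+1)%:Z - (bl j)%:Z).
Proof.
move=> b1 b0 p1 p2 pb w1 w2; pose W j := winding n1 (f ^~ j).
have strip j : 3 * \sum_(i < n1) sq (f i j) (f i.+1 j) (f i j.+1) (f i.+1 j.+1) =
    if bl j && bl j.+1 then W j - W j.+1 else 0.
  case: ifP => [/andP[bj bj1]|/negbT]; last first.
    rewrite negb_and => h; rewrite big1 ?mulr0 // => i _.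
    by case/orP: h => h; rewrite /sq !om_L3 ?subrr // ?(b0 _ _ h); intuition.
  pose V i := turn (f i j) (f i j.+1).
  have -> : W j - W j.+1 = \sum_(i < n1) (turn (f i j) (f i.+1 j) - turn (f i j.+1) (f i.+1 j.+1)
       + (V i.+1 - V i)).
    by rewrite big_split /= sum_telescope /V p1 p1 subrr addr0 sumrB.
  rewrite mulr_sumr; apply: eq_bigr => i _.
  rewrite /sq mulrBr !om_turn /V; try exact: b1.
  ring.
pose U j := (bl j)%:Z * W j.
have -> : 3 * deg n1 n2 f = \sum_(j < n2) (if bl j && bl j.+1 then W j - W j.+1 else 0 ).
  by rewrite /deg exchange_big mulr_sumr; apply: eq_bigr => j _; exact: strip.
have -> : \sum_(j < n2) (if bl j && bl j.+1 then W j - W j.+1 else 0) =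
   \sum_(j < n2) (w j * ((bl j.+1)%:Z - (bl j)%:Z) - (U j.+1 - U j)).
  apply: eq_bigr => j _; have := w1 j (ltn_ord j); have := w2 j (ltn_ord j).
  rewrite /U /W; case: (bl j); case: (bl j.+1) => //= h1 h2.
  - ring.
  - by rewrite (h2 isT); ring.
  - by rewrite (h1 isT); ring.
  - ring.
rewrite sumrB sum_telescope /U /W pb.
have -> : winding n1 (f^~ n2) = winding n1 (f^~ 0%N).
  by apply: eq_bigr => i _; rewrite !p2.
by rewrite subrr subr0.
Qed.

(** An angle function on the circle of labels cut open at [m]. *)
Definition level (m a : label) : int :=
  match m, a with L0, L2 | L1, L0 | L2, L1 => 1 | _, _ => 0 end.

Lemma turn_level (m a b : label) : m <> L3 -> a <> m -> b <> m -> a <> L3 -> b <> L3 ->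
  turn a b = level m b - level m a.
Proof. by case: m => //; case: a => //; case: b. Qed.

Lemma winding_level m n f : m <> L3 -> (forall i, (i <= n)%N -> f i <> m /\ f i <> L3) ->
  winding n f = level m (f n) - level m (f 0%N).
Proof.
move=> m3 H; rewrite /winding -(sum_telescope n (fun i => level m (f i))); apply: eq_bigr => i _.
by apply: turn_level => //; [case: (H i (ltnW (ltn_ord i)))|case: (H i.+1 (ltn_ord i))
  |case: (H i (ltnW (ltn_ord i)))|case: (H i.+1 (ltn_ord i))].
Qed.

Lemma winding_cat n m f : winding (n + m) f = winding n f + winding m (fun i => f (n + i)%N).
Proof.
rewrite /winding big_split_ord /=; congr (_ + _).
by apply: eq_bigr => i _; rewrite addnS.
Qed.

(** * Parametrizations of the polygons *)

Section loops.
Variable R : realType.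
Local Notation E3 := 'rV[R]_3.

Definition clamp (x : R) : R := Num.min (Num.max x 0) 1.

Lemma clamp_itv x : 0 <= clamp x <= 1.
Proof.
rewrite /clamp; apply/andP; split; first by rewrite le_min ler01 le_max lexx orbT.
by rewrite ge_min lexx orbT.
Qed.

Lemma clamp_id x : 0 <= x <= 1 -> clamp x = x.
Proof. by move=> /andP[x0 x1]; rewrite /clamp max_l // min_l. Qed.

Lemma clamp_le0 x : x <= 0 -> clamp x = 0.
Proof. by move=> x0; rewrite /clamp max_r // min_l. Qed.

Lemma clamp_ge1 x : 1 <= x -> clamp x = 1.
Proof. by move=> x1; rewrite /clamp max_l ?min_r // (le_trans ler01). Qed.

Lemma clamp_lip x y : `|clamp x - clamp y| <= 1 * `|x - y|.
Proof.
wlog xy : x y / x <= y.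
  move=> W; have [h|/ltW h] := leP x y; first exact: W.
  by rewrite distrC (distrC x); exact: W.
rewrite mul1r (distrC x) (distrC (clamp x)) (ger0_norm (x := y - x)) ?subr_ge0 //.
have [x0|x0] := leP x 0; have [y0|y0] := leP y 0; have [x1|x1] := leP x 1;
  have [y1|y1] := leP y 1; try lra;
  rewrite ?(clamp_le0 x0) ?(clamp_le0 y0) ?(clamp_ge1 (ltW x1)) ?(clamp_ge1 (ltW y1))
    ?(@clamp_id x) ?(@clamp_id y) ?(ltW x0) ?(ltW y0) //= ler_norml; lra.
Qed.

Lemma clamp_continuous : continuous clamp.
Proof. exact: (lipschitz_continuous ler01 clamp_lip). Qed.

(** Clamping the parameter of each edge gives a single formula for the loop, so that continuity
    needs no gluing. *)
Definition loop3 (a b c : E3) (t : R) : E3 :=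
  a + clamp t *: (b - a) + clamp (t - 1) *: (c - b) + clamp (t - 2) *: (a - c).

Definition loop4 (a b c d : E3) (t : R) : E3 :=
  a + clamp t *: (b - a) + clamp (t - 1) *: (c - b) + clamp (t - 2) *: (d - c)
  + clamp (t - 3) *: (a - d).

Lemma clamp_shift_continuous (k : R) (v : E3) : continuous (fun t => clamp (t - k) *: v).
Proof.
move=> t; apply: cvgZr_tmp.
apply: (cvg_comp (fun t => t - k) clamp); last exact: clamp_continuous.
by apply: cvgB; [exact: cvg_id|exact: cvg_cst].
Qed.

Lemma loop3_continuous a b c : continuous (loop3 a b c).
Proof.
move=> t; apply: cvgD; last exact: clamp_shift_continuous.
apply: cvgD; last exact: clamp_shift_continuous.
apply: cvgD; first exact: cvg_cst.
by apply: cvgZr_tmp; exact: clamp_continuous.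
Qed.

Lemma loop4_continuous a b c d : continuous (loop4 a b c d).
Proof.
move=> t; apply: cvgD; last exact: clamp_shift_continuous.
apply: cvgD; last exact: clamp_shift_continuous.
apply: cvgD; last exact: clamp_shift_continuous.
apply: cvgD; first exact: cvg_cst.
by apply: cvgZr_tmp; exact: clamp_continuous.
Qed.

Lemma loop3E a b c r : 0 <= r <= 1 ->
  [/\ loop3 a b c r = (1 - r) *: a + r *: b, loop3 a b c (1 + r) = (1 - r) *: b + r *: c
    & loop3 a b c (2 + r) = (1 - r) *: c + r *: a].
Proof.
move=> r01; rewrite /loop3; split.
- rewrite (clamp_id r01) !clamp_le0; [|lra|lra]; vring.
- rewrite (@clamp_ge1 (1 + r)); last lra.
  have -> : 1 + r - 1 = r by ring.
  rewrite (clamp_id r01) clamp_le0; [vring|lra].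
- rewrite (@clamp_ge1 (2 + r)); last lra.
  rewrite (@clamp_ge1 (2 + r - 1)); last lra.
  have -> : 2 + r - 2 = r by ring.
  rewrite (clamp_id r01); vring.
Qed.

Lemma loop4E a b c d r : 0 <= r <= 1 ->
  [/\ loop4 a b c d r = (1 - r) *: a + r *: b, loop4 a b c d (1 + r) = (1 - r) *: b + r *: c,
      loop4 a b c d (2 + r) = (1 - r) *: c + r *: d
    & loop4 a b c d (3 + r) = (1 - r) *: d + r *: a].
Proof.
move=> r01; rewrite /loop4; split.
- rewrite (clamp_id r01) !clamp_le0; [|lra|lra|lra]; vring.
- rewrite (@clamp_ge1 (1 + r)); last lra.
  have -> : 1 + r - 1 = r by ring.
  rewrite (clamp_id r01) !clamp_le0; [|lra|lra]; vring.
- rewrite (@clamp_ge1 (2 + r)); last lra.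
  rewrite (@clamp_ge1 (2 + r - 1)); last lra.
  have -> : 2 + r - 2 = r by ring.
  rewrite (clamp_id r01) clamp_le0; [vring|lra].
- rewrite (@clamp_ge1 (3 + r)); last lra.
  rewrite (@clamp_ge1 (3 + r - 1)); last lra.
  rewrite (@clamp_ge1 (3 + r - 2)); last lra.
  have -> : 3 + r - 3 = r by ring.
  rewrite (clamp_id r01); vring.
Qed.

Lemma itv3 (t : R) : 0 <= t <= 3 -> exists2 r, 0 <= r <= 1 & [\/ t = r, t = 1 + r | t = 2 + r].
Proof.
move=> t3; have [h|h] := leP t 1; first by exists t; [lra|exact: Or31].
have [h2|h2] := leP t 2; first by exists (t - 1); [lra|apply: Or32; ring].
by exists (t - 2); [lra|apply: Or33; ring].
Qed.

Lemma itv4 (t : R) : 0 <= t <= 4 ->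
  exists2 r, 0 <= r <= 1 & [\/ t = r, t = 1 + r, t = 2 + r | t = 3 + r].
Proof.
move=> t3; have [h|h] := leP t 1; first by exists t; [lra|exact: Or41].
have [h2|h2] := leP t 2; first by exists (t - 1); [lra|apply: Or42; ring].
have [h3|h3] := leP t 3; first by exists (t - 2); [lra|apply: Or43; ring].
by exists (t - 3); [lra|apply: Or44; ring].
Qed.

Lemma loop3_tri a b c x : poly4 (tri a b c) x <-> exists2 t, 0 <= t <= 3 & x = loop3 a b c t.
Proof.
rewrite poly4_tri; split=> [[] [s s01 ->]|[t /itv3[r r01 tr] ->]].
- by exists s; [lra|case: (loop3E a b c s01)].
- by exists (1 + s); [lra|case: (loop3E a b c s01)].
- by exists (2 + s); [lra|case: (loop3E a b c s01)].
have [e1 e2 e3] := loop3E a b c r01.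
case: tr => ->; [apply: Or31|apply: Or32|apply: Or33]; rewrite ?e1 ?e2 ?e3; by exists r.
Qed.

Lemma loop4_gon a b c d x : poly4 (gon a b c d) x <-> exists2 t, 0 <= t <= 4 & x = loop4 a b c d t.
Proof.
rewrite poly4E; split=> [[] [s s01 ->]|[t /itv4[r r01 tr] ->]].
- by exists s; [lra|case: (loop4E a b c d s01)].
- by exists (1 + s); [lra|case: (loop4E a b c d s01)].
- by exists (2 + s); [lra|case: (loop4E a b c d s01)].
- by exists (3 + s); [lra|case: (loop4E a b c d s01)].
have [e1 e2 e3 e4] := loop4E a b c d r01.
case: tr => ->; [apply: Or41|apply: Or42|apply: Or43|apply: Or44];
  rewrite ?e1 ?e2 ?e3 ?e4; by exists r.
Qed.

End loops.

(** * Labels of directions *)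

Section labelling.
Variable R : realType.
Local Notation E3 := 'rV[R]_3.
Variables t0 t1 t2 : E3.
Hypothesis nondeg : cross (t1 - t0) (t2 - t0) != 0.

Local Notation n := (cross (t1 - t0) (t2 - t0)).

Definition height (x : E3) : R := det3 (t1 - t0) (t2 - t0) x.
Definition bary1 (x : E3) : R := det3 x (t2 - t0) n.
Definition bary2 (x : E3) : R := det3 (t1 - t0) x n.
Definition bary0 (x : E3) : R := - bary1 x - bary2 x.
Definition area2 : R := det3 (t1 - t0) (t2 - t0) n.

(* Below the plane of the triangle the label is [L3]; above it, the projection to the plane falls
   into one of three sectors bounded by directions of the sides. *)
Definition lab3 (d0 d1 d2 : R) : label :=
  if (0 < d0) && (d1 <= 0) then L0 else if (0 < d1) && (d2 <= 0) then L1 else L2.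

Definition lab (x : E3) : label :=
  if height x < 0 then L3 else lab3 (bary0 x) (bary1 x) (bary2 x).

Lemma lab3_ne3 d0 d1 d2 : lab3 d0 d1 d2 <> L3.
Proof. by rewrite /lab3; case: ifP => // _; case: ifP. Qed.

Lemma lab3_ne0 d0 d1 d2 : d0 <= 0 \/ 0 < d1 -> lab3 d0 d1 d2 <> L0.
Proof.
rewrite /lab3; case: ifP => [/andP[h1 h2]|_ _]; last by case: ifP.
by case=> h; [rewrite leNgt h1 in h|rewrite ltNge h2 in h].
Qed.

Lemma lab3_ne1 d0 d1 d2 : 0 < d2 -> lab3 d0 d1 d2 <> L1.
Proof. by move=> h; rewrite /lab3 [d2 <= 0]leNgt h andbF; case: ifP. Qed.

Lemma lab3_ne2 d0 d1 d2 : d0 + d1 + d2 = 0 -> 0 < d0 \/ d2 < 0 -> lab3 d0 d1 d2 <> L2.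
Proof.
move=> s h; rewrite /lab3; have [d1p|d1n] := leP d1 0.
  by rewrite (_ : 0 < d0) //; case: h => h; lra.
by rewrite andbF /= (_ : d2 <= 0) //; case: h => h; lra.
Qed.

Lemma area2_gt0 : 0 < area2.
Proof.
have e : area2 = n 0 0 ^+ 2 + n 0 1 ^+ 2 + n 0 2 ^+ 2.
  by rewrite /area2 /det3 /cross !mxE /=; ring.
rewrite e lt_neqAle eq_sym; apply/andP; split; last by rewrite !addr_ge0 ?sqr_ge0.
apply: contra nondeg; rewrite paddr_eq0 ?addr_ge0 ?sqr_ge0 // paddr_eq0 ?sqr_ge0 //.
rewrite !sqrf_eq0 => /andP[/andP[/eqP h0 /eqP h1] /eqP h2].
by apply/eqP; apply: row3P; rewrite ?h0 ?h1 ?h2 !mxE.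
Qed.

Lemma bary_cramer (x : E3) : area2 *: x =
  bary1 x *: (t1 - t0) + bary2 x *: (t2 - t0) + height x *: n.
Proof. by apply: row3P; rewrite /area2 /bary1 /bary2 /height /det3 /cross !mxE /=; ring. Qed.

Lemma bary_height0 x : height x = 0 -> bary1 x = 0 -> bary2 x = 0 -> x = 0.
Proof.
move=> h b1 b2; apply/eqP; have := bary_cramer x.
rewrite h b1 b2 !scale0r !addr0 => /eqP; rewrite scaler_eq0 gt_eqF //.
exact: area2_gt0.
Qed.

Lemma det3_continuous (u v : E3) : continuous (fun x => det3 u v x).
Proof.
pose c0 := u 0 1 * v 0 2 - u 0 2 * v 0 1; pose c1 := u 0 2 * v 0 0 - u 0 0 * v 0 2.
pose c2 := u 0 0 * v 0 1 - u 0 1 * v 0 0.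
apply: (@lipschitz_continuous _ _ _ _ (`|c0| + `|c1| + `|c2|)).
  by rewrite !addr_ge0.
move=> x y; have -> : det3 u v x - det3 u v y =
    c0 * (x - y) 0 0 + c1 * (x - y) 0 1 + c2 * (x - y) 0 2.
  by rewrite /det3 /c0 /c1 /c2 !mxE; ring.
have h c i : `|c * (x - y) 0 i| <= `|c| * `|x - y|.
  by rewrite normrM ler_wpM2l // coord_norm3.
have := h c0 0; have := h c1 1; have := h c2 2.
have := ler_normD (c0 * (x - y) 0 0 + c1 * (x - y) 0 1) (c2 * (x - y) 0 2).
have := ler_normD (c0 * (x - y) 0 0) (c1 * (x - y) 0 1).
lra.
Qed.

Lemma height_continuous : continuous height.
Proof. exact: det3_continuous. Qed.

Lemma bary1_continuous : continuous bary1.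
Proof.
have -> : bary1 = det3 (t2 - t0) n by apply/funext => x; rewrite /bary1 det3_rot.
exact: det3_continuous.
Qed.

Lemma bary2_continuous : continuous bary2.
Proof.
have -> : bary2 = det3 n (t1 - t0).
  by apply/funext => x; rewrite /bary2 det3_rot det3_rot.
exact: det3_continuous.
Qed.

Lemma bary0_continuous : continuous bary0.
Proof.
by move=> x; exact: (continuousB (continuousN (@bary1_continuous x)) (@bary2_continuous x)).
Qed.

Lemma near_gt0 (f : E3 -> R) x : continuous f -> 0 < f x -> \forall y \near x, 0 < f y.
Proof. by move=> cf fx; apply: (cvgr_gt (f x) (cf x)). Qed.

Lemma near_lt0 (f : E3 -> R) x : continuous f -> f x < 0 -> \forall y \near x, f y < 0.
Proof. by move=> cf fx; apply: (cvgr_lt (f x) (cf x)). Qed.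

(** Near each direction some label is absent. This is what makes the cubes of a fine grid satisfy
    the hypothesis of [deg_step]. *)
Lemma lab_robust x : x != 0 -> exists m, \forall y \near x, lab y <> m.
Proof.
move=> x0; have [h|h|h] := ltrgt0P (height x).
- exists L3; apply: filterS (near_gt0 height_continuous h) => y hy.
  by rewrite /lab ltNge (ltW hy) /=; exact: lab3_ne3.
- exists L0; apply: filterS (near_lt0 height_continuous h) => y hy.
  by rewrite /lab hy.
have [b|b] := ltrP 0 (bary1 x).
  exists L0; apply: filterS (near_gt0 bary1_continuous b) => y hy.
  by rewrite /lab; case: ifP => // _; apply: lab3_ne0; right.
have [b2|b2] := ltrP 0 (bary2 x).
  exists L1; apply: filterS (near_gt0 bary2_continuous b2) => y hy.
  by rewrite /lab; case: ifP => // _; exact: lab3_ne1.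
have b0 : 0 < bary0 x.
  rewrite lt_neqAle /bary0; apply/andP; split; last by lra.
  apply: contra x0 => /eqP e; apply/eqP; apply: bary_height0 => //; lra.
exists L2; apply: filterS (near_gt0 bary0_continuous b0) => y hy.
by rewrite /lab; case: ifP => // _; apply: lab3_ne2; [rewrite /bary0; ring|left].
Qed.

Lemma bary1D x y : bary1 (x - y) = bary1 x - bary1 y.
Proof. by rewrite /bary1 /det3 !mxE; ring. Qed.
Lemma bary2D x y : bary2 (x - y) = bary2 x - bary2 y.
Proof. by rewrite /bary2 /det3 !mxE; ring. Qed.
Lemma bary0D x y : bary0 (x - y) = bary0 x - bary0 y.
Proof. by rewrite /bary0 bary1D bary2D; ring. Qed.
Lemma heightD x y : height (x - y) = height x - height y.
Proof. by rewrite /height /det3 !mxE; ring. Qed.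

(* Barycentric coordinates of [q], scaled by [area2]. *)
Definition beta0 q := area2 + bary0 (q - t0).
Definition beta1 q := bary1 (q - t0).
Definition beta2 q := bary2 (q - t0).

Lemma beta_sum q : beta0 q + beta1 q + beta2 q = area2.
Proof. by rewrite /beta0 /beta1 /beta2 /bary0; ring. Qed.

Lemma beta_vertex : [/\ beta0 t0 = area2, beta1 t0 = 0 & beta2 t0 = 0] /\
  [/\ beta0 t1 = 0, beta1 t1 = area2 & beta2 t1 = 0] /\
  [/\ beta0 t2 = 0, beta1 t2 = 0 & beta2 t2 = area2].
Proof.
rewrite /beta0 /beta1 /beta2 /bary0 /bary1 /bary2 /area2; move: (n) => w.
by do ![split]; rewrite /det3 !mxE /=; ring.
Qed.

Lemma side_vertex : [/\ side t0 t1 t2 t0 = 0, side t0 t1 t2 t1 = 0 & side t0 t1 t2 t2 = 0].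
Proof. by rewrite /side; split; volring. Qed.

Lemma lab_sub x q : side t0 t1 t2 x = 0 -> side t0 t1 t2 q <= 0 ->
  lab (x - q) = lab3 (beta0 x - beta0 q) (beta1 x - beta1 q) (beta2 x - beta2 q).
Proof.
move=> hx hq; have -> : x - q = (x - t0) - (q - t0) by vring.
have hx' : height (x - t0) = 0 := hx; have hq' : height (q - t0) <= 0 := hq.
rewrite /lab heightD hx' sub0r oppr_lt0 ltNge hq' /=.
by rewrite bary0D bary1D bary2D /beta0 /beta1 /beta2; congr lab3; ring.
Qed.

Lemma beta_edge (r : R) a b : [/\ beta0 ((1 - r) *: a + r *: b) = (1 - r) * beta0 a + r * beta0 b,
   beta1 ((1 - r) *: a + r *: b) = (1 - r) * beta1 a + r * beta1 b
 & beta2 ((1 - r) *: a + r *: b) = (1 - r) * beta2 a + r * beta2 b].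
Proof.
rewrite /beta0 /beta1 /beta2 /bary0 /bary1 /bary2; move: (area2) (n) => A w.
by split; rewrite /det3 !mxE /=; ring.
Qed.

Definition rowlab (N : nat) (q : E3) (i : nat) : label :=
  lab (loop3 t0 t1 t2 (i%:R / N%:R) - q).

Section point.
Variable q : E3.
Hypothesis q_below : side t0 t1 t2 q <= 0.

Lemma lab_loop3 r : 0 <= r <= 1 -> exists2 s, 0 <= s <= area2 & [/\
  lab (loop3 t0 t1 t2 r - q) = lab3 (area2 - s - beta0 q) (s - beta1 q) (- beta2 q),
  lab (loop3 t0 t1 t2 (1 + r) - q) = lab3 (- beta0 q) (area2 - s - beta1 q) (s - beta2 q)
& lab (loop3 t0 t1 t2 (2 + r) - q) = lab3 (s - beta0 q) (- beta1 q) (area2 - s - beta2 q)] /\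
  s = r * area2.
Proof.
move=> r01; exists (r * area2); first by have := area2_gt0; nra.
have [e1 e2 e3] := loop3E t0 t1 t2 r01; rewrite e1 e2 e3 {e1 e2 e3}.
have [s0 s1 s2] := side_vertex.
have [[a0 a1 a2] [[b0 b1 b2] [c0 c1 c2]]] := beta_vertex.
have sz a b : side t0 t1 t2 a = 0 -> side t0 t1 t2 b = 0 ->
    side t0 t1 t2 ((1 - r) *: a + r *: b) = 0.
  by move=> ha hb; rewrite side_edge ha hb !mulr0 addr0.
split=> //; split; rewrite lab_sub ?sz //.
- by have [-> -> ->] := beta_edge r t0 t1; rewrite a0 a1 a2 b0 b1 b2; congr lab3; ring.
- by have [-> -> ->] := beta_edge r t1 t2; rewrite c0 c1 c2 b0 b1 b2; congr lab3; ring.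
- by have [-> -> ->] := beta_edge r t2 t0; rewrite c0 c1 c2 a0 a1 a2; congr lab3; ring.
Qed.

Lemma grid_itv (N i : nat) : (0 < N)%N -> (i <= N)%N -> 0 <= (i%:R / N%:R : R) <= 1.
Proof.
by move=> N0 iN; rewrite divr_ge0 //= ler_pdivrMr ?ltr0n // mul1r ler_nat.
Qed.

Lemma grid_shift (N i k : nat) : (0 < N)%N ->
  (k * N + i)%N%:R / N%:R = k%:R + i%:R / N%:R :> R.
Proof. by move=> N0; rewrite natrD natrM mulrDl mulfK // pnatr_eq0 -lt0n. Qed.

(** Seen from a point that projects into the triangle, each side misses one label; so the winding is
    determined by the corners, labelled [L0], [L1], [L2]. *)
Lemma winding_inside N : (0 < N)%N -> 0 < beta0 q -> 0 < beta1 q -> 0 < beta2 q ->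
  winding (N + (N + N)) (rowlab N q) = 3.
Proof.
move=> N0 b0 b1 b2; have A0 := area2_gt0; have bs := beta_sum q.
have r1 i : rowlab N q (N + i) = lab (loop3 t0 t1 t2 (1 + i%:R / N%:R) - q).
  by have := grid_shift i 1 N0; rewrite mul1n /rowlab => ->.
have r2 i : rowlab N q (N + (N + i)) = lab (loop3 t0 t1 t2 (2 + i%:R / N%:R) - q).
  by have := grid_shift i 2 N0; rewrite mul2n -addnn -addnA /rowlab => ->.
have g i (iN : (i <= N)%N) := lab_loop3 (grid_itv N0 iN).
rewrite !winding_cat (@winding_level L2) //; last first.
  move=> i iN; have [s s01 [[h _ _] _]] := g i iN; rewrite /rowlab h.
  by split; [apply: lab3_ne2; [lra|right; lra]|exact: lab3_ne3].
rewrite (@winding_level L0) //; last first.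
  move=> i iN; have [s s01 [[_ h _] _]] := g i iN; rewrite r1 h.
  by split; [apply: lab3_ne0; left; lra|exact: lab3_ne3].
have ne1 d0 d1 d2 : d1 <= 0 -> lab3 d0 d1 d2 <> L1.
  by move=> h; rewrite /lab3 h andbT; case: ifP => // _; rewrite ltNge h.
rewrite (@winding_level L1) //; last first.
  move=> i iN; have [s s01 [[_ _ h] _]] := g i iN; rewrite r2 h.
  by split; [apply: ne1; lra|exact: lab3_ne3].
have [s [_ [[z1 z2 z3] s0]]] := g 0%N (leq0n N).
have [s' [_ [[n1 n2 n3] s1]]] := g N (leqnn N).
rewrite mul0r mul0r in s0; rewrite divff ?mul1r ?pnatr_eq0 -?lt0n // in s1.
have v0 : lab3 (area2 - beta0 q) (- beta1 q) (- beta2 q) = L0.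
  by rewrite /lab3 ifT //; apply/andP; split; lra.
have v1 : lab3 (- beta0 q) (area2 - beta1 q) (- beta2 q) = L1.
  by rewrite /lab3 ifF ?ifT //; [apply/andP; split; lra|apply/negbTE; rewrite negb_and -leNgt; apply/orP; left; lra].
have v2 : lab3 (- beta0 q) (- beta1 q) (area2 - beta2 q) = L2.
  by rewrite /lab3 !ifF //; apply/negbTE; rewrite negb_and -leNgt; apply/orP; left; lra.
rewrite r1 r1 r2 r2 n2 n3 z2 z3 /rowlab n1 z1 s0 s1 subrr !subr0 !sub0r v0 v1 v2.
by [].
Qed.

(** A negative barycentric coordinate of [q] means that the whole triangle lies on one side of a
    line through its projection, and then one label never occurs. *)
Lemma winding_outside N : (0 < N)%N -> beta0 q < 0 \/ beta1 q < 0 \/ beta2 q < 0 ->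
  winding (N + (N + N)) (rowlab N q) = 0.
Proof.
move=> N0 H; have A0 := area2_gt0; have bs := beta_sum q.
have per : rowlab N q (N + (N + N)) = rowlab N q 0.
  have := grid_shift N 2 N0; rewrite mul2n -addnn -addnA /rowlab => ->.
  rewrite divff ?pnatr_eq0 -?lt0n // mul0r.
  have h0 : 0 <= (0 : R) <= 1 by rewrite lexx ler01.
  have h1 : 0 <= (1 : R) <= 1 by rewrite lexx ler01.
  have [-> _ _] := loop3E t0 t1 t2 h0; have [_ _ ->] := loop3E t0 t1 t2 h1.
  by rewrite subr0 subrr !scale0r !scale1r addr0 add0r.
have g i : (i <= N + (N + N))%N -> exists s d0 d1 d2, [/\ 0 <= s <= area2,
    rowlab N q i = lab3 (d0 - beta0 q) (d1 - beta1 q) (d2 - beta2 q), d0 + d1 + d2 = area2 &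
    [/\ 0 <= d0, 0 <= d1 & 0 <= d2]].
  move=> iN; have : 0 <= (i%:R / N%:R : R) <= 3.
    rewrite divr_ge0 //= ler_pdivrMr ?ltr0n // -natrM ler_nat; lia.
  case/itv3 => r r01 tr; have [s s01 [[e1 e2 e3] _]] := lab_loop3 r01; exists s.
  rewrite /rowlab; case: tr => ->.
  - by exists (area2 - s), s, 0; rewrite e1 sub0r; split=> //; [ring|split; lra].
  - by exists 0, (area2 - s), s; rewrite e2 sub0r; split=> //; [ring|split; lra].
  - by exists s, 0, (area2 - s); rewrite e3 sub0r; split=> //; [ring|split; lra].
suff [m [m3 mP]] : exists m, m <> L3 /\ forall i, (i <= N + (N + N))%N ->
    rowlab N q i <> m /\ rowlab N q i <> L3.
  by rewrite (winding_level m3 mP) per subrr.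
case: H => [b|[b|b]].
- exists L2; split=> // i /g[s [d0 [d1 [d2 [s01 -> e [h0 h1 h2]]]]]].
  by split; [apply: lab3_ne2; [lra|left; lra]|exact: lab3_ne3].
- exists L0; split=> // i /g[s [d0 [d1 [d2 [s01 -> e [h0 h1 h2]]]]]].
  by split; [apply: lab3_ne0; right; lra|exact: lab3_ne3].
- exists L1; split=> // i /g[s [d0 [d1 [d2 [s01 -> e [h0 h1 h2]]]]]].
  by split; [apply: lab3_ne1; lra|exact: lab3_ne3].
Qed.

End point.
End labelling.

(** * Homotopy invariance of the grid degree *)

Section degree.
Variable R : realType.
Local Notation E3 := 'rV[R]_3.
Variables t0 t1 t2 : E3.
Hypothesis nondeg : cross (t1 - t0) (t2 - t0) != 0.
Local Notation lab := (lab t0 t1 t2).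

Lemma near_lab (F : R * R * R -> E3) x : continuous F -> F x != 0 ->
  exists m, \forall y \near x, lab (F y) <> m.
Proof. by move=> cF /(lab_robust nondeg)[m mP]; exists m; exact: (cF x _ mP). Qed.

(** The number [N0] plays the part of a Lebesgue number for the cover of [K] by sets whose images
    avoid a label. *)
Lemma fine_grid (F : R * R * R -> E3) (K : set (R * R * R)) : continuous F -> compact K ->
  (forall x, K x -> F x != 0) ->
  exists N0, forall N, (N0 <= N)%N -> forall x, K x ->
    exists m, forall y, `|x - y| <= N%:R^-1 -> lab (F y) <> m.
Proof.
move=> cF /compact_near_coveringP cK F0.
have := cK nat \oo (fun N x => exists m, forall y, `|x - y| <= N%:R^-1 -> lab (F y) <> m) _.
case=> [x /F0 /(near_lab cF)[m /nbhs_ballP[r /= r0 rP]]|N0 _ N0P].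
  exists (ball x (r / 2), [set N : nat | 2 / r < N%:R]).
    split; first by apply: nbhsx_ballx; rewrite divr_gt0.
    have [M hM] : exists M : nat, 2 / r < M%:R.
      by exists (Num.bound (2 / r)); apply: archi_boundP; rewrite divr_ge0 // ltW.
    exists M => // N /= MN; apply: lt_le_trans hM _; by rewrite ler_nat.
  move=> [x' N] /= [bx hN]; exists m => y xy; apply: rP.
  have N0 : 0 < N%:R :> R by apply: lt_trans hN; rewrite divr_gt0.
  have hN' : N%:R^-1 < r / 2 by rewrite invf_plt ?posrE ?divr_gt0 // invf_div.
  move: bx; rewrite -!ball_normE /= => bx.
  have : `|x - y| <= `|x - x'| + `|x' - y| by exact: ler_distD.
  by lra.
by exists N0 => N hN; apply: N0P.
Qed.

Definition torus_deg (N : nat) (f : R -> R -> E3) : int :=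
  deg (N + (N + N)) (N + (N + (N + N))) (fun i j => lab (f (i%:R / N%:R) (j%:R / N%:R))).

Lemma torus_deg_homotopy (F : R -> R -> R -> E3) :
  continuous (fun z : R * R * R => F z.1.1 z.1.2 z.2) ->
  (forall k t s, 0 <= k <= 1 -> 0 <= t <= 3 -> 0 <= s <= 4 -> F k t s != 0) ->
  (forall k s, 0 <= k <= 1 -> F k 3 s = F k 0 s) ->
  (forall k t, 0 <= k <= 1 -> F k t 4 = F k t 0) ->
  exists N0, forall N, (0 < N)%N -> (N0 <= N)%N -> torus_deg N (F 0) = torus_deg N (F 1).
Proof.
move=> cF F0 p1 p2.
pose K : set (R * R * R) := (`[0, 1]%classic `*` `[0, 3]%classic) `*` `[0, 4]%classic.
have cK : compact K by do 2?apply: compact_setX; exact: segment_compact.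
have [|N0 N0P] := fine_grid cF cK.
  by move=> [[k t] s] [[/= kI tI] sI]; apply: F0; move: kI tI sI; rewrite !in_itv.
exists N0 => N Npos NN0.
have NR : 0 < N%:R :> R by rewrite ltr0n.
pose f k i j := lab (F (k%:R / N%:R) (i%:R / N%:R) (j%:R / N%:R)).
have grid (i M : nat) : (i <= M * N)%N -> 0 <= (i%:R / N%:R : R) <= M%:R.
  by move=> h; rewrite divr_ge0 //= ler_pdivrMr // -natrM ler_nat.
have n3 : (N + (N + N))%N%:R / N%:R = 3 :> R.
  by rewrite !natrD; field; rewrite gt_eqF.
have n4 : (N + (N + (N + N)))%N%:R / N%:R = 4 :> R.
  by rewrite !natrD; field; rewrite gt_eqF.
have z : 0%N%:R / N%:R = 0 :> R by rewrite mul0r.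
(* The homotopy is cut with the same mesh as the torus, so all corners of a cube are within [1 / N]
   of one of them in the sup norm. *)
have step k : (k < N)%N -> deg (N + (N + N)) (N + (N + (N + N))) (f k.+1) =
    deg (N + (N + N)) (N + (N + (N + N))) (f k).
  move=> kN.
  have kI (k' : nat) : (k' <= N)%N -> 0 <= (k'%:R / N%:R : R) <= 1.
    by move=> h; apply: (grid _ 1%N); rewrite mul1n.
  apply: deg_step => [i j iN jN|j|i].
  - have [|m mP] := N0P N NN0 (k%:R / N%:R, i%:R / N%:R, j%:R / N%:R).
      split; [split|]; rewrite /= in_itv /=; [apply: kI; exact: ltnW| |].
        by apply: (grid _ 3%N); lia.
      by apply: (grid _ 4%N); lia.
    have near1 (c : nat) (b : bool) : `|c%:R / N%:R - (c + b)%N%:R / N%:R| <= N%:R^-1 :> R.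
      rewrite natrD mulrDl opprD addrA subrr sub0r normrN ger0_norm ?divr_ge0 //.
      by rewrite ler_piMl ?invr_ge0 // lern1 leq_b1.
    have near3 (c a b : bool) : `|(k%:R / N%:R, i%:R / N%:R, j%:R / N%:R) -
        ((k + c)%N%:R / N%:R, (i + a)%N%:R / N%:R, (j + b)%N%:R / N%:R)| <= N%:R^-1 :> R.
      by rewrite !prod_normE /= !ge_max !near1.
    exists m => a b; split; apply: (mP (_, _, _)).
      by have := near3 false a b; rewrite addn0.
    by have := near3 true a b; rewrite addn1.
  - by rewrite /f n3 z !p1 // kI // ltnW.
  - by rewrite /f n4 z !p2 // kI // ltnW.
have : forall k, (k <= N)%N -> deg (N + (N + N)) (N + (N + (N + N))) (f k) =
    deg (N + (N + N)) (N + (N + (N + N))) (f 0%N).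
  by elim=> // k IH kN; rewrite step // IH // ltnW.
move=> /(_ N (leqnn N)) h; rewrite /torus_deg; symmetry.
have N1 : N%:R / N%:R = 1 :> R by rewrite divff // gt_eqF.
by move: h; rewrite /f N1 z.
Qed.

End degree.

(** * The degree of a triangle and a quadrilateral *)

Section evaluation.
Variable R : realType.
Local Notation E3 := 'rV[R]_3.

Lemma dominated (W E D : R) : W != 0 -> exists N0, forall N, (0 < N)%N -> (N0 <= N)%N ->
  forall s, `|s| <= D / N%:R -> 0 < W * (W + E * s).
Proof.
move=> W0; have w : 0 < `|W| by rewrite normr_gt0.
pose b := `|E| * `|D| / `|W|.
have b0 : 0 <= b by rewrite divr_ge0 ?mulr_ge0.
exists (Num.bound b) => N N0 hN s hs.
have bN : b < N%:R.
  by apply: lt_le_trans (archi_boundP b0) _; rewrite ler_nat.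
have h1 : `|E| * `|s| < `|W|.
  apply: (@le_lt_trans _ _ (`|E| * `|D| / N%:R)).
    rewrite -mulrA ler_wpM2l //; apply: le_trans hs _.
    by rewrite ler_pM2r ?invr_gt0 ?ltr0n // ler_norm.
  by rewrite ltr_pdivrMr ?ltr0n // [ltRHS]mulrC -ltr_pdivrMr.
have h2 : `|W * (E * s)| < W * W.
  have -> : W * W = `|W| * `|W| by rewrite -normrM ger0_norm // -expr2 sqr_ge0.
  by rewrite !normrM ltr_pM2l.
by move: h2; rewrite ltr_norml mulrDr => /andP[]; lra.
Qed.

Lemma same_sign (v D b Y : R) : 0 < D * Y -> 0 < v * (D * b) -> (0 < v * Y) = (0 < b).
Proof.
have [d|d|->] := ltgtP D 0; last by rewrite mul0r ltxx.
- rewrite nmulr_rgt0 // => y; rewrite mulrCA nmulr_rgt0 // => vb.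
  rewrite nmulr_lgt0 //; have [h|h|h] := ltgtP v 0; move: vb.
  + by rewrite nmulr_rlt0.
  + by rewrite pmulr_rlt0 // => /ltW /le_gtF ->.
  + by rewrite h mul0r ltxx.
- rewrite pmulr_rgt0 // => y; rewrite mulrCA pmulr_rgt0 // => vb.
  rewrite pmulr_lgt0 //; have [h|h|h] := ltgtP v 0; move: vb.
  + by rewrite nmulr_rgt0 // => /ltW /le_gtF ->.
  + by rewrite pmulr_rgt0.
  + by rewrite h mul0r ltxx.
Qed.

Variables t0 t1 t2 : E3.
Hypothesis nondeg : cross (t1 - t0) (t2 - t0) != 0.
Local Notation side := (side t0 t1 t2).
Local Notation beta0 := (beta0 t0 t1 t2).
Local Notation beta1 := (beta1 t0 t1 t2).
Local Notation beta2 := (beta2 t0 t1 t2).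
Local Notation area2 := (area2 t0 t1 t2).
Local Notation rowlab := (rowlab t0 t1 t2).

Lemma beta_vol x y : [/\ area2 * vol x y t1 t2 = beta0 x * side y - side x * beta0 y,
  area2 * vol x y t2 t0 = beta1 x * side y - side x * beta1 y
& area2 * vol x y t0 t1 = beta2 x * side y - side x * beta2 y].
Proof.
rewrite /beta0 /beta1 /beta2 /bary0 /bary1 /bary2 /area2.
have h1 : vol x y t0 t1 = det3 (t1 - t0) (x - t0) (y - t0) by volring.
have h2 : vol x y t2 t0 = - det3 (t2 - t0) (x - t0) (y - t0) by volring.
have h0 : vol x y t1 t2 = side y - side x - vol x y t0 t1 - vol x y t2 t0.
  by rewrite -vol_sum; ring.
have -> : side x = det3 (t1 - t0) (t2 - t0) (x - t0) by [].
have -> : side y = det3 (t1 - t0) (t2 - t0) (y - t0) by [].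
have e1 (u v X Y w : E3) : det3 u v w * det3 u X Y =
    det3 u X w * det3 u v Y - det3 u v X * det3 u Y w by rewrite /det3; ring.
have e2 (u v X Y w : E3) : det3 u v w * - det3 v X Y =
    det3 X v w * det3 u v Y - det3 u v X * det3 Y v w by rewrite /det3; ring.
rewrite h0 h1 h2.
have -> : side x = det3 (t1 - t0) (t2 - t0) (x - t0) by [].
have -> : side y = det3 (t1 - t0) (t2 - t0) (y - t0) by [].
by rewrite !mulrBr e1 !e2; split=> //; ring.
Qed.

Lemma edge_beta (b : E3 -> R) x y s : b ((1 - s) *: x + s *: y) = (1 - s) * b x + s * b y ->
  (side y - side x) * b ((1 - s) *: x + s *: y) =
  (b x * side y - side x * b y) + (b y - b x) * side ((1 - s) *: x + s *: y).
Proof. by move=> ->; rewrite side_edge; ring. Qed.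

Lemma small_side x y N s s' : side ((1 - s) *: x + s *: y) <= 0 ->
  0 < side ((1 - s') *: x + s' *: y) -> `|s - s'| <= N%:R^-1 ->
  `|side ((1 - s) *: x + s *: y)| <= `|side y - side x| / N%:R.
Proof.
move=> h1 h2 h3; apply: (@le_trans _ _ (`|side y - side x| * `|s - s'|)); last first.
  by rewrite ler_wpM2l.
rewrite -normrM !side_edge in h1 h2 *.
have -> : (side y - side x) * (s - s') =
  ((1 - s) * side x + s * side y) - ((1 - s') * side x + s' * side y) by ring.
by rewrite !ler0_norm ?subr_le0; lra.
Qed.

Lemma opposite (A B s s' : R) : A != 0 -> B != 0 -> 0 <= s <= 1 -> 0 <= s' <= 1 ->
  (1 - s) * A + s * B <= 0 -> 0 < (1 - s') * A + s' * B -> A * B < 0 /\ 0 < (B - A) * B.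
Proof.
move=> A0 B0 s01 s01' h1 h2; have [a|a|a] := ltgtP A 0; last by rewrite a eqxx in A0.
- by have [b|b|b] := ltgtP B 0; [nra|nra|rewrite b eqxx in B0].
- by have [b|b|b] := ltgtP B 0; [nra|nra|rewrite b eqxx in B0].
Qed.

(** Between neighbouring grid points the edge crosses the plane. There, by [edge_beta], a
    barycentric coordinate times [side y - side x] is a multiple of a volume from [pierce] plus a
    term of the order of the mesh, so for large [N] the volumes decide whether the point is
    inside. *)
Lemma edge_winding x y : transversal t0 t1 t2 x y ->
  exists N0, forall N, (0 < N)%N -> (N0 <= N)%N -> forall s s' : R,
    0 <= s <= 1 -> 0 <= s' <= 1 -> `|s - s'| <= N%:R^-1 ->
    side ((1 - s) *: x + s *: y) <= 0 -> 0 < side ((1 - s') *: x + s' *: y) ->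
    winding (N + (N + N)) (rowlab N ((1 - s) *: x + s *: y)) = 3 * (pierce t0 t1 t2 x y : nat)%:Z.
Proof.
move=> /and5P[sx sy v2 v0 v1]; have A0 := area2_gt0 nondeg.
have [e0 e1 e2] := beta_vol x y.
have nz v : v != 0 -> area2 * v != 0 by move=> ?; rewrite mulf_neq0 // gt_eqF.
have [N0 P0] := dominated (beta0 y - beta0 x) `|side y - side x| (nz _ v0).
have [N1 P1] := dominated (beta1 y - beta1 x) `|side y - side x| (nz _ v1).
have [N2 P2] := dominated (beta2 y - beta2 x) `|side y - side x| (nz _ v2).
exists (N0 + N1 + N2)%N => N Npos hN s s' s01 s01' ss h1 h2.
have hs := small_side h1 h2 ss.
have [h3 h4] : side x * side y < 0 /\ 0 < (side y - side x) * side y.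
  by move: (h1) (h2); rewrite !side_edge; exact: opposite.
have [b0 b1 b2] := beta_edge t0 t1 t2 s x y.
have {}P0 := P0 N Npos (leq_trans (leq_addr _ _) (leq_trans (leq_addr _ _) hN)) _ hs.
have {}P1 := P1 N Npos (leq_trans (leq_addl _ _) (leq_trans (leq_addr _ _) hN)) _ hs.
have {}P2 := P2 N Npos (leq_trans (leq_addl _ _) hN) _ hs.
rewrite e0 -(edge_beta b0) in P0; rewrite e1 -(edge_beta b1) in P1.
rewrite e2 -(edge_beta b2) in P2.
rewrite -e0 in P0; rewrite -e1 in P1; rewrite -e2 in P2.
have sgn (v b : R) : 0 < area2 * v * ((side y - side x) * b) -> (0 < v * side y) = (0 < b).
  by rewrite -mulrA pmulr_rgt0 //; exact: same_sign.
have pE : pierce t0 t1 t2 x y = [&& 0 < beta2 ((1 - s) *: x + s *: y),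
    0 < beta0 ((1 - s) *: x + s *: y) & 0 < beta1 ((1 - s) *: x + s *: y)].
  by rewrite /pierce h3 (sgn _ _ P0) (sgn _ _ P1) (sgn _ _ P2).
have ne (v b : R) : 0 < area2 * v * ((side y - side x) * b) -> ~~ (0 < b) -> b < 0.
  rewrite -leNgt le_eqVlt => h /orP[/eqP e|//].
  by rewrite e !mulr0 ltxx in h.
rewrite pE; case: (boolP (0 < beta2 _)) => [c2|/(ne _ _ P2) c2] /=; last first.
  by rewrite (winding_outside nondeg h1 Npos) //; right; right.
case: (boolP (0 < beta0 _)) => [c0|/(ne _ _ P0) c0] /=; last first.
  by rewrite (winding_outside nondeg h1 Npos) //; left.
case: (boolP (0 < beta1 _)) => [c1|/(ne _ _ P1) c1] /=; last first.
  by rewrite (winding_outside nondeg h1 Npos) //; right; left.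
by rewrite (winding_inside nondeg h1 Npos).
Qed.

Definition crossing_edge (x y : E3) : int :=
  (pierce t0 t1 t2 x y : nat)%:Z * (((side y <= 0)%R : nat)%:Z - ((side x <= 0)%R : nat)%:Z).

Lemma crossing_edgeE x y : crossing_edge x y = crossing_sign t0 t1 t2 x y.
Proof.
rewrite /crossing_edge /crossing_sign; case: ifP => [/pierce_side h|_]; last by rewrite mul0r.
have [x0|x0|x0] := ltgtP (side x) 0.
- by move: h; rewrite nmulr_rlt0 // leNgt => ->.
- by move: h; rewrite pmulr_rlt0 // => /ltW ->.
- by rewrite x0 mul0r ltxx in h.
Qed.

Lemma block_sum (n m : nat) (p : int) (w : nat -> int) (bl : nat -> bool) :
  (forall i, (i < n)%N -> w (m + i)%N = 3 * p) ->
  \sum_(i < n) w (m + i)%N * ((bl (m + i).+1)%:Z - (bl (m + i)%N)%:Z) =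
  3 * (p * ((bl (m + n)%N)%:Z - (bl m)%:Z)).
Proof.
move=> h; have := sum_telescope n (fun i => (bl (m + i)%N)%:Z); rewrite addn0 => <-.
rewrite mulrA mulr_sumr; apply: eq_bigr => i _; by rewrite h // addnS.
Qed.

(** Along one edge of the quadrilateral the winding at a change of side is always the same, so its
    block in the sum of [deg_rows] telescopes to [crossing_edge]. *)
Lemma torus_link4 a b c d : transversal t0 t1 t2 a b -> transversal t0 t1 t2 b c ->
  transversal t0 t1 t2 c d -> transversal t0 t1 t2 d a ->
  exists N0, forall N, (0 < N)%N -> (N0 <= N)%N ->
    torus_deg t0 t1 t2 N (fun t s => loop3 t0 t1 t2 t - loop4 a b c d s) = link4 t0 t1 t2 a b c d.
Proof.
move=> /edge_winding[N1 w1] /edge_winding[N2 w2] /edge_winding[N3 w3] /edge_winding[N4 w4].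
exists (N1 + N2 + N3 + N4)%N => N Npos hN.
have {}w1 := w1 N Npos _; have {}w2 := w2 N Npos _; have {}w3 := w3 N Npos _.
have {}w4 := w4 N Npos _.
have {}w4 := w4 (leq_trans (leq_addl _ _) hN).
have {}hN := leq_trans (leq_addr _ _) hN; have {}w3 := w3 (leq_trans (leq_addl _ _) hN).
have {}hN := leq_trans (leq_addr _ _) hN; have {}w2 := w2 (leq_trans (leq_addl _ _) hN).
have {}w1 := w1 (leq_trans (leq_addr _ _) hN).
pose q (j : nat) := loop4 a b c d (j%:R / N%:R).
pose bl j := side (q j) <= 0.
pose p j := if (j < N)%N then pierce t0 t1 t2 a b else if (j < N + N)%N then pierce t0 t1 t2 b c
  else if (j < N + N + N)%N then pierce t0 t1 t2 c d else pierce t0 t1 t2 d a.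
have g i : (i < N)%N -> [/\ 0 <= (i%:R / N%:R : R) <= 1, 0 <= (i.+1%:R / N%:R : R) <= 1
    & `|i%:R / N%:R - i.+1%:R / N%:R| <= N%:R^-1 :> R].
  move=> iN; split; [exact: grid_itv (ltnW iN)|exact: grid_itv|].
  rewrite -natr1 mulrDl opprD addrA subrr sub0r normrN mul1r ger0_norm //.
have q1 i : (i <= N)%N -> q i = (1 - i%:R / N%:R) *: a + (i%:R / N%:R) *: b.
  by move=> iN; have [] := loop4E a b c d (grid_itv R Npos iN).
have q2 i : (i <= N)%N -> q (N + i)%N = (1 - i%:R / N%:R) *: b + (i%:R / N%:R) *: c.
  move=> iN; have [_ <- _ _] := loop4E a b c d (grid_itv R Npos iN).
  by have := grid_shift R i 1 Npos; rewrite mul1n /q => ->.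
have q3 i : (i <= N)%N -> q (N + N + i)%N = (1 - i%:R / N%:R) *: c + (i%:R / N%:R) *: d.
  move=> iN; have [_ _ <- _] := loop4E a b c d (grid_itv R Npos iN).
  by have := grid_shift R i 2 Npos; rewrite mul2n -addnn /q => ->.
have q4 i : (i <= N)%N -> q (N + N + N + i)%N = (1 - i%:R / N%:R) *: d + (i%:R / N%:R) *: a.
  move=> iN; have [_ _ _ <-] := loop4E a b c d (grid_itv R Npos iN).
  have := grid_shift R i 3 Npos; rewrite (_ : 3 * N = N + N + N)%N /q => [->//|]; lia.
have p1 i : (i < N)%N -> p i = pierce t0 t1 t2 a b by move=> h; rewrite /p h.
have p2 i : (i < N)%N -> p (N + i)%N = pierce t0 t1 t2 b c.
  by move=> h; rewrite /p ltn_add2l h ltnNge leq_addr.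
have p3 i : (i < N)%N -> p (N + N + i)%N = pierce t0 t1 t2 c d.
  move=> h; rewrite /p ltn_add2l h (ltnNge _ (N + N)%N) leq_addr ltnNge.
  by rewrite -addnA leq_addr.
have p4 i : (i < N)%N -> p (N + N + N + i)%N = pierce t0 t1 t2 d a.
  move=> h; rewrite /p (ltnNge _ (N + N + N)%N) leq_addr (ltnNge _ (N + N)%N).
  by rewrite (ltnNge _ N) -!addnA !leq_addr /= addnA leq_addr.
have [z4 s4] : q (N + (N + (N + N)))%N = a /\ q 0%N = a.
  rewrite !addnA q4 // q1 // mul0r divff ?pnatr_eq0 -?lt0n //.
  by rewrite subr0 subrr !scale0r !scale1r add0r addr0.
have W j : (j < N + (N + (N + N)))%N -> exists x y i, [/\ (i < N)%N, p j = pierce t0 t1 t2 x y,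
    q j = (1 - i%:R / N%:R) *: x + (i%:R / N%:R) *: y,
    q j.+1 = (1 - i.+1%:R / N%:R) *: x + (i.+1%:R / N%:R) *: y &
    forall s s' : R, 0 <= s <= 1 -> 0 <= s' <= 1 -> `|s - s'| <= N%:R^-1 ->
      side ((1 - s) *: x + s *: y) <= 0 -> 0 < side ((1 - s') *: x + s' *: y) ->
      winding (N + (N + N)) (rowlab N ((1 - s) *: x + s *: y)) =
      3 * (pierce t0 t1 t2 x y : nat)%:Z].
  move=> jN; have [h1|h1] := ltnP j N.
    by exists a, b, j; split; rewrite ?p1 ?q1 //; exact: ltnW.
  have [h2|h2] := ltnP j (N + N).
    have [i e] : exists i, j = (N + i)%N by exists (j - N)%N; lia.
    have iN : (i < N)%N by lia.
    by rewrite e -addnS; exists b, c, i; split; rewrite ?p2 ?q2 //; exact: ltnW.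
  have [h3|h3] := ltnP j (N + N + N).
    have [i e] : exists i, j = (N + N + i)%N by exists (j - (N + N))%N; lia.
    have iN : (i < N)%N by lia.
    by rewrite e -addnS; exists c, d, i; split; rewrite ?p3 ?q3 //; exact: ltnW.
  have [i e] : exists i, j = (N + N + N + i)%N by exists (j - (N + N + N))%N; lia.
  have iN : (i < N)%N by lia.
  by rewrite e -addnS; exists d, a, i; split; rewrite ?p4 ?q4 //; exact: ltnW.
have hh (x : E3) : (lab t0 t1 t2 x = L3) <-> height t0 t1 t2 x < 0.
  by rewrite /lab; case: ifP => // _; split=> // /lab3_ne3.
have hq t j : height t0 t1 t2 (loop3 t0 t1 t2 t - q j) = - side (q j).
  have -> : loop3 t0 t1 t2 t - q j = (loop3 t0 t1 t2 t - t0) - (q j - t0) by vring.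
  have -> : - side (q j) = 0 - height t0 t1 t2 (q j - t0) by rewrite sub0r.
  rewrite heightD; congr (_ - _); rewrite /loop3 /height.
  move: (clamp t) (clamp (t - 1)) (clamp (t - 2)) => x y z.
  by rewrite /det3 !mxE; ring.
apply/eqP; rewrite -(inj_eq (mulfI (_ : (3 : int) != 0))) //; apply/eqP.
rewrite /torus_deg (@deg_rows _ _ _ bl (fun j => 3 * (p j : nat)%:Z)).
- rewrite big_split_ord big_split_ord big_split_ord /=.
  pose w j := 3 * (p j : nat)%:Z; pose D (j k : nat) := (bl k : nat)%:Z - (bl j : nat)%:Z.
  transitivity (3 * ((pierce t0 t1 t2 a b : nat)%:Z * D 0%N N)
    + (3 * ((pierce t0 t1 t2 b c : nat)%:Z * D N (N + N)%N)
    + (3 * ((pierce t0 t1 t2 c d : nat)%:Z * D (N + N)%N (N + N + N)%N)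
    + 3 * ((pierce t0 t1 t2 d a : nat)%:Z * D (N + N + N)%N (N + N + N + N)%N)))).
    congr (_ + (_ + (_ + _))).
    - by apply: (@block_sum N 0 _ w bl) => i iN; rewrite /w p1.
    - by apply: (@block_sum N N _ w bl) => i iN; rewrite /w p2.
    - rewrite -(@block_sum N (N + N) _ w bl) => [|i iN]; last by rewrite /w p3.
      by apply: eq_bigr => i _; rewrite addnA.
    - rewrite -(@block_sum N (N + N + N) _ w bl) => [|i iN]; last by rewrite /w p4.
      by apply: eq_bigr => i _; rewrite !addnA.
  rewrite /link4 -!crossing_edgeE /crossing_edge /D /bl -!addnA z4 s4.
  have e1 := q2 0%N (leq0n N); have e2 := q3 0%N (leq0n N); have e3 := q4 0%N (leq0n N).
  rewrite !addn0 mul0r subr0 scale0r scale1r addr0 -?addnA in e1 e2 e3.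
  by rewrite e1 e2 e3 !scale0r !scale1r !addr0; ring.
- move=> i j; rewrite /bl => h /hh; rewrite hq oppr_lt0 => h'.
  by move: h; rewrite leNgt h'.
- by move=> i j; rewrite /bl -ltNge => h; apply/hh; rewrite hq oppr_lt0.
- move=> j; have -> : (N + (N + N))%N%:R / N%:R = 3 :> R.
    by rewrite !natrD; field; rewrite pnatr_eq0 -lt0n.
  rewrite mul0r.
  have h0 : 0 <= (0 : R) <= 1 by rewrite lexx ler01.
  have h1 : 0 <= (1 : R) <= 1 by rewrite lexx ler01.
  have [-> _ _] := loop3E t0 t1 t2 h0; have [_ _] := loop3E t0 t1 t2 h1.
  rewrite (_ : 2 + 1 = 3) => [->|]; last by ring.
  by rewrite subr0 subrr !scale0r !scale1r addr0 add0r.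
- by move=> i; rewrite -/(q _) z4 -[loop4 _ _ _ _ _]/(q 0%N) s4.
- by rewrite /bl z4 s4.
- move=> j /W[x [y [i [/g[g1 g2 g3] -> ej ej1 w]]]] /andP[]; rewrite /bl -ltNge ej ej1 => h1 h2.
  have := w _ _ g1 g2 g3 h1 h2; rewrite /rowlab -ej; exact.
- move=> j /W[x [y [i [/g[g1 g2 g3] -> ej ej1 w]]]] /andP[]; rewrite /bl -ltNge ej ej1 => h1 h2.
  by rewrite distrC in g3; have := w _ _ g2 g1 g3 h2 h1; rewrite /rowlab -ej1; exact.
Qed.
End evaluation.

(** * Loops separated by a plane *)

Section separation.
Variable R : realType.
Local Notation E3 := 'rV[R]_3.

Lemma dotB (e x y : E3) : dot e (x - y) = dot e x - dot e y.
Proof. by rewrite !dotE !mxE; ring. Qed.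

Lemma dot_continuous (e : E3) : continuous (fun x => dot e x).
Proof.
apply: (@lipschitz_continuous _ _ _ _ (`|e 0 0| + `|e 0 1| + `|e 0 2|)).
  by rewrite !addr_ge0.
move=> x y; rewrite -dotB dotE.
have h c i : `|c * (x - y) 0 i| <= `|c| * `|x - y|.
  by rewrite normrM ler_wpM2l // coord_norm3.
have := h (e 0 0) 0; have := h (e 0 1) 1; have := h (e 0 2) 2.
have := ler_normD (e 0 0 * (x - y) 0 0 + e 0 1 * (x - y) 0 1) (e 0 2 * (x - y) 0 2).
have := ler_normD (e 0 0 * (x - y) 0 0) (e 0 1 * (x - y) 0 1).
lra.
Qed.

Lemma dot_ge0 (x : E3) : 0 <= dot x x.
Proof. by rewrite dotE !addr_ge0 // -expr2 sqr_ge0. Qed.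

Lemma dot_gt0 (x : E3) : x != 0 -> 0 < dot x x.
Proof.
move=> x0; rewrite lt_neqAle dot_ge0 andbT eq_sym; apply: contra x0.
rewrite dotE -!expr2 paddr_eq0 ?addr_ge0 ?sqr_ge0 // paddr_eq0 ?sqr_ge0 //.
rewrite !sqrf_eq0 => /andP[/andP[/eqP h0 /eqP h1] /eqP h2].
by apply/eqP; apply: row3P; rewrite ?h0 ?h1 ?h2 !mxE.
Qed.

Lemma cauchy_schwarz (x y : E3) : dot x y ^+ 2 <= dot x x * dot y y.
Proof.
rewrite -subr_ge0; have -> : dot x x * dot y y - dot x y ^+ 2 = dot (cross x y) (cross x y).
  by rewrite !dotE /cross !mxE /=; ring.
exact: dot_ge0.
Qed.

(** The centres are farther apart than [r1 + r2], so a plane orthogonal to the line of centres fits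
    between the circles. *)
Lemma planar_unlink_separated (U : set E3) : planar_unlink U ->
  exists C1 C2 : set E3, exists e th, [/\ U = C1 `|` C2, C1 !=set0 /\ C2 !=set0, e != 0,
    (forall x, C1 x -> dot e x < th) & (forall x, C2 x -> th < dot e x)].
Proof.
move=> [nu [c1 [c2 [r1 [r2 [nu0 ne [r10 r20] dis ->]]]]]].
pose e := c2 - c1; pose L := Num.sqrt (dot e e).
have LL : L ^+ 2 = dot e e by rewrite sqr_sqrtr // dot_ge0.
have L0 : 0 <= L by exact: sqrtr_ge0.
have far_apart : r1 + r2 < L.
  (* Otherwise the point dividing the segment of centres in the ratio of the radii lies in both
     disks. *)
  rewrite ltNge; apply/negP => hL; pose t := r1 / (r1 + r2).
  have rr : 0 < r1 + r2 by lra.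
  have t1 : t * (r1 + r2) = r1 by rewrite divfK // gt_eqF.
  have t0 : 0 <= t by rewrite divr_ge0 // ltW.
  have t2 : (1 - t) * (r1 + r2) = r2 by rewrite mulrBl t1; ring.
  have t2' : 0 <= 1 - t by rewrite -(pmulr_rge0 _ rr) mulrC t2 ltW.
  have : (disk3 nu c1 r1 `&` disk3 nu c2 r2) (c1 + t *: e).
    split; split.
    - have -> : dot nu (c1 + t *: e - c1) = t * dot nu (c2 - c1).
        by rewrite /e !dotE !mxE; ring.
      by rewrite ne mulr0.
    - have -> : dot (c1 + t *: e - c1) (c1 + t *: e - c1) = (t * L) ^+ 2.
        by rewrite exprMn LL /e !dotE !mxE; ring.
      rewrite ler_sqr ?nnegrE ?(mulr_ge0 t0 L0) ?(ltW r10) // -[leRHS]t1.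
      by rewrite ler_wpM2l.
    - have -> : dot nu (c1 + t *: e - c2) = (t - 1) * dot nu (c2 - c1).
        by rewrite /e !dotE !mxE; ring.
      by rewrite ne mulr0.
    - have -> : dot (c1 + t *: e - c2) (c1 + t *: e - c2) = ((1 - t) * L) ^+ 2.
        by rewrite exprMn LL /e !dotE !mxE; ring.
      rewrite ler_sqr ?nnegrE ?(mulr_ge0 t2' L0) ?(ltW r20) // -[leRHS]t2.
      by rewrite ler_wpM2l.
  by rewrite dis.
have Lp : 0 < L by lra.
have bound (c x : E3) (r : R) : 0 < r -> dot (x - c) (x - c) = r ^+ 2 ->
    `|dot e (x - c)| <= L * r.
  move=> r0 h; rewrite -ler_sqr ?nnegrE ?mulr_ge0 ?(ltW r0) // exprMn LL -h -normrX.
  by rewrite ger0_norm ?sqr_ge0 // cauchy_schwarz.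
have ne_circle (c : E3) (r : R) : circle3 nu c r !=set0.
  exists (c + (r / L) *: e); split.
    have -> : dot nu (c + (r / L) *: e - c) = (r / L) * dot nu (c2 - c1).
      by rewrite /e !dotE !mxE; ring.
    by rewrite ne mulr0.
  have -> : dot (c + (r / L) *: e - c) (c + (r / L) *: e - c) = (r / L) ^+ 2 * dot e e.
    by rewrite /e !dotE !mxE; ring.
  by rewrite -LL -exprMn divfK // gt_eqF.
have mid : L * r1 < L ^+ 2 - L * r2 by rewrite expr2 -mulrBr ltr_pM2l //; lra.
have d12 : dot e c2 = dot e c1 + L ^+ 2 by rewrite LL /e !dotE !mxE; ring.
exists (circle3 nu c1 r1), (circle3 nu c2 r2), e, (dot e c1 + (L * r1 + (L ^+ 2 - L * r2)) / 2).
split=> //.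
- by apply/eqP => e0; move: LL; rewrite e0 dotE !mxE !mul0r !addr0 => /eqP; rewrite sqrf_eq0 gt_eqF.
- by move=> x [_ /(bound _ _ _ r10)]; rewrite ler_norml dotB => /andP[_]; lra.
- by move=> x [_ /(bound _ _ _ r20)]; rewrite ler_norml dotB => /andP[]; lra.
Qed.

Lemma one_side (g : R -> R) (b th : R) : 0 <= b -> continuous g ->
  (forall t, 0 <= t <= b -> g t != th) ->
  (forall t, 0 <= t <= b -> g t < th) \/ (forall t, 0 <= t <= b -> th < g t).
Proof.
move=> b0 cg gne.
have h0 : 0 <= (0 : R) <= b by rewrite lexx.
have key t : 0 <= t <= b -> ~ (Num.min (g 0) (g t) <= th <= Num.max (g 0) (g t)).
  move=> t0b h; have t0 : 0 <= t by case/andP: t0b.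
  have [|c + /eqP] := @IVT R g 0 t th t0 _ h; first exact: continuous_subspaceT.
  rewrite in_itv /= => /andP[c0 ct]; apply/negP; apply: gne.
  by rewrite c0 (le_trans ct) //; case/andP: t0b.
have [h|h|h] := ltgtP (g 0) th; last by have := gne 0 h0; rewrite h eqxx.
- left=> t tb; rewrite ltNge; apply/negP => h'; apply: (key t tb).
  by rewrite ge_min (ltW h) le_max h' orbT.
- right=> t tb; rewrite ltNge; apply/negP => h'; apply: (key t tb).
  by rewrite ge_min h' orbT le_max (ltW h).
Qed.

Lemma deg_const n1 n2 (l : label) : deg n1 n2 (fun _ _ => l) = 0.
Proof.
by rewrite /deg big1 // => i _; rewrite big1 // => j _; case: l.
Qed.

Variables t0 t1 t2 : E3.
Hypothesis nondeg : cross (t1 - t0) (t2 - t0) != 0.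

(** All differences [f t - g s] lie in the half-space where [dot e] is negative, so they contract
    linearly to the constant [- e]. *)
Lemma torus_deg_separated (f g : R -> E3) (e : E3) (th : R) :
  continuous f -> continuous g -> f 3 = f 0 -> g 4 = g 0 ->
  (forall t, 0 <= t <= 3 -> dot e (f t) < th) -> (forall s, 0 <= s <= 4 -> th < dot e (g s)) ->
  exists N0, forall N, (0 < N)%N -> (N0 <= N)%N ->
    torus_deg t0 t1 t2 N (fun t s => f t - g s) = 0.
Proof.
move=> cf cg pf pg hf hg.
have e0 : e != 0.
  apply/eqP => ez; have := hf 0; have := hg 0; rewrite ez !dotE !mxE !mul0r !addr0 !lexx.
  by rewrite !ler0n => /(_ isT) h1 /(_ isT) /(lt_trans h1); rewrite ltxx.
pose F (k t s : R) := (1 - k) *: (f t - g s) - k *: e.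
have [||||N0 P] := @torus_deg_homotopy _ _ _ _ nondeg F.
- move=> z; apply: cvgB; last by apply: cvgZr_tmp; apply: (cvg_comp _ _ cvg_fst); exact: cvg_fst.
  apply: cvgZ.
    apply: cvgB; first exact: cvg_cst.
    by apply: (cvg_comp _ _ cvg_fst); exact: cvg_fst.
  apply: cvgB.
    apply: (cvg_comp (fun z : R * R * R => z.1.2) f); last exact: cf.
    by apply: (cvg_comp _ _ cvg_fst); exact: cvg_snd.
  by apply: (cvg_comp (fun z : R * R * R => z.2) g); [exact: cvg_snd|exact: cg].
- move=> k t s k01 t03 s04; apply/eqP => /(congr1 (dot e)).
  have -> : dot e (F k t s) = (1 - k) * (dot e (f t) - dot e (g s)) - k * dot e e.
    by rewrite /F !dotE !mxE; ring.
  have -> : dot e 0 = 0 by rewrite dotE !mxE !mulr0 !addr0.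
  have h : 0 < dot e (g s) - dot e (f t) by have := hf t t03; have := hg s s04; lra.
  by have := convex_gt0 k01 h (dot_gt0 e0); lra.
- by move=> k s _; rewrite /F pf.
- by move=> k t _; rewrite /F pg.
exists N0 => N Npos NN0; have := P N Npos NN0.
have -> : F 0 = fun t s => f t - g s.
  by apply/funext => t; apply/funext => s; rewrite /F subr0 scale1r scale0r subr0.
move=> ->; have -> : F 1 = fun _ _ => - e.
  by apply/funext => t; apply/funext => s; rewrite /F subrr scale0r scale1r sub0r.
exact: (deg_const _ _ (lab t0 t1 t2 (- e))).
Qed.
End separation.

(** * The signed number of a trivial link vanishes *)

Section unlinking.
Variable R : realType.
Local Notation E3 := 'rV[R]_3.
Variables t0 t1 t2 : E3.

Lemma cross_ne0 (u v w : E3) : det3 u v w != 0 -> cross u v != 0.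
Proof.
apply: contra => /eqP h; have -> : det3 u v w = dot (cross u v) w.
  by rewrite dotE /det3 /cross !mxE /=; ring.
by rewrite h dotE !mxE !mul0r !addr0.
Qed.

(** An isotopy is continuous only relative to times in the unit interval; clamping makes it
    continuous everywhere, as [torus_deg_homotopy] requires. *)
Lemma within_clamp (H : R -> E3 -> E3) (p : R -> E3) :
  {within `[0, 1] `*` setT, continuous (fun tx : R * E3 => H tx.1 tx.2)} -> continuous p ->
  continuous (fun z : R * R => H (clamp z.1) (p z.2)).
Proof.
set D := `[0, 1] `*` setT => /subspace_continuousP cH cp z.
pose G (z : R * R) := (clamp z.1, p z.2).
have DG z' : D (G z') by split=> //=; rewrite in_itv /= clamp_itv.
have cG : G z' @[z' --> z] --> G z.
  have g1 : clamp z'.1 @[z' --> z] --> clamp z.1.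
    by apply: (cvg_comp (fst : R * R -> R) (@clamp R)); [exact: cvg_fst|exact: clamp_continuous].
  have g2 : p z'.2 @[z' --> z] --> p z.2.
    by apply: (cvg_comp (snd : R * R -> R) p); [exact: cvg_snd|exact: cp].
  exact: (cvg_pair g1 g2).
move=> V /(cH _ (DG z)) hV.
have hV' : nbhs z [set z' | D (G z') -> V (H (G z').1 (G z').2)] := cG _ hV.
change (nbhs z [set z' | V (H (G z').1 (G z').2)]).
by apply: filterS hV' => z' /=; apply; exact: DG.
Qed.

Lemma transversal_disjoint a b c d x : transversal t0 t1 t2 a b -> transversal t0 t1 t2 b c ->
  transversal t0 t1 t2 c d -> transversal t0 t1 t2 d a ->
  poly4 (tri t0 t1 t2) x -> poly4 (gon a b c d) x -> False.
Proof.
move=> h1 h2 h3 h4 hx /poly4E[] e.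
- exact: (boundary_edge_side e hx h1).
- exact: (boundary_edge_side e hx h2).
- exact: (boundary_edge_side e hx h3).
- exact: (boundary_edge_side e hx h4).
Qed.

(** The loops stay disjoint under the isotopy, so the degree can be read off at its end, where each
    loop is connected and lies on one side of the plane. Neither circle is empty, so the loops are
    on different sides and the degree is 0. *)
Theorem link4_TL a b c d : transversal t0 t1 t2 a b -> transversal t0 t1 t2 b c ->
  transversal t0 t1 t2 c d -> transversal t0 t1 t2 d a ->
  TL (tri t0 t1 t2) (gon a b c d) -> link4 t0 t1 t2 a b c d = 0.
Proof.
move=> h1 h2 h3 h4 [U /planar_unlink_separated[C1 [C2 [e [th [EU [n1 n2] e0 s1 s2]]]]]].
move=> [H [cH hH H0 H1]].
have nondeg : cross (t1 - t0) (t2 - t0) != 0.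
  by apply: (@cross_ne0 _ _ (a - t0)); case/and5P: h1.
pose f k t := H (clamp k) (loop3 t0 t1 t2 t); pose g k s := H (clamp k) (loop4 a b c d s).
have cf : continuous (fun z : R * R => f z.1 z.2) := within_clamp cH (@loop3_continuous _ t0 t1 t2).
have cg : continuous (fun z : R * R => g z.1 z.2) := within_clamp cH (@loop4_continuous _ a b c d).
have l3 : loop3 t0 t1 t2 3 = loop3 t0 t1 t2 0.
  have h0 : 0 <= (0 : R) <= 1 by rewrite lexx ler01.
  have h1' : 0 <= (1 : R) <= 1 by rewrite lexx ler01.
  have [-> _ _] := loop3E t0 t1 t2 h0; have [_ _] := loop3E t0 t1 t2 h1'.
  rewrite (_ : 2 + 1 = 3) => [->|]; last by ring.
  by rewrite subr0 subrr !scale0r !scale1r addr0 add0r.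
have l4 : loop4 a b c d 4 = loop4 a b c d 0.
  have h0 : 0 <= (0 : R) <= 1 by rewrite lexx ler01.
  have h1' : 0 <= (1 : R) <= 1 by rewrite lexx ler01.
  have [-> _ _ _] := loop4E a b c d h0; have [_ _ _] := loop4E a b c d h1'.
  rewrite (_ : 3 + 1 = 4) => [->|]; last by ring.
  by rewrite subr0 subrr !scale0r !scale1r addr0 add0r.
have in3 t : 0 <= t <= 3 -> poly4 (tri t0 t1 t2) (loop3 t0 t1 t2 t).
  by move=> h; apply/loop3_tri; exists t.
have in4 s : 0 <= s <= 4 -> poly4 (gon a b c d) (loop4 a b c d s).
  by move=> h; apply/loop4_gon; exists s.
have [||||N1 P1] := @torus_deg_homotopy _ _ _ _ nondeg (fun k t s => f k t - g k s).
- move=> z; apply: cvgB.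
    apply: (cvg_comp (fun z : R * R * R => z.1) (fun z => f z.1 z.2)); [exact: cvg_fst|exact: cf].
  have g1 : z'.1.1 @[z' --> z] --> z.1.1.
    by apply: (cvg_comp _ _ cvg_fst); exact: cvg_fst.
  have g2 : z'.2 @[z' --> z] --> z.2 by exact: cvg_snd.
  exact: (cvg_comp (fun z : R * R * R => (z.1.1, z.2)) (fun z => g z.1 z.2) (cvg_pair g1 g2)
    (cg (z.1.1, z.2))).
- move=> k t s k01 t03 s04; rewrite subr_eq0; apply/eqP => E.
  have /hH[h [hK _ _ _]] : clamp k \in `[0, 1] by rewrite in_itv /= clamp_itv.
  have /(congr1 h) := E; rewrite !hK => E'.
  by apply: (transversal_disjoint h1 h2 h3 h4 (in3 t t03)); rewrite E'; exact: in4.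
- by move=> k s _; rewrite /f l3.
- by move=> k t _; rewrite /g l4.
have [N2 P2] := torus_link4 nondeg h1 h2 h3 h4.
have c0 : clamp (0 : R) = 0 by rewrite clamp_le0.
have c1 : clamp (1 : R) = 1 by rewrite clamp_ge1.
have F0 : (fun t s => f 0 t - g 0 s) = fun t s => loop3 t0 t1 t2 t - loop4 a b c d s.
  by apply/funext => t; apply/funext => s; rewrite /f /g c0 !H0.
rewrite F0 in P1.
have cut (h : R -> R -> E3) : continuous (fun z : R * R => h z.1 z.2) -> continuous (h 1).
  move=> ch x.
  have h1' : 1 @[_ --> x] --> (1 : R) by exact: cvg_cst.
  have h2' : x' @[x' --> x] --> x by exact: cvg_id.
  exact: (cvg_comp (fun x => (1, x)) (fun z => h z.1 z.2) (cvg_pair h1' h2') (ch (1, x))).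
have {}cf := cut _ cf; have {}cg := cut _ cg.
have fU t : 0 <= t <= 3 -> (C1 `|` C2) (f 1 t).
  move=> ht; rewrite -EU -H1 /f c1; exists (loop3 t0 t1 t2 t) => //; left; exact: in3.
have gU s : 0 <= s <= 4 -> (C1 `|` C2) (g 1 s).
  move=> hs; rewrite -EU -H1 /g c1; exists (loop4 a b c d s) => //; right; exact: in4.
have Ufg x : (C1 `|` C2) x -> (exists2 t, 0 <= t <= 3 & x = f 1 t) \/
    (exists2 s, 0 <= s <= 4 & x = g 1 s).
  rewrite -EU -H1 /f /g c1 => -[y [/loop3_tri[t ht ->]|/loop4_gon[s hs ->]] <-].
    by left; exists t.
  by right; exists s.
have ne x : (C1 `|` C2) x -> dot e x != th by case=> [/s1|/s2] h; [rewrite lt_eqF|rewrite gt_eqF].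
have cdot (p : R -> E3) : continuous p -> continuous (fun t => dot e (p t)).
  by move=> cp t; apply: (cvg_comp p (dot e)); [exact: cp|exact: dot_continuous].
have o3 := @one_side _ _ 3 th (ler0n R 3) (cdot _ cf) (fun t ht => ne _ (fU t ht)).
have o4 := @one_side _ _ 4 th (ler0n R 4) (cdot _ cg) (fun t ht => ne _ (gU t ht)).
suff [N3 P3] : exists N0, forall N, (0 < N)%N -> (N0 <= N)%N ->
    torus_deg t0 t1 t2 N (fun t s => f 1 t - g 1 s) = 0.
  pose N := (N1 + N2 + N3).+1.
  by rewrite -(P2 N) ?P1 ?P3 // /N; lia.
have pf : f 1 3 = f 1 0 by rewrite /f l3.
have pg : g 1 4 = g 1 0 by rewrite /g l4.
case: o3 => o3; case: o4 => o4.
- case: n2 => x C2x; have := s2 x C2x.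
  case: (Ufg x (or_intror C2x)) => -[t ht ->] h; [have := lt_trans h (o3 t ht)|have := lt_trans h (o4 t ht)];
    by rewrite ltxx.
- exact: (torus_deg_separated nondeg cf cg pf pg o3 o4).
(* The loops have exchanged their sides, so the plane is oriented the other way. *)
- apply: (torus_deg_separated (e := - e) (th := - th) nondeg cf cg pf pg) => t ht.
    by have := o3 t ht; rewrite !dotE !mxE; lra.
  by have := o4 t ht; rewrite !dotE !mxE; lra.
- case: n1 => x C1x; have := s1 x C1x.
  case: (Ufg x (or_introl C1x)) => -[t ht ->] h; [have := lt_trans h (o3 t ht)|have := lt_trans h (o4 t ht)];
    by rewrite ltxx.
Qed.
End unlinking.

(** * Seven points in general position *)

Section orientation.
Variable R : realType.
Local Notation E3 := 'rV[R]_3.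
Variable P : nat -> E3.

Definition volp (a b c d : nat) : R := vol (P a) (P b) (P c) (P d).
Definition orient (a b c d : nat) : bool := 0 < volp a b c d.
Definition general_position := forall a b c d, valid4 a b c d -> volp a b c d != 0.

Hypothesis gp : general_position.

Lemma orientN a b c d a' b' c' d' : valid4 a b c d -> volp a' b' c' d' = - volp a b c d ->
  orient a b c d = ~~ orient a' b' c' d'.
Proof.
move=> /gp h e; rewrite /orient e oppr_gt0 -leNgt le_eqVlt eq_sym.
by rewrite (negPf h).
Qed.

Lemma sum3_sign (A B C : R) : A != 0 -> B != 0 -> C != 0 -> A + B + C = 0 ->
  (0 < A) = (0 < B) -> (0 < A) = (0 < C) -> False.
Proof.
move=> a b c e; have [h|h|/eqP h] := ltgtP A 0; last by rewrite h in a.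
- move=> /esym/negbT; rewrite -leNgt => h1 /esym/negbT; rewrite -leNgt => h2; lra.
- move=> /esym h1 /esym h2; lra.
Qed.

Lemma mul_sign (x y : R) : x != 0 -> y != 0 -> (0 < x * y) = ~~ ((0 < x) (+) (0 < y)).
Proof.
move=> a b; have [h|h|/eqP h] := ltgtP x 0; last by rewrite h in a.
- by rewrite nmulr_rgt0 //=; have [//|//|/eqP h'] := ltgtP y 0; rewrite h' in b.
- by rewrite pmulr_rgt0 //=; case: (0 < y).
Qed.

Lemma valid_mask m (s : seq nat) : uniq s && all (fun x => x < 7)%N s ->
  uniq (mask m s) && all (fun x => x < 7)%N (mask m s).
Proof.
case/andP=> us /allP ls; rewrite mask_uniq //=; apply/allP => x /mem_mask; exact: ls.
Qed.

Lemma orient_plucker x1 x2 y1 y2 y3 y4 : valid6 x1 x2 y1 y2 y3 y4 ->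
  ~~ violated id (plucker orient x1 x2 y1 y2 y3 y4).
Proof.
move=> V.
have H m := valid_mask m V.
have v1 : valid4 x1 x2 y1 y2 := H [:: true; true; true; true].
have v2 : valid4 x1 x2 y3 y4 := H [:: true; true; false; false; true; true].
have v3 : valid4 x1 x2 y1 y3 := H [:: true; true; true; false; true].
have v4 : valid4 x1 x2 y2 y4 := H [:: true; true; false; true; false; true].
have v5 : valid4 x1 x2 y1 y4 := H [:: true; true; true; false; false; true].
have v6 : valid4 x1 x2 y2 y3 := H [:: true; true; false; true; true].
have S : volp x1 x2 y1 y2 * volp x1 x2 y3 y4 + - (volp x1 x2 y1 y3 * volp x1 x2 y2 y4) +
    volp x1 x2 y1 y4 * volp x1 x2 y2 y3 = 0.
  by rewrite /volp /vol; move: (P x2 - P x1) (P y1 - P x1) (P y2 - P x1) (P y3 - P x1) (P y4 - P x1);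
    move=> a b c d e; rewrite /det3; ring.
apply/negP; rewrite /violated /tval /=; case: ifP => // /negbT e1 e2.
have nz a b c d a' b' c' d' : valid4 a b c d -> valid4 a' b' c' d' -> volp a b c d * volp a' b' c' d' != 0.
  by move=> /gp h1 /gp h2; rewrite mulf_neq0.
apply: (sum3_sign _ _ _ S); rewrite ?oppr_eq0 ?nz //.
- have opp_sign (x : R) : x != 0 -> (0 < - x) = ~~ (0 < x).
    by move=> x0; rewrite oppr_gt0 -leNgt le_eqVlt (negPf x0).
  rewrite opp_sign ?nz // !mul_sign ?gp //.
  move: e1; rewrite /orient; move: (0 < volp x1 x2 y1 y2) (0 < volp x1 x2 y3 y4).
  by move: (0 < volp x1 x2 y1 y3) (0 < volp x1 x2 y2 y4); do 4! case.
- rewrite !mul_sign ?gp //.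
  move: e2; rewrite /orient; move: (0 < volp x1 x2 y1 y2) (0 < volp x1 x2 y3 y4).
  by move: (0 < volp x1 x2 y1 y4) (0 < volp x1 x2 y2 y3); do 4! case.
Qed.

Lemma orient_chirotope : chirotope orient.
Proof.
split=> [a b c d V|a b c d V|a b c d V|]; last exact: orient_plucker.
- by apply: orientN => //; rewrite /volp; volring.
- by apply: orientN => //; rewrite /volp; volring.
- by apply: orientN => //; rewrite /volp; volring.
Qed.
End orientation.

Section link_sign.
Variable R : realType.
Local Notation E3 := 'rV[R]_3.
Variable P : nat -> E3.
Hypothesis gp : general_position P.
Local Notation orient := (orient P).

Definition valid_edge (i j x y : nat) : bool :=
  [&& valid4 6 i j x, valid4 6 i j y, valid4 x y 6 i, valid4 x y i j & valid4 x y j 6].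

Lemma pierceE i j x y f : valid_edge i j x y ->
  pierce (P 6) (P i) (P j) (P x) (P y) = pierced (edge_of orient i j x y f).
Proof.
move=> /and5P[/gp h1 /gp h2 /gp h3 /gp h4 /gp h5]; rewrite /pierce /side /=.
rewrite -!/(volp P _ _ _ _) !mul_sign // /piercing; congr (_ && _).
rewrite -[X in _ < X]oppr0 ltrNr -mulrN mul_sign ?oppr_eq0 //.
rewrite /orient oppr_gt0; have [//|//|/eqP h] := ltgtP (volp P 6 i j y) 0.
- by rewrite addbT negbK addbF.
- by rewrite addbF addbT.
- by rewrite (negPf h2) in h.
Qed.

Lemma crossing_signC (t0 t1 t2 x y : E3) :
  crossing_sign t0 t1 t2 y x = - crossing_sign t0 t1 t2 x y.
Proof.
rewrite /crossing_sign pierceC; case: ifP => [/pierce_side h|_]; last by rewrite oppr0.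
have [h1|h1|h1] := ltgtP (side t0 t1 t2 x) 0.
- by move: h; rewrite nmulr_rlt0 // => ->.
- by move: h; rewrite pmulr_rlt0 // => /lt_gtF ->.
- by rewrite h1 mul0r ltxx in h.
Qed.

(** [link4] follows the 4-cycle, whereas [edge_of] reads the edges between [m] and [l] and between
    [k] and [n] against it; [crossing_signC] accounts for their flips. *)
Lemma link4_unbalanced i j k l m n : valid_edge i j k l -> valid_edge i j m l ->
  valid_edge i j m n -> valid_edge i j k n ->
  (link4 (P 6) (P i) (P j) (P k) (P l) (P m) (P n) != 0) =
  unbalanced pierced sign [:: edge_of orient i j k l false; edge_of orient i j m l true;
    edge_of orient i j m n false; edge_of orient i j k n true].
Proof.
move=> h1 h2 h3 h4; rewrite /link4 (crossing_signC _ _ _ (P m) (P l)) (crossing_signC _ _ _ (P k) (P n)).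
rewrite /crossing_sign (pierceE false h1) (pierceE true h2) (pierceE false h3) (pierceE true h4).
have sE x f : sign (edge_of orient i j x l f) = (0 < side (P 6) (P i) (P j) (P x)) (+) f by [].
have sE' x f : sign (edge_of orient i j x n f) = (0 < side (P 6) (P i) (P j) (P x)) (+) f by [].
rewrite /unbalanced /= !sE !sE'.
move: (piercing _ _ _ _ _) (piercing _ _ _ _ _) (piercing _ _ _ _ _) (piercing _ _ _ _ _).
by move: (0 < side _ _ _ _) (0 < side _ _ _ _); do 6! case.
Qed.

Definition valid_link (i j k l m n : nat) : bool :=
  [&& valid_edge i j k l, valid_edge i j m l, valid_edge i j m n, valid_edge i j k n &
   [&& valid4 k n m l, valid4 k l m 6, valid4 l m n 6, valid4 m n k 6 & valid4 n k l 6]].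

Lemma valid_edge_transversal i j x y : valid_edge i j x y ->
  transversal (P 6) (P i) (P j) (P x) (P y) && transversal (P 6) (P i) (P j) (P y) (P x).
Proof.
move=> /and5P[/gp h1 /gp h2 /gp h3 /gp h4 /gp h5]; rewrite /transversal /side.
have sw (a b c d : E3) : vol a b c d = - vol b a c d by volring.
by rewrite h1 h2 h3 h4 h5 !(sw (P y) (P x)) !oppr_eq0 h3 h4 h5.
Qed.

Lemma TL_unbalanced i j k l m n : valid_link i j k l m n ->
  TL (tri (P 6) (P i) (P j)) (gon (P k) (P l) (P m) (P n)) <->
  ~~ unbalanced pierced sign [:: edge_of orient i j k l false; edge_of orient i j m l true;
    edge_of orient i j m n false; edge_of orient i j k n true].
Proof.
case/and5P=> v1 v2 v3 v4 /and5P[v5 v6 v7 v8 v9]; rewrite -link4_unbalanced // negbK.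
have /andP[t1 _] := valid_edge_transversal v1; have /andP[_ t2] := valid_edge_transversal v2.
have /andP[t3 _] := valid_edge_transversal v3; have /andP[_ t4] := valid_edge_transversal v4.
split=> [/(link4_TL t1 t2 t3 t4) ->//|/eqP h].
have : generic_link (P 6) (P i) (P j) (P k) (P l) (P m) (P n).
  rewrite /generic_link t1 t2 t3 t4 /=.
  by rewrite (gp v5) (gp v6) (gp v7) (gp v8) (gp v9).
by move/TL_link4/(_ h); apply: TL_poly4 => //; rewrite -poly4_rev.
Qed.

Definition link_data (i j : nat) : seq nat :=
  let: (k, m) := others i in let: (l, n) := others j in [:: i; 3 + j; k; 3 + l; m; 3 + n]%N.

Definition triangle_link (i j : nat) : Prop :=
  if link_data i j is [:: i'; j'; k; l; m; n] then
    TL (tri (P 6) (P i') (P j')) (gon (P k) (P l) (P m) (P n)) else True.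

Lemma triangle_linkE i j : (i < 3)%N -> (j < 3)%N ->
  triangle_link i j <-> ~~ unbalanced pierced sign (link_edges orient i j).
Proof.
by case: i => [|[|[|]]] // _; case: j => [|[|[|]]] // _; exact: TL_unbalanced.
Qed.
End link_sign.

(** * From edge sets to polygons *)

Section supports.
Variable R : realType.
Local Notation E3 := 'rV[R]_3.
Variable f : K331_vertex -> E3.
Let P (n : nat) : E3 := f (vertex n).

Lemma set2_inj (T : finType) (u v x y : T) : ([set u; v] = [set x; y])%SET ->
  (u = x /\ v = y) \/ (u = y /\ v = x).
Proof.
move=> h; have : u \in [set x; y]%SET by rewrite -h set21.
have : v \in [set x; y]%SET by rewrite -h set22.
case/set2P=> ev /set2P[] eu; [| |by left|].
- have : y \in [set u; v]%SET by rewrite h set22.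
  by rewrite eu ev => /set2P[] ->; left.
- by right.
- have : x \in [set u; v]%SET by rewrite h set21.
  by rewrite eu ev => /set2P[] ->; left.
Qed.

Definition realize (C : {set {set K331_vertex}}) : set E3 :=
  [set p | exists u v, [set u; v]%SET \in C /\ segment (f u) (f v) p].

Lemma realizeU (C C' : {set {set K331_vertex}}) :
  realize (C :|: C')%SET = realize C `|` realize C'.
Proof.
apply/seteqP; split=> p.
  move=> [u [v []]]; rewrite inE => /orP[] h s; [left|right]; by exists u, v.
by case=> -[u [v [h s]]]; exists u, v; rewrite inE h ?orbT.
Qed.

Lemma realize1 u v : realize [set [set u; v]]%SET = on_edge (f u) (f v).
Proof.
apply/seteqP; split=> p => [[x [y []]]|h]; last by exists u, v; rewrite inE eqxx; split=> //; apply/segmentP.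
by rewrite inE => /eqP/set2_inj[[-> ->]|[-> ->]] /segmentP // /on_edgeC.
Qed.

Lemma realize_edges3 x y z : realize (edges3 x y z) = poly4 (tri (f x) (f y) (f z)).
Proof.
rewrite /edges3 !realizeU !realize1; apply/seteqP; split=> p; rewrite poly4_tri.
  by move=> [[]|] h; [apply: Or31|apply: Or32|apply: Or33].
by case=> h; [left; left|left; right|right].
Qed.

Lemma realize_edges4 x y z w : realize (edges4 x y z w) = poly4 (gon (f x) (f y) (f z) (f w)).
Proof.
rewrite /edges4 !realizeU !realize1; apply/seteqP; split=> p; rewrite poly4E.
  by move=> [[[]|]|] h; [apply: Or41|apply: Or42|apply: Or43|apply: Or44].
by case=> h; [left; left; left|left; left; right|left; right|right].
Qed.

Lemma link_support_klink (i j : 'I_3) :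
  trivial_link (link_support f (klink i j)) <-> triangle_link P i j.
Proof.
have -> : link_support f (klink i j) = realize (tri_edges i j) `|` realize (quad_edges i j).
  by rewrite -realizeU -cover_klink.
rewrite /tri_edges realize_edges3 -(vertex_a i) -(vertex_b j) /triangle_link /link_data /quad_edges.
by case: (others i) => k m; case: (others j) => l n; rewrite realize_edges4.
Qed.

Lemma card_nontrivial_links : general_position P ->
  #|nontrivial_links K331 f| = nlinked (all_edges (orient P)).
Proof.
move=> gp; pose u (ij : 'I_3 * 'I_3) := unbalanced pierced sign (link_edges (orient P) ij.1 ij.2).
have -> : nontrivial_links K331 f = [set klink ij.1 ij.2 | ij in [set ij | u ij]]%SET.
  apply/finset.setP => L; rewrite inE; apply/asboolP/imsetP.
    case=> /two_linkP[i [j ->]] nt; exists (i, j) => //; rewrite inE.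
    by apply: contra_notT nt => h; apply/link_support_klink/triangle_linkE.
  move=> [[i j]]; rewrite inE => h ->; split; first by apply/two_linkP; exists i, j.
  by move/link_support_klink/(triangle_linkE gp (ltn_ord i) (ltn_ord j)); apply/negP; rewrite negbK.
rewrite (card_imset _ klink_inj).
transitivity (\sum_(ij : 'I_3 * 'I_3) (u (ij.1, ij.2) : nat))%N.
  rewrite -sum1dep_card big_mkcond; apply: eq_bigr => -[i j] _.
  by case: (u (i, j)).
rewrite -(pair_bigA _ (fun i j => (u (i, j) : nat))) /= !big_ord_recr !big_ord0 /= /u.
by rewrite /nlinked /all_edges /= !add0n !addn0 !addnA.
Qed.
End supports.

(** * Stability of the nontrivial links *)

Section embeddings.
Variable R : realType.
Local Notation E3 := 'rV[R]_3.

Lemma edge_pt_vertex (V : finType) (f : V -> E3) (u v w : V) (s : R) : f u != f v ->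
  w \in [set u; v]%SET -> edge_pt f u v s = f w -> forall z, edge_wt u v s z = (z == w)%:R.
Proof.
move=> uv /set2P[] -> e z.
  have /eqP : s *: (f v - f u) = 0.
    transitivity (edge_pt f u v s - f u); last by rewrite e subrr.
    by rewrite /edge_pt; vring.
  rewrite scaler_eq0 subr_eq0 [f v == _]eq_sym (negPf uv) orbF => /eqP ->.
  by rewrite /edge_wt; ring.
have /eqP : (1 - s) *: (f u - f v) = 0.
  transitivity (edge_pt f u v s - f v); last by rewrite e subrr.
  by rewrite /edge_pt; vring.
rewrite scaler_eq0 !subr_eq0 (negPf uv) orbF => /eqP <-.
by rewrite /edge_wt; ring.
Qed.

Lemma edge_pt_inj (V : finType) (f : V -> E3) (u v : V) (s t : R) : f u != f v ->
  edge_pt f u v s = edge_pt f u v t -> s = t.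
Proof.
move=> uv h; have /eqP : (s - t) *: (f v - f u) = 0.
  transitivity (edge_pt f u v s - edge_pt f u v t); last by rewrite h subrr.
  by rewrite /edge_pt; vring.
by rewrite scaler_eq0 !subr_eq0 orbC eq_sym (negPf uv) => /eqP.
Qed.

Lemma linear_embedding_emb (V : finType) (e : rel V) (f : V -> E3) : irreflexive e ->
  linear_embedding e f -> emb e f.
Proof.
move=> ie [fi _ fe] u v x y uv xy s t s01 t01 h.
have nuv : f u != f v.
  by apply: contraTneq uv => /fi ->; rewrite ie.
have nxy : f x != f y.
  by apply: contraTneq xy => /fi ->; rewrite ie.
have [E|ne] := eqVneq [set u; v]%SET [set x; y]%SET.
  case: (set2_inj E) => -[eu ev]; move: h; rewrite -eu -ev.
    by move/(edge_pt_inj nuv) => ->.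
  by rewrite edge_ptC => h z; rewrite edge_wtC (edge_pt_inj _ h) // eq_sym.
have s1 : segment (f u) (f v) (edge_pt f u v s) by apply/segmentP; exists s.
have s2 : segment (f x) (f y) (edge_pt f u v s) by apply/segmentP; exists t.
have [w] := fe _ _ _ _ uv xy ne _ s1 s2; rewrite inE => /andP[w1 w2] ew.
move=> z; rewrite (edge_pt_vertex nuv w1 ew) (edge_pt_vertex nxy w2) //.
by rewrite -h.
Qed.

(** A lower Lipschitz bound for the graph serves all its subgraphs, so one [d] works for all links
    at once. *)
Lemma emb_subgraphs (V : finType) (e : rel V) (f : V -> E3) : irreflexive e -> emb e f ->
  exists2 d, 0 < d & forall g, (forall w, `|g w - f w| <= d) -> forall e' : rel V, subrel e' e ->
  ambient_isotopic (carrier e' f) (carrier e' g) /\ ambient_isotopic (carrier e' g) (carrier e' f).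
Proof.
move=> ie /(emb_boundP ie)[c c0 cP].
exists (c / 3) => [|g gf e' sub]; first by rewrite divr_gt0.
have cP' : emb_bound e' f c by move=> u v x y s t uv xy; apply: cP; exact: sub.
have c3 : 0 < c - c / 3 by lra.
split; first by apply: (emb_bound_isotopic c0 cP' gf); lra.
apply: (emb_bound_isotopic c3 (emb_bound_near cP' gf) (d := c / 3)); last lra.
by move=> w; rewrite distrC.
Qed.

Lemma two_link_edges L u v : two_link K331 L -> [set u; v]%SET \in finset.cover L -> K331 u v.
Proof.
case=> C1 [C2 [g1 g2 _ ->]] /bigcupP[C]; rewrite in_set2.
have H C' : graph_cycle K331 C' -> [set u; v]%SET \in C' -> K331 u v.
  case=> c [uc _ ->] /imsetP[x xc] /set2_inj[] [-> ->]; last rewrite /K331 eq_sym.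
    exact: next_cycle (ucycle_cycle uc) xc.
  exact: (next_cycle (ucycle_cycle uc) xc).
by case/orP=> /eqP ->; exact: H.
Qed.

Lemma nontrivial_links_stable (f : K331_vertex -> E3) : linear_embedding K331 f ->
  exists2 d, 0 < d & forall g, (forall w, `|g w - f w| <= d) ->
    nontrivial_links K331 g = nontrivial_links K331 f.
Proof.
have ie : irreflexive K331 by move=> u; rewrite /K331 eqxx.
move=> /(linear_embedding_emb ie)/(emb_subgraphs ie)[d d0 dP].
exists d => // g /dP{}dP; apply/finset.setP => L; rewrite !inE; apply/asbool_equiv_eq.
have E h : link_support h L = carrier (fun u v => [set u; v]%SET \in finset.cover L) h by [].
split=> -[tL nt]; split=> // h; apply: nt.
  have [|h1 h2] := dP (fun u v => [set u; v]%SET \in finset.cover L).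
    by move=> u v; exact: two_link_edges.
  by move: h; rewrite !E; exact: trivial_link_isotopic.
have [|h1 h2] := dP (fun u v => [set u; v]%SET \in finset.cover L).
  by move=> u v; exact: two_link_edges.
by move: h; rewrite !E; exact: trivial_link_isotopic.
Qed.
End embeddings.

(** * Perturbation into general position *)

Section generic.
Variable R : realType.
Local Notation E3 := 'rV[R]_3.

Definition moment (n : nat) : E3 := vec3 n%:R (n%:R ^+ 2) (n%:R ^+ 3).

(** On the moment curve the volume is a Vandermonde determinant. *)
Lemma vol_moment (a b c d : nat) : uniq [:: a; b; c; d] ->
  vol (moment a) (moment b) (moment c) (moment d) != 0.
Proof.
have -> : vol (moment a) (moment b) (moment c) (moment d) =
    (b%:R - a%:R) * (c%:R - a%:R) * (d%:R - a%:R) * (c%:R - b%:R) * (d%:R - b%:R) * (d%:R - c%:R).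
  by rewrite /vol /det3 /moment !mxE /=; ring.
rewrite /= !inE !negb_or => /and4P[/and3P[ab ac ad] /andP[bc bd] cd _].
by rewrite !mulf_neq0 // subr_eq0 eqr_nat eq_sym.
Qed.

(** The coefficient of [t^3] is the volume of the four directions. *)
Lemma vol_path (a b c d a' b' c' d' : E3) : vol a' b' c' d' != 0 -> exists2 p : {poly R}, p != 0 &
  forall t, p.[t] = vol (a + t *: a') (b + t *: b') (c + t *: c') (d + t *: d').
Proof.
move=> h.
pose e0 := vol a b c d.
pose e1 := det3 (b' - a') (c - a) (d - a) + det3 (b - a) (c' - a') (d - a) + det3 (b - a) (c - a) (d' - a').
pose e2 := det3 (b - a) (c' - a') (d' - a') + det3 (b' - a') (c - a) (d' - a')
  + det3 (b' - a') (c' - a') (d - a).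
exists (e0%:P + e1 *: 'X + e2 *: 'X^2 + vol a' b' c' d' *: 'X^3).
  apply/negP => /eqP/(congr1 (fun p : {poly R} => p`_3)) /eqP.
  by rewrite !coefE /= !mulr0 !add0r mulr1 (negPf h).
move=> t; rewrite !(hornerD, hornerZ, hornerC, hornerX, hornerXn) /e0 /e1 /e2 /vol /det3 !mxE; ring.
Qed.

Definition seq4 : seq (nat * nat * (nat * nat)) :=
  [seq (ab, cd) | ab <- [seq (a, b) | a <- iota 0 7, b <- iota 0 7],
                  cd <- [seq (a, b) | a <- iota 0 7, b <- iota 0 7]].

Lemma mem_seq4 a b c d : valid4 a b c d -> ((a, b), (c, d)) \in seq4.
Proof.
move=> /andP[_ /and5P[la lb lc ld _]].
have H x y : (x < 7)%N -> (y < 7)%N -> (x, y) \in [seq (a, b) | a <- iota 0 7, b <- iota 0 7].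
  by move=> hx hy; apply: allpairs_f; rewrite mem_iota.
exact: allpairs_f (H _ _ la lb) (H _ _ lc ld).
Qed.

Lemma generic_perturbation (P : nat -> E3) (e : R) : 0 < e -> exists2 t, 0 < t <= e &
  general_position (fun n => P n + t *: moment n).
Proof.
move=> e0.
have /choice[p pP] : forall q : nat * nat * (nat * nat), exists p : {poly R}, p != 0 /\
    (valid4 q.1.1 q.1.2 q.2.1 q.2.2 -> forall t, p.[t] =
     volp (fun n => P n + t *: moment n) q.1.1 q.1.2 q.2.1 q.2.2).
  (* At invalid quadruples the constant polynomial 1 keeps the product nonzero. *)
  move=> [[a b] [c d]] /=; case V : (valid4 a b c d); last by exists 1; rewrite oner_neq0.
  have /andP[u _] := V; have [p p0 pE] := vol_path (P a) (P b) (P c) (P d) (vol_moment u).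
  by exists p.
have nz : \prod_(q <- seq4) p q != 0 by rewrite prodf_seq_neq0; apply/allP => q _; exact: (pP q).1.
have [t te tr] := nonroot_small nz e0; exists t => // a b c d V.
move: tr; rewrite horner_prod prodf_seq_neq0 => /allP /(_ _ (mem_seq4 V)) /=.
by rewrite (pP _).2.
Qed.

Lemma moment_bound : exists2 M, 0 < M & forall n, (n < 7)%N -> `|moment n| <= M.
Proof.
exists (1 + \sum_(i < 7) `|moment i|); first by rewrite ltr_pwDl // sumr_ge0.
move=> n n7; rewrite (bigD1 (Ordinal n7)) //= addrCA lerDl.
by rewrite addr_ge0 // sumr_ge0.
Qed.
End generic.

(** * General position gives linear embeddings *)

Section general_embedding.
Variable R : realType.
Local Notation E3 := 'rV[R]_3.
Variable f : K331_vertex -> E3.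
Hypothesis gp : general_position (fun n => f (vertex n)).

Lemma mem_vertices u : u \in vertices.
Proof.
have p0 (o : 'I_1) : inr o = pvert by congr inr; rewrite (ord1 o).
case: u => [[i|j]|o]; last by rewrite p0.
- have -> : inl (inl i) = vertex i by rewrite vertex_a.
  by rewrite mem_nth //; apply: ltn_trans (ltn_ord i) _.
- have -> : inl (inr j) = vertex (3 + j) by rewrite vertex_b.
  by rewrite mem_nth // -[size _]/(3 + 4)%N ltn_add2l; apply: ltn_trans (ltn_ord j) _.
Qed.

Lemma gp_vol (u v w z : K331_vertex) : uniq [:: u; v; w; z] -> vol (f u) (f v) (f w) (f z) != 0.
Proof.
have E x : f x = f (vertex (index x vertices)) by rewrite /vertex nth_index ?mem_vertices.
move=> U; rewrite (E u) (E v) (E w) (E z); apply: gp; apply/andP; split.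
  rewrite -[X in uniq X]/(map (index^~ vertices) [:: u; v; w; z]) map_inj_in_uniq // => x y _ _ e.
  by rewrite -(nth_index pvert (mem_vertices x)) e nth_index ?mem_vertices.
have H x : (index x vertices < 7)%N by have := mem_vertices x; rewrite -index_mem.
by rewrite /= !H.
Qed.

Lemma fresh_vertex (s : seq K331_vertex) : (size s < 7)%N -> exists z, z \notin s.
Proof.
move=> s7; apply: contrapT => h.
suff : (size vertices <= size s)%N by rewrite leqNgt s7.
apply: uniq_leq_size => // x _; apply/negPn/negP => xs; by apply: h; exists x.
Qed.

Lemma gp_not_collinear (u v w : K331_vertex) (r s : R) : uniq [:: u; v; w] ->
  f u + r *: (f v - f u) = f u + s *: (f w - f u) -> r = 0.
Proof.
move=> U e; have [z zs] := @fresh_vertex [:: u; v; w] isT.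
have /gp_vol h : uniq [:: u; v; w; z].
  by rewrite -[_ :: _]/(rcons [:: u; v; w] z) rcons_uniq zs.
apply/eqP; rewrite -[_ == 0]orbF -(negPf h) -mulf_eq0; apply/eqP.
have {}e : r *: (f v - f u) = s *: (f w - f u) by exact: addrI e.
rewrite /vol; transitivity (det3 (r *: (f v - f u)) (f w - f u) (f z - f u)).
  by rewrite /det3 !mxE; ring.
by rewrite e /det3 !mxE; ring.
Qed.

Lemma gp_injective : injective f.
Proof.
move=> u v e; apply/eqP/negPn/negP => uv.
have [w] := @fresh_vertex [:: u; v] isT; rewrite !inE negb_or => /andP[wu wv].
have : (1 : R) = 0.
  apply: (@gp_not_collinear u v w 1 0).
    by rewrite /= !inE negb_or uv andbT eq_sym wu eq_sym wv.
  by rewrite e; vring.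
by move/eqP; rewrite oner_eq0.
Qed.

Lemma gp_share (u v w : K331_vertex) p : uniq [:: u; v; w] -> segment (f u) (f v) p ->
  segment (f u) (f w) p -> p = f u.
Proof.
move=> U /segmentP[r _ ->] /segmentP[s _ e].
have r0 : r = 0.
  apply: (@gp_not_collinear u v w r s U).
  by transitivity ((1 - r) *: f u + r *: f v); [vring|rewrite e; vring].
by rewrite r0; vring.
Qed.

Lemma segmentC (a b : E3) p : segment a b p -> segment b a p.
Proof. by move=> /segmentP/on_edgeC/segmentP. Qed.

(** Two edges at a common vertex that meet elsewhere would be collinear, and two disjoint edges that
    meet would be coplanar; either way some volume would vanish. *)
Lemma gp_linear_embedding : linear_embedding K331 f.
Proof.
have ne u v : K331 u v -> u != v by apply: contraTneq => ->; rewrite /K331 eqxx.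
split; first exact: gp_injective.
- move=> w u v /ne uv h; apply/negPn/negP; rewrite !inE negb_or => /andP[wu wv].
  have /gp_injective e : f w = f u.
    apply: (@gp_share u v w) => //; first by rewrite /= !inE negb_or uv eq_sym wu eq_sym wv.
    by apply/segmentP; exists 1; [rewrite ler01 lexx|vring].
  by rewrite e eqxx in wu.
move=> u v x y /ne uv /ne xy d p s1 s2.
have [ux|ux] := eqVneq u x.
  exists u; first by rewrite !inE ux !eqxx.
  apply: (@gp_share u v y) => //; last by rewrite ux.
  rewrite /= !inE negb_or uv ux xy /= andbT; apply: contraNneq d => ->; by rewrite ux.
have [vy|vy] := eqVneq v y.
  exists v; first by rewrite !inE vy !eqxx !orbT.
  apply: (@gp_share v u x) => //; [|exact: segmentC|by rewrite vy; exact: segmentC].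
  by rewrite /= !inE !negb_or (eq_sym v u) uv ux vy (eq_sym y x) xy.
have [uy|uy] := eqVneq u y.
  exists u; first by rewrite !inE uy !eqxx !orbT.
  apply: (@gp_share u v x) => //; last by rewrite uy; exact: segmentC.
  rewrite /= !inE negb_or uv ux /= andbT; apply: contraNneq d => ->; by rewrite uy set2C.
have [vx|vx] := eqVneq v x.
  exists v; first by rewrite !inE vx !eqxx !orbT.
  apply: (@gp_share v u y) => //; [|exact: segmentC|by rewrite vx].
  by rewrite /= !inE !negb_or (eq_sym v u) uv vy uy.
have /gp_vol/eqP [] : uniq [:: u; v; x; y] by rewrite /= !inE !negb_or uv ux uy vx vy xy.
move/segmentP: s1 => [s _ e]; have z := vol_on_edge0 _ ((segmentP _ _ _).1 s2).
transitivity (vol p (f v) (f x) (f y) - vol p (f u) (f x) (f y)); last by rewrite !z subrr.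
by rewrite e; volring.
Qed.
End general_embedding.

Lemma eq_all_edges (T : Type) (q q' : nat -> nat -> nat -> nat -> T) :
  (forall a b c d, (a < 7)%N -> (b < 7)%N -> (c < 7)%N -> (d < 7)%N -> q a b c d = q' a b c d) ->
  all_edges q = all_edges q'.
Proof. by move=> E; rewrite /all_edges /link_edges /= /edge_of !E. Qed.

(** * Examples with integer coordinates *)

Section integer_points.
Variable R : realType.
Local Notation E3 := 'rV[R]_3.
Local Notation point := (int * int * int)%type.

Definition sub3 (a b : point) : point := (a.1.1 - b.1.1, a.1.2 - b.1.2, a.2 - b.2).
Definition int_vol (a b c d : point) : int :=
  let: (u0, u1, u2) := sub3 b a in let: (v0, v1, v2) := sub3 c a in
  let: (w0, w1, w2) := sub3 d a in
  u0 * (v1 * w2 - v2 * w1) - u1 * (v0 * w2 - v2 * w0) + u2 * (v0 * w1 - v1 * w0).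

Definition real_point (a : point) : E3 := vec3 a.1.1%:~R a.1.2%:~R a.2%:~R.

Lemma vol_real_point a b c d :
  vol (real_point a) (real_point b) (real_point c) (real_point d) = (int_vol a b c d)%:~R.
Proof.
rewrite /int_vol /vol /det3 /real_point !mxE /=.
by rewrite !(intrD, intrM, mulrNz).
Qed.

Variable Q : seq point.

Definition int_orient (a b c d : nat) : bool :=
  0 < int_vol (nth 0 Q a) (nth 0 Q b) (nth 0 Q c) (nth 0 Q d).

Definition placement (v : K331_vertex) : E3 := real_point (nth 0 Q (index v vertices)).

Definition int_general : bool := all (fun q : nat * nat * (nat * nat) =>
  valid4 q.1.1 q.1.2 q.2.1 q.2.2 ==>
  (int_vol (nth 0 Q q.1.1) (nth 0 Q q.1.2) (nth 0 Q q.2.1) (nth 0 Q q.2.2) != 0)) seq4.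

Lemma placement_vertex n : (n < 7)%N -> placement (vertex n) = real_point (nth 0 Q n).
Proof. by rewrite /placement; do 7! [case: n => [//|n]]. Qed.

(** For integer points the orientations are found by computation and hold over every [R]. *)
Lemma int_realizable n : int_general -> nlinked (all_edges int_orient) = n ->
  exists f : K331_vertex -> E3, linear_embedding K331 f /\ #|nontrivial_links K331 f| = n.
Proof.
move=> /allP ig <-; exists placement.
have gp : general_position (fun n => placement (vertex n)).
  move=> a b c d V; have := ig _ (mem_seq4 V); rewrite /= V /= => h.
  move: V => /andP[_ /and5P[la lb lc ld _]].
  by rewrite /volp !placement_vertex // vol_real_point intr_eq0.
split; first exact: gp_linear_embedding.
rewrite card_nontrivial_links //; congr nlinked; apply: eq_all_edges => a b c d la lb lc ld.
by rewrite /orient /volp !placement_vertex // vol_real_point ltr0z.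
Qed.
End integer_points.

(* The coordinates were found by random search. *)
Lemma realizable (R : realType) n : n \in [:: 1; 2; 3; 4; 5]%N ->
  exists f : K331_vertex -> 'rV[R]_3, linear_embedding K331 f /\ #|nontrivial_links K331 f| = n.
Proof.
rewrite !inE => /or4P[/eqP|/eqP|/eqP|/orP[]/eqP] ->.
- by apply: (@int_realizable R [:: (1,-3,-1); (-2,1,-2); (1,1,2); (1,-3,1); (-1,0,0); (0,1,-1); (-1,3,-1)]);
    vm_compute.
- by apply: (@int_realizable R [:: (-2,-1,3); (1,3,2); (-3,4,3); (-4,2,-1); (2,0,-2); (-2,2,-4); (-4,-4,3)]);
    vm_compute.
- by apply: (@int_realizable R [:: (2,1,-2); (2,-3,-1); (2,0,-3); (-1,-3,2); (-2,0,0); (0,-3,3); (-1,-1,-2)]);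
    vm_compute.
- by apply: (@int_realizable R [:: (1,-3,0); (-2,0,0); (3,-1,-2); (2,-3,-3); (1,-1,-2); (-1,-3,-1); (-2,-1,-1)]);
    vm_compute.
- by apply: (@int_realizable R [:: (-2,3,-2); (1,-1,-2); (0,3,0); (2,-2,-1); (-2,-1,3); (1,2,2); (0,-2,0)]);
    vm_compute.
Qed.

Lemma nontrivial_links_range (R : realType) (f : K331_vertex -> 'rV[R]_3) :
  linear_embedding K331 f -> #|nontrivial_links K331 f| \in [:: 1; 2; 3; 4; 5]%N.
Proof.
move=> ef; have [d d0 dP] := nontrivial_links_stable ef.
have [M M0 MP] := moment_bound R.
(* With [t] at most [d / M] no vertex moves by more than [d], so [f] keeps its set of nontrivial
   links. *)
have [t /andP[t0 td] gp] := generic_perturbation (fun n => f (vertex n)) (divr_gt0 d0 M0).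
pose g v := f v + t *: moment R (index v vertices).
have gE k : (k < 7)%N -> g (vertex k) = f (vertex k) + t *: moment R k.
  by move=> k7; rewrite /g index_uniq.
have gp' : general_position (fun n => g (vertex n)).
  move=> a b c e V; have := gp a b c e V; rewrite /volp.
  by move: V => /andP[_ /and5P[la lb lc ld _]]; rewrite !gE.
rewrite -(dP g) => [|v].
  rewrite card_nontrivial_links //.
  by have := linked_bounds (orient_chirotope gp'); case: (nlinked _) => [|[|[|[|[|[|k]]]]]].
rewrite /g addrAC subrr add0r normrZ ger0_norm ?(ltW t0) //.
apply: (@le_trans _ _ (d / M * M)); last by rewrite divfK // gt_eqF.
apply: ler_pM => //; first exact: ltW.
by apply: MP; have := mem_vertices v; rewrite -index_mem.
Qed.

Local Close Scope ring_scope.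
Local Close Scope classical_set_scope.

Theorem theorem1 (R : realType) (n : nat) :
  (exists f : K331_vertex -> 'rV[R]_3,
     linear_embedding K331 f /\ #|nontrivial_links K331 f| = n)
  <-> n \in [:: 1; 2; 3; 4; 5].
Proof.
by split=> [[f [ef <-]]|]; [exact: nontrivial_links_range|exact: realizable].
Qed.
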